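(* Let $\gamma\in(0,1)$. There exists a constant $c_\gamma>0$ depending only on $\gamma$ such that for all $d\in\mathbb N^*$, $\pi\in\mathbf P$ and integers $k\ge3$, $$\rho^*_\gamma(H_0^{(\mathrm{Clo})},H_1^{(\mathrm{Clo})};\pi,k)\ \le\ c_\gamma\Bigg(\min_{I\ge J_\pi}\Bigg[\Big(\sqrt I\,\frac{\log k}{k}\Big)\vee\Big(\frac{\sqrt I}{\sqrt k}\Big(\sum_{i\le d}\pi_i^2e^{-k\pi_i/2}\Big)^{1/4}\Big)\vee\sum_{i\ge I}\pi_{(i)}\Bigg]\ \vee\ \frac{1}{\sqrt k}\Big(\sum_{i\le J_\pi}\pi_{(i)}^{2/3}\Big)^{3/4}\ \vee\ \sqrt{\frac{\log k}{k}}\Bigg).$$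
   Context: Notation: $a\vee b=\max(a,b)$. For $d\in\mathbb N^*$, $\mathbf P=\{\pi\in(\mathbb R^+)^d:\sum_{i\le d}\pi_i=1\}$. For $\pi\in\mathbf P$ and $i\in\mathbb Z$, $S_\pi(i)=\{j\in\{1,\dots,d\}:\pi_j\in[2^{-i},2^{-i+1})\}$, and $$\mathbf P_\pi=\Big\{q\in\mathbf P:\ \forall i\in\mathbb Z,\ \tfrac{|S_\pi(i)|}{2}\le\sum_{j=i-1}^{i+1}|S_q(j)|\le\tfrac32\sum_{j=i-2}^{i+2}|S_\pi(j)|\Big\}.$$ For $u\in\mathbb R^d$, $u_{(1)}\ge\dots\ge u_{(d)}$ are the entries of $u$ in decreasing order and $J_u=\min\{j\le d:u_{(j)}\le 1/k\}$ (with the convention $\min\emptyset=d$). $I$ ranges over integers. Under $\mathbb P_{p,q}$ one observes two independent samples $\mathcal X=(\mathcal X_1,\dots,\mathcal X_k)$ and $\mathcal Y=(\mathcal Y_1,\dots,\mathcal Y_k)$, where the $\mathcal X_i$ are i.i.d. with $\mathbb P(\mathcal X_i=j)=p_j$ and the $\mathcal Y_i$ are i.i.d. with $\mathbb P(\mathcal Y_i=j)=q_j$, $j\in\{1,\dots,d\}$. The closeness testing hypotheses are $$H_0^{(\mathrm{Clo})}(\pi)=\{(p,q)\in\mathbf P_\pi^2:p=q\},\qquad H_1^{(\mathrm{Clo})}(\pi,\rho)=\{(p,q)\in\mathbf P\times\mathbf P_\pi:\|p-q\|_1\ge\rho\}.$$ A test $\varphi$ is a $\{0,1\}$-valued decision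 rule based on $(\mathcal X,\mathcal Y)$. Its risk is $$R(H_0(\pi),H_1(\pi,\rho),\varphi;k)=\sup_{(p,q)\in H_0(\pi)}\mathbb P_{p,q}(\varphi(\mathcal X,\mathcal Y)=1)+\sup_{(p,q)\in H_1(\pi,\rho)}\mathbb P_{p,q}(\varphi(\mathcal X,\mathcal Y)=0),$$ and for $\gamma\in(0,1)$ the local minimax separation distance is $$\rho^*_\gamma(H_0,H_1;\pi,k)=\inf_\varphi\ \inf\{\rho>0:R(H_0(\pi),H_1(\pi,\rho),\varphi;k)\le\gamma\}.$$ *)

(* Defs.v *)
From HB Require Import structures.
From mathcomp Require Import all_boot all_order all_algebra.
From mathcomp Require Import all_classical all_reals ereal sequences exp.

Set Implicit Arguments.
Unset Strict Implicit.
Unset Printing Implicit Defensive.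

Import Order.TTheory GRing.Theory Num.Theory.
Local Open Scope classical_set_scope.
Local Open Scope ring_scope.

Definition simplex (R : realType) (d : nat) : set ('I_d -> R) :=
  [set p | (forall j, 0 <= p j) /\ \sum_j p j = 1].
Arguments simplex : clear implicits.

Definition dyadic_class (R : realType) (d : nat) (u : 'I_d -> R) (i : int) :
    {set 'I_d} :=
  [set j | (2 ^ (- i) <= u j) && (u j < 2 ^ (- i + 1))]%SET.

Definition neighborhood (R : realType) (d : nat) (pi : 'I_d -> R) :
    set ('I_d -> R) :=
  [set q | simplex R d q /\ forall i : int,
    let n_q := \sum_(j <- [:: i - 1; i; i + 1]) #|dyadic_class q j|%:R in
    let n_pi := \sum_(j <- [:: i - 2; i - 1; i; i + 1; i + 2])
                  #|dyadic_class pi j|%:R in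
    #|dyadic_class pi i|%:R / 2 <= n_q :> R /\ n_q <= 3 / 2 * n_pi].

(* [order_stat u j] is u_(j), with ranks j starting at 1: the largest entry
   is u_(1). *)
Definition order_stat (R : realType) (d : nat) (u : 'I_d -> R) (j : nat) : R :=
  nth 0 (sort >=%R [seq u i | i <- enum 'I_d]) j.-1.

(* All candidates j are at most d, so the neutral value d of the iterated
   minimum is exactly the convention min(empty) = d. *)
Definition small_rank (R : realType) (d : nat) (u : 'I_d -> R) (k : nat) : nat :=
  \big[minn/d]_(1 <= j < d.+1 | order_stat u j <= 1 / k%:R) j.

Definition l1_dist (R : realType) (d : nat) (p q : 'I_d -> R) : R :=
  \sum_j `|p j - q j|.

(* true means that the null hypothesis is rejected *)
Definition test (d k : nat) := k.-tuple 'I_d -> k.-tuple 'I_d -> bool.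

(* Probability of the event A when X and Y are independent, the entries of X
   being i.i.d. with law p and those of Y i.i.d. with law q. *)
Definition prob_samples (R : realType) (d k : nat) (p q : 'I_d -> R)
    (A : test d k) : R :=
  \sum_(x : k.-tuple 'I_d) \sum_(y : k.-tuple 'I_d | A x y)
    (\prod_(l < k) p (tnth x l)) * (\prod_(l < k) q (tnth y l)).

(* The suprema are over sets of probabilities; the real-valued [sup] of the
   empty set is 0, the usual convention when a hypothesis is empty. *)
Definition risk (R : realType) (d k : nat)
    (H0 H1 : set (('I_d -> R) * ('I_d -> R))) (phi : test d k) : R :=
  sup [set prob_samples pq.1 pq.2 phi | pq in H0] +
  sup [set prob_samples pq.1 pq.2 (fun x y => ~~ phi x y) | pq in H1].

(* The infima are taken in the extended reals because no separation need be
   admissible for a given test: its infimum is then +oo, whereas the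
   real-valued [inf] would return 0. *)
Definition separation_distance (R : realType) (d : nat) (gamma : R)
    (H0 : ('I_d -> R) -> set (('I_d -> R) * ('I_d -> R)))
    (H1 : ('I_d -> R) -> R -> set (('I_d -> R) * ('I_d -> R)))
    (pi : 'I_d -> R) (k : nat) : \bar R :=
  ereal_inf
    [set ereal_inf [set rho%:E | rho in
           [set rho : R | 0 < rho /\ risk (H0 pi) (H1 pi rho) phi <= gamma]]
    | phi in [set: test d k]].

Definition H0_clo (R : realType) (d : nat) (pi : 'I_d -> R) :
    set (('I_d -> R) * ('I_d -> R)) :=
  [set pq | [/\ neighborhood pi pq.1, neighborhood pi pq.2 & pq.1 = pq.2]].

Definition H1_clo (R : realType) (d : nat) (pi : 'I_d -> R) (rho : R) :
    set (('I_d -> R) * ('I_d -> R)) :=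
  [set pq | [/\ simplex R d pq.1, neighborhood pi pq.2
              & rho <= l1_dist pq.1 pq.2]].

Definition tail_bound (R : realType) (d : nat) (pi : 'I_d -> R) (k I : nat) : R :=
  Num.max (Num.sqrt I%:R * (ln k%:R / k%:R))
 (Num.max (Num.sqrt I%:R / Num.sqrt k%:R *
             (\sum_i pi i ^+ 2 * expR (- (k%:R * pi i / 2))) `^ (1 / 4))
          (\sum_(I <= i < d.+1) order_stat pi i)).

(* The minimum over all integers I >= J_pi is attained, since [tail_bound]
   is nonnegative and tends to infinity with I; it is written as an infimum. *)
Definition closeness_rate (R : realType) (d : nat) (pi : 'I_d -> R) (k : nat) : R :=
  Num.max (inf [set tail_bound pi k I | I in [set I | (small_rank pi k <= I)%N]])
 (Num.max (1 / Num.sqrt k%:R *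
             (\sum_(1 <= i < (small_rank pi k).+1)
                order_stat pi i `^ (2 / 3)) `^ (3 / 4))
          (Num.sqrt (ln k%:R / k%:R))).

(* Main.v *)
Require Import Defs.
From mathcomp Require Import all_boot all_order all_algebra.
From mathcomp Require Import all_classical all_reals ereal sequences exp.
From mathcomp Require Import ring lra zify.

Set Implicit Arguments.
Unset Strict Implicit.
Unset Printing Implicit Defensive.

Import Order.TTheory GRing.Theory Num.Theory.
Local Open Scope classical_set_scope.
Local Open Scope ring_scope.

(** Write K for the sample size k, lambda_j = K q_j, mu_j = K p_j,
    delta_j = |mu_j - lambda_j|, and kappa for K times the claimed rate.  One
    test depending only on [gamma], [pi] and [k] has to have small error on the null
    hypothesis, and has to reject as soon as the sum of the delta_j exceeds a
    large multiple of kappa.  It rejects when at least one of three statistics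
    is large; each is analysed with Chebyshev's inequality alone.

    - The samples are cut in two halves and N_j counts j in the first half of Y.
      On the second halves, a U-statistic estimates the sum of w_j delta_j^2
      with weights w_j = (1 + N_j)^(-2/3) ([weighted_stat]).  Its null variance
      is of order sum_j min(lambda_j^(2/3), lambda_j^2), because
      lambda_j / (1 + N_j) has a bounded second moment.  It detects an
      alternative whose excess sits on the coordinates with lambda_j >= 1 (by
      Cauchy-Schwarz against the weights), or on those with lambda_j < 1 and
      mu_j > 2 (there delta_j^2 >= delta_j and the weights are bounded below on
      average): [weighted_stat_power_large], [weighted_stat_power_spike].

    - On the whole samples, [collision_stat] compares the number of coordinates
      seen twice in one sample and never in the other with the number of those
      seen once in each.  Its mean is exactly the sum of
      delta_j^2 ((1 - p_j) (1 - q_j))^(k - 2), and its variance is at most a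
      constant times the sum of s_j^2 exp(- s_j), s_j = lambda_j + mu_j
      ([collision_stat_var]).  Not splitting the samples matters: on the null
      the variance is of order sum_j lambda_j^2 exp(- 2 lambda_j), the
      neighborhood of [pi] only yields pi_l <= 4 q_j for matched coordinates,
      and so exp(- K pi_l / 2) is exactly what remains.  On an alternative the
      variance may exceed its null value by a factor ln(k)^2 times the mean;
      this is what the term sqrt(I) ln(k) / k of the rate pays for
      ([collision_stat_noise_le]).

    - On the second halves, [unseen_stat] is the difference between the numbers
      of X and of Y falling outside the first half of Y.  A linear statistic is
      unavoidable for mass spread over so many coordinates that nothing is ever
      seen twice; it detects an excess of p of order sqrt(K) on coordinates
      where q has little mass ([unseen_stat_power]).

    The quantities above involve the unknown q and not [pi].  A vector q in the
    neighborhood of [pi] is coupled to [pi] by nonnegative weights c_jl that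
    link only comparable entries, have row sums 1 and bounded column sums
    ([neighborhood_coupling]); hence sums over q are bounded by sums over [pi],
    and the I - 1 largest entries of [pi] give a set of at most 15 I coordinates
    outside of which q has mass at most 240 times the tail of [pi].

    Finally let I nearly attain the minimum in the rate.  Every alternative
    carries a large multiple of kappa on one of four regions: lambda_j >= 1;
    lambda_j < 1 and mu_j > 2; small coordinates in that set of size 15 I; the
    remaining small coordinates.  The first statistic sees the first two, the
    second one the third, the last one the fourth ([closeness_test_power]).
    When k is bounded the rate is bounded below, and there is nothing to test,
    since two distributions are at distance at most 2. *)

(** * Expectations as positive linear functionals, and independent samples *)

(** Everything below is about finite sums, but positivity, additivity and
    homogeneity are all that Chebyshev's inequality uses; keeping only these
    lets a coordinate, a pair, a sample and a pair of samples be treated alike. *)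
Record mean (R : realType) (T : Type) := Mean {
  expect :> (T -> R) -> R;
  meanD : forall f g, expect (fun t => f t + g t) = expect f + expect g;
  meanZ : forall c f, expect (fun t => c * f t) = c * expect f;
  mean_ge0 : forall f, (forall t, 0 <= f t) -> 0 <= expect f;
  mean1 : expect (fun=> 1) = 1 }.

Section Mean.
Variables (R : realType) (T : Type) (E : mean R T).
Implicit Types (f g : T -> R) (a c v : R).

Lemma eq_mean f g : (forall t, f t = g t) -> E f = E g.
Proof. by move=> fg; congr (E _); apply/funext. Qed.

Lemma mean_cst c : E (fun=> c) = c.
Proof.
rewrite -[RHS]mulr1 -(mean1 E) -meanZ.
by apply: eq_mean => t; rewrite mulr1.
Qed.

Lemma meanZr c f : E (fun t => f t * c) = E f * c.
Proof. by rewrite mulrC -meanZ; apply: eq_mean => t; rewrite mulrC. Qed.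

Lemma meanB f g : E (fun t => f t - g t) = E f - E g.
Proof.
rewrite -[- E g]mulN1r -meanZ -meanD; apply: eq_mean => t.
by rewrite mulN1r.
Qed.

Lemma mean_sum (I : Type) (r : seq I) (P : pred I) (F : I -> T -> R) :
  E (fun t => \sum_(i <- r | P i) F i t) = \sum_(i <- r | P i) E (F i).
Proof.
elim: r => [|i r IH].
  by rewrite big_nil -[RHS](mean_cst 0); apply: eq_mean => t; rewrite big_nil.
rewrite big_cons -IH; case: ifP => Pi; last first.
  by apply: eq_mean => t; rewrite big_cons Pi.
by rewrite -meanD; apply: eq_mean => t; rewrite big_cons Pi.
Qed.

Lemma le_mean f g : (forall t, f t <= g t) -> E f <= E g.
Proof.
by move=> fg; rewrite -subr_ge0 -meanB; apply: mean_ge0 => t; rewrite subr_ge0.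
Qed.

Lemma markov f a : 0 < a -> (forall t, 0 <= f t) ->
  E (fun t => (a <= f t)%R%:R) <= E f / a.
Proof.
move=> a0 f0; rewrite ler_pdivlMr// -meanZr; apply: le_mean => t.
by case: (leP a (f t)) => h; rewrite ?mul1r ?mul0r.
Qed.

Lemma chebyshev_le f c a v : 0 < a -> E (fun t => (f t - c) ^+ 2) <= v ->
  E (fun t => (f t <= c - a)%R%:R) <= v / a ^+ 2.
Proof.
move=> a0 fv.
apply: (@le_trans _ _ (E (fun t => (a ^+ 2 <= (f t - c) ^+ 2)%R%:R))).
  apply: le_mean => t; rewrite ler_nat.
  case: (leP (f t)) => //= h; suff -> : a ^+ 2 <= (f t - c) ^+ 2 by [].
  by rewrite -[leRHS]sqrrN ler_sqr ?nnegrE; lra.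
apply: le_trans (markov _ _) _; [by rewrite exprn_gt0|by move=> t; exact: sqr_ge0|].
by rewrite ler_pM2r ?invr_gt0 ?exprn_gt0.
Qed.

Lemma chebyshev_ge f c a v : 0 < a -> E (fun t => (f t - c) ^+ 2) <= v ->
  E (fun t => (c + a <= f t)%R%:R) <= v / a ^+ 2.
Proof.
move=> a0 fv.
apply: le_trans (@chebyshev_le (fun t => - f t) (- c) a v a0 _).
  by apply: le_mean => t; rewrite ler_nat -opprD lerN2.
by rewrite (eq_mean (g := fun t => (f t - c) ^+ 2))// => t; rewrite opprK addrC -sqrrN; congr (_ ^+ 2); ring.
Qed.

Lemma mean_varE f : E (fun t => (f t - E f) ^+ 2) = E (fun t => f t ^+ 2) - E f ^+ 2.
Proof.
rewrite (eq_mean (g := fun t => (f t ^+ 2 - 2 * E f * f t) + E f ^+ 2)); last by move=> t; ring.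
by rewrite meanD meanB meanZ mean_cst; ring.
Qed.

Lemma mean_var_le f : E (fun t => (f t - E f) ^+ 2) <= E (fun t => f t ^+ 2).
Proof. by rewrite mean_varE lerBlDr lerDl sqr_ge0. Qed.

End Mean.

Lemma eq_ler (R : realType) (x y : R) : x = y -> x <= y.
Proof. by move=> ->. Qed.

Section Obs.
Variables (R : realType) (d : nat) (p : 'I_d -> R) (hp : simplex R d p).

Let obs_fun (f : 'I_d -> R) := \sum_j p j * f j.

Fact obsD f g : obs_fun (fun t => f t + g t) = obs_fun f + obs_fun g.
Proof. by rewrite -big_split; apply: eq_bigr => j _; rewrite mulrDr. Qed.
Fact obsZ c f : obs_fun (fun t => c * f t) = c * obs_fun f.
Proof. by rewrite mulr_sumr; apply: eq_bigr => j _; rewrite mulrCA. Qed.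
Fact obs_ge0 f : (forall t, 0 <= f t) -> 0 <= obs_fun f.
Proof. by move=> f0; apply: sumr_ge0 => j _; rewrite mulr_ge0// hp.1. Qed.
Fact obs1 : obs_fun (fun=> 1) = 1.
Proof. by rewrite -[RHS](hp.2); apply: eq_bigr => j _; rewrite mulr1. Qed.

Definition obs : mean R 'I_d := Mean obsD obsZ obs_ge0 obs1.

Lemma obsE f : obs f = \sum_j p j * f j. Proof. by []. Qed.

Lemma obs_delta j (c : 'I_d -> R) : obs (fun x => (x == j)%:R * c x) = p j * c j.
Proof.
rewrite obsE (bigD1 j)//= eqxx mul1r big1 ?addr0// => i /negPf ->.
by rewrite mul0r mulr0.
Qed.

End Obs.

Section Pair.
Variables (R : realType) (T U : Type) (E : mean R T) (F : mean R U).

Let pair_fun (f : T * U -> R) := E (fun a => F (fun b => f (a, b))).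

Fact pairD f g : pair_fun (fun t => f t + g t) = pair_fun f + pair_fun g.
Proof. by rewrite /pair_fun -meanD; apply: eq_mean => a; rewrite meanD. Qed.
Fact pairZ c f : pair_fun (fun t => c * f t) = c * pair_fun f.
Proof. by rewrite /pair_fun -meanZ; apply: eq_mean => a; rewrite meanZ. Qed.
Fact pair_ge0 f : (forall t, 0 <= f t) -> 0 <= pair_fun f.
Proof. by move=> f0; apply: mean_ge0 => a; apply: mean_ge0. Qed.
Fact pair1 : pair_fun (fun=> 1) = 1.
Proof. by rewrite /pair_fun mean_cst mean_cst. Qed.

Definition pairm : mean R (T * U) := Mean pairD pairZ pair_ge0 pair1.

Lemma pairmE f : pairm f = E (fun a => F (fun b => f (a, b))). Proof. by []. Qed.

Lemma pairm_prod f g : pairm (fun t => f t.1 * g t.2) = E f * F g.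
Proof. by rewrite pairmE -meanZr; apply: eq_mean => a; exact: (meanZ F (f a) g). Qed.

Lemma pairm_fst f : pairm (fun t => f t.1) = E f.
Proof. by rewrite pairmE; apply: eq_mean => a; exact: (mean_cst F (f a)). Qed.

Lemma pairm_snd f : pairm (fun t => f t.2) = F f.
Proof. by rewrite pairmE; exact: (mean_cst E (F f)). Qed.

End Pair.

Section Iid.
Variables (R : realType) (T : Type) (E : mean R T).

(** Samples are sequences built by recursion on their size: variances follow by
    induction on that size, and cutting a sample is concatenation ([iid_cat]). *)
Fixpoint iid_fun n (f : seq T -> R) :=
  if n is m.+1 then E (fun z => iid_fun m (fun t => f (z :: t))) else f [::].

Fact iidD n f g : iid_fun n (fun t => f t + g t) = iid_fun n f + iid_fun n g.
Proof.
elim: n f g => //= n IH f g; rewrite -meanD; apply: eq_mean => z; exact: IH.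
Qed.
Fact iidZ n c f : iid_fun n (fun t => c * f t) = c * iid_fun n f.
Proof. by elim: n f => //= n IH f; rewrite -meanZ; apply: eq_mean => z; exact: IH. Qed.
Fact iid_ge0 n f : (forall t, 0 <= f t) -> 0 <= iid_fun n f.
Proof. by elim: n f => //= n IH f f0; apply: mean_ge0 => z; apply: IH. Qed.
Fact iid1 n : iid_fun n (fun=> 1) = 1.
Proof. by elim: n => //= n IH; rewrite -[RHS](mean1 E); apply: eq_mean. Qed.

Definition iid n : mean R (seq T) :=
  Mean (@iidD n) (@iidZ n) (@iid_ge0 n) (@iid1 n).

Lemma iid0 f : iid 0 f = f [::]. Proof. by []. Qed.

Lemma iidS n f : iid n.+1 f = E (fun z => iid n (fun t => f (z :: t))).
Proof. by []. Qed.

Lemma eq_iid n f g : (forall t, size t = n -> f t = g t) -> iid n f = iid n g.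
Proof.
elim: n f g => [|n IH] f g fg; first by rewrite !iid0 fg.
by rewrite !iidS; apply: eq_mean => z; apply: IH => t st; rewrite fg//= st.
Qed.

Lemma iid_cat m n f :
  iid (m + n) f = iid m (fun a => iid n (fun b => f (a ++ b))).
Proof.
by elim: m f => [|m IH] f //; rewrite addSn !iidS; apply: eq_mean => z; rewrite IH.
Qed.

Lemma iid_sum n (f : T -> R) : iid n (fun t => \sum_(z <- t) f z) = n%:R * E f.
Proof.
elim: n => [|n IH]; first by rewrite iid0 big_nil mul0r.
rewrite iidS (eq_mean _ (g := fun z => f z + n%:R * E f)).
  by rewrite meanD mean_cst -natr1 mulrDl mul1r addrC.
move=> z; rewrite -IH -[f z in RHS](mean_cst (iid n)) -meanD.
by apply: eq_mean => t; rewrite big_cons.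
Qed.

Lemma iid_sum_sqr n (f : T -> R) : E f = 0 ->
  iid n (fun t => (\sum_(z <- t) f z) ^+ 2) = n%:R * E (fun z => f z ^+ 2).
Proof.
move=> f0; elim: n => [|n IH]; first by rewrite iid0 big_nil expr0n mul0r.
rewrite iidS (eq_mean _ (g := fun z => f z ^+ 2 + n%:R * E (fun z => f z ^+ 2))).
  by rewrite meanD mean_cst -natr1 mulrDl mul1r addrC.
move=> z; rewrite (eq_mean _ (g := fun t => (f z ^+ 2 + 2 * f z * \sum_(z <- t) f z) +
   (\sum_(z <- t) f z) ^+ 2)); last by move=> t; rewrite big_cons; ring.
by rewrite meanD meanD meanZ mean_cst iid_sum f0 IH; ring.
Qed.

Lemma iid_sum_var n (f : T -> R) :
  iid n (fun t => (\sum_(z <- t) f z - n%:R * E f) ^+ 2) <= n%:R * E (fun z => f z ^+ 2).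
Proof.
rewrite (eq_iid (g := fun t => (\sum_(z <- t) (f z - E f)) ^+ 2)); last first.
  by move=> t st; rewrite sumrB big_const_seq count_predT st iter_addr_0 mulr_natl.
rewrite iid_sum_sqr; last by rewrite meanB mean_cst subrr.
by rewrite ler_wpM2l// mean_var_le.
Qed.

End Iid.

(** Averages over a sample from a finite law are iterated finite sums, so they
    commute with any linear functional. *)
Lemma iid_exchange (R : realType) (d : nat) (p : 'I_d -> R) (hp : simplex R d p)
    (T : Type) (E : mean R T) n (f : seq 'I_d -> T -> R) :
  iid (obs hp) n (fun x => E (f x)) = E (fun t => iid (obs hp) n (f^~ t)).
Proof.
elim: n f => [|n IH] f //; rewrite iidS obsE.
rewrite (eq_mean E (g := fun t => \sum_j p j *
   iid (obs hp) n (fun x => f (j :: x) t))) //.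
by rewrite mean_sum; apply: eq_bigr => j _; rewrite meanZ -IH.
Qed.

Lemma iid_zip (R : realType) (d : nat) (p q : 'I_d -> R) (hp : simplex R d p)
    (hq : simplex R d q) n (f : seq ('I_d * 'I_d) -> R) :
  pairm (iid (obs hp) n) (iid (obs hq) n) (fun t => f (zip t.1 t.2)) =
  iid (pairm (obs hp) (obs hq)) n f.
Proof.
elim: n f => [|n IH] f; first by rewrite pairmE !iid0.
rewrite pairmE iidS [RHS]iidS pairmE; apply: eq_mean => a.
rewrite (iid_exchange hp (iid (obs hq) n.+1)) iidS.
apply: eq_mean => b; rewrite -IH pairmE -iid_exchange.
by [].
Qed.

Lemma sum_tupleS (R : realType) (T : finType) n (F : n.+1.-tuple T -> R) :
  \sum_(x : n.+1.-tuple T) F x = \sum_(z : T) \sum_(t : n.-tuple T) F [tuple of z :: t].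
Proof.
rewrite pair_big /= (reindex (fun zt : T * n.-tuple T => [tuple of zt.1 :: zt.2])) //=.
exists (fun x => (thead x, [tuple of behead x])) => [[z t] _|x _] /=.
  by congr (_, _); apply: val_inj.
by rewrite -tuple_eta.
Qed.

Lemma sum_tuple_iid (R : realType) (d : nat) (p : 'I_d -> R) (hp : simplex R d p)
    n (f : seq 'I_d -> R) :
  \sum_(x : n.-tuple 'I_d) (\prod_(l < n) p (tnth x l)) * f x = iid (obs hp) n f.
Proof.
elim: n f => [|n IH] f.
  rewrite (big_pred1 [tuple]) ?big_ord0 ?mul1r// => t.
  exact/esym/eqP/tuple0.
rewrite sum_tupleS iidS obsE; apply: eq_bigr => z _.
rewrite -IH mulr_sumr; apply: eq_bigr => t _.
rewrite big_ord_recl tnth0 -mulrA; congr (_ * (_ * _)).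
by apply: eq_bigr => l _; rewrite tnthS.
Qed.

Lemma prob_samplesE (R : realType) (d k : nat) (p q : 'I_d -> R)
    (hp : simplex R d p) (hq : simplex R d q) (A : seq 'I_d -> seq 'I_d -> bool) :
  prob_samples p q (fun x y : k.-tuple 'I_d => A x y) =
  pairm (iid (obs hp) k) (iid (obs hq) k) (fun t => (A t.1 t.2)%:R).
Proof.
rewrite pairmE -sum_tuple_iid /prob_samples; apply: eq_bigr => x _.
rewrite -sum_tuple_iid mulr_sumr big_mkcond /=; apply: eq_bigr => y _.
by case: (A x y); rewrite ?mulr1 ?mulr0 // mulrA.
Qed.

(** * Second moments of weighted U-statistics *)

Section Ustat.
Variables (R : realType) (T : Type) (E : mean R T) (J : finType) (w : J -> R).
Implicit Types (e : T -> J -> R) (a b : J -> R) (t : seq T).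

Definition wdot a b : R := \sum_j w j * a j * b j.

(** Subtracting the diagonal leaves the sum over ordered pairs of distinct
    observations, whose mean is a multiple of the weighted square of the mean. *)
Definition ustat e t : R :=
  \sum_j w j * ((\sum_(z <- t) e z j) ^+ 2 - \sum_(z <- t) e z j ^+ 2).

Lemma wdotC a b : wdot a b = wdot b a.
Proof. by apply: eq_bigr => j _; ring. Qed.

Lemma wdotBl a a' b : wdot (fun j => a j - a' j) b = wdot a b - wdot a' b.
Proof. by rewrite -sumrB; apply: eq_bigr => j _; ring. Qed.

Lemma wdotBr a b b' : wdot a (fun j => b j - b' j) = wdot a b - wdot a b'.
Proof. by rewrite wdotC wdotBl !(wdotC a). Qed.

Lemma mean_wdot a e : E (fun z => wdot a (e z)) = wdot a (fun j => E (e^~ j)).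
Proof.
by rewrite mean_sum; apply: eq_bigr => j _; rewrite meanZ.
Qed.

Lemma sum_wdot a e t :
  \sum_(y <- t) wdot a (e y) = wdot a (fun j => \sum_(y <- t) e y j).
Proof.
by rewrite exchange_big; apply: eq_bigr => j _; rewrite mulr_sumr.
Qed.

Lemma ustat_cons e z t :
  ustat e (z :: t) = ustat e t + 2 * \sum_(y <- t) wdot (e z) (e y).
Proof.
rewrite sum_wdot mulr_sumr -big_split; apply: eq_bigr => j _ /=.
by rewrite !big_cons; ring.
Qed.

(** The right-hand side is symmetric in [e] and [e'] up to relabelling: it stands
    for exchanging the two independent copies, which need not commute for an
    abstract expectation. *)
Lemma mean_wdot_sqr e e' :
  E (fun z => E (fun y => wdot (e z) (e' y) ^+ 2)) =
  \sum_i \sum_j w i * w j * E (fun z => e z i * e z j) * E (fun y => e' y i * e' y j).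
Proof.
have sqrE a b : wdot a b ^+ 2 = \sum_i \sum_j w i * w j * (a i * a j) * (b i * b j).
  rewrite expr2 big_distrlr; apply: eq_bigr => i _; apply: eq_bigr => j _ /=.
  by ring.
under eq_mean => z.
  under eq_mean => y do rewrite sqrE.
  rewrite mean_sum; under eq_bigr => i _ do rewrite mean_sum.
  under eq_bigr => i _ do under eq_bigr => j _ do rewrite meanZ.
  over.
rewrite mean_sum; apply: eq_bigr => i _; rewrite mean_sum; apply: eq_bigr => j _.
by rewrite meanZr meanZ.
Qed.

(** Centering one copy at a time: a variance is at most a second moment. *)
Lemma mean_wdot_sqr_center e :
  E (fun z => E (fun y =>
     wdot (fun j => e z j - E (e^~ j)) (fun j => e y j - E (e^~ j)) ^+ 2)) <=
  E (fun z => E (fun y => wdot (e z) (e y) ^+ 2)).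
Proof.
have center (f : T -> J -> R) : E (fun z => E (fun y =>
     wdot (f z) (fun j => e y j - E (e^~ j)) ^+ 2)) <=
  E (fun z => E (fun y => wdot (f z) (e y) ^+ 2)).
  apply: le_mean => z.
  under eq_mean => y do rewrite wdotBr -(mean_wdot (f z) e).
  exact: mean_var_le.
apply: le_trans (center _) _.
have swap f g : E (fun z => E (fun y => wdot (f z) (g y) ^+ 2)) =
                E (fun z => E (fun y => wdot (g z) (f y) ^+ 2)).
  rewrite !mean_wdot_sqr; apply: eq_bigr => i _; apply: eq_bigr => j _.
  by ring.
by rewrite swap; exact: center.
Qed.

(** Adding an observation adds twice a linear statistic of the previous ones,
    which is centered given them: increments are orthogonal. *)
Lemma ustat_sqr n e : (forall j, E (e^~ j) = 0) ->
  iid E n (fun t => ustat e t ^+ 2) =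
  2 * n%:R * (n%:R - 1) * E (fun z => E (fun y => wdot (e z) (e y) ^+ 2)).
Proof.
move=> e0; set h := E (fun z => _).
have wd0 z : E (fun y => wdot (e z) (e y)) = 0.
  by rewrite mean_wdot /wdot big1// => j _; rewrite e0 mulr0.
elim: n => [|n IH].
  by rewrite iid0 /ustat big1 ?expr0n ?mulr0 ?mul0r// => j _; rewrite !big_nil expr0n subr0 mulr0.
(* The cross term is linear in the new observation; c j is its coefficient. *)
pose c j := w j * iid E n (fun t => 4 * ustat e t * \sum_(y <- t) e y j).
rewrite iidS (eq_mean _ (g := fun z => iid E n (fun t => ustat e t ^+ 2) +
    \sum_j c j * e z j + 4 * n%:R * E (fun y => wdot (e z) (e y) ^+ 2))).
  rewrite !meanD mean_cst meanZ IH mean_sum big1 => [|j _]; last first.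
    by rewrite meanZ e0 mulr0.
  by rewrite -/h -natr1; ring.
move=> z; rewrite -mulrA -iid_sum_sqr// -meanZ.
rewrite (_ : \sum_j c j * e z j = iid E n (fun t => 4 * ustat e t * \sum_(y <- t) wdot (e z) (e y))).
  rewrite -!meanD; apply: eq_mean => t; rewrite ustat_cons; ring.
under eq_mean => t do rewrite sum_wdot mulr_sumr.
rewrite mean_sum; apply: eq_bigr => j _.
rewrite /c mulrAC -meanZ; apply: eq_mean => t; ring.
Qed.

(** Hoeffding's decomposition: after centering, the deviation is a linear
    statistic plus a U-statistic with centered entries. *)
Lemma ustat_var n e :
  let m j := E (e^~ j) in
  iid E n (fun t => (ustat e t - n%:R * (n%:R - 1) * wdot m m) ^+ 2) <=
  8 * n%:R ^+ 3 * E (fun z => wdot m (e z) ^+ 2) +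
  4 * n%:R ^+ 2 * E (fun z => E (fun y => wdot (e z) (e y) ^+ 2)).
Proof.
cbv zeta; set m := fun j => E (e^~ j); pose xi z j := e z j - m j.
have xi0 j : E (xi^~ j) = 0 by rewrite meanB mean_cst subrr.
have dec t : size t = n -> ustat e t - n%:R * (n%:R - 1) * wdot m m =
    2 * (n%:R - 1) * \sum_(y <- t) wdot m (xi y) + ustat xi t.
  move=> st; rewrite sum_wdot /ustat /wdot !mulr_sumr -sumrB -big_split.
  apply: eq_bigr => j _ /=.
  have Sx c : \sum_(z <- t) c = n%:R * c :> R.
    by rewrite big_const_seq count_predT st iter_addr_0 mulr_natl.
  have -> : \sum_(z <- t) e z j = n%:R * m j + \sum_(y <- t) xi y j.
    by rewrite /xi sumrB Sx; ring.
  have -> : \sum_(z <- t) e z j ^+ 2 = n%:R * m j ^+ 2 +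
      2 * m j * (\sum_(y <- t) xi y j) + \sum_(y <- t) xi y j ^+ 2.
    rewrite (eq_bigr (fun z => m j ^+ 2 + 2 * m j * xi z j + xi z j ^+ 2)).
      by rewrite big_split big_split /= Sx -mulr_sumr.
    by move=> z _; rewrite /xi; ring.
  ring.
rewrite (eq_iid E (g := fun t => (2 * (n%:R - 1) * \sum_(y <- t) wdot m (xi y) + ustat xi t) ^+ 2)); last first.
  by move=> t st; rewrite dec.
apply: (@le_trans _ _ (iid E n (fun t =>
   8 * (n%:R - 1) ^+ 2 * (\sum_(y <- t) wdot m (xi y)) ^+ 2 + 2 * ustat xi t ^+ 2))).
  apply: le_mean => t; set A := \sum_(y <- t) _; set B := ustat _ _.
  have := sqr_ge0 (2 * (n%:R - 1) * A - B); nra.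
rewrite meanD !meanZ ustat_sqr// iid_sum_sqr; last first.
  by rewrite mean_wdot /wdot big1// => j _; rewrite xi0 mulr0.
have n0 : 0 <= n%:R :> R by [].
apply: lerD.
  have le1 : E (fun z => wdot m (xi z) ^+ 2) <= E (fun z => wdot m (e z) ^+ 2).
    under eq_mean => z do rewrite /xi wdotBr -(mean_wdot m e).
    exact: mean_var_le.
  have ge0 : 0 <= E (fun z => wdot m (xi z) ^+ 2) by apply: mean_ge0 => z; exact: sqr_ge0.
  rewrite mulrA; apply: ler_pM => //.
    by rewrite mulr_ge0// mulr_ge0// sqr_ge0.
  have : n%:R * (n%:R - 1) ^+ 2 <= n%:R ^+ 3 :> R.
    case: (n) => [|i]; first by rewrite mul0r expr0n.
    have i0 : 0 <= i%:R :> R by [].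
    by rewrite -natr1; nra.
  lra.
have le2 := mean_wdot_sqr_center e; rewrite -/xi in le2.
set h := E (fun z => E (fun y => wdot (e z) (e y) ^+ 2)) in le2 *.
set h' := E _ in le2 *.
have h'0 : 0 <= h' by apply: mean_ge0 => z; apply: mean_ge0 => y; exact: sqr_ge0.
nra.
Qed.

End Ustat.

(** * The two-sample contrast *)

Definition contrast (R : realType) (d : nat) (z : 'I_d * 'I_d) (j : 'I_d) : R :=
  (z.1 == j)%:R - (z.2 == j)%:R.

Lemma obs_ind (R : realType) (d : nat) (p : 'I_d -> R) (hp : simplex R d p) j :
  obs hp (fun x => (x == j)%:R) = p j.
Proof.
rewrite -[RHS]mulr1 -(obs_delta hp j (fun=> 1)); apply: eq_mean => x.
by rewrite mulr1.
Qed.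

Section TwoSampleVar.
Variables (R : realType) (d : nat) (p q : 'I_d -> R).
Hypotheses (hp : simplex R d p) (hq : simplex R d q).
Variable (w : 'I_d -> R).

Let pq := pairm (obs hp) (obs hq).

Lemma contrast_mean j : pq (fun z => contrast R z j) = p j - q j.
Proof.
by rewrite meanB (pairm_fst _ _ (fun x => (x == j)%:R))
  (pairm_snd _ _ (fun x => (x == j)%:R)) !obs_ind.
Qed.

Lemma wdot_contrast a z : wdot w a (contrast R z) = w z.1 * a z.1 - w z.2 * a z.2.
Proof.
have ind x : \sum_j w j * a j * (x == j)%:R = w x * a x.
  rewrite (bigD1 x)//= eqxx mulr1 big1 ?addr0// => j; rewrite eq_sym => /negPf ->.
  by rewrite mulr0.
rewrite -!ind -sumrB; apply: eq_bigr => j _; exact: mulrBr.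
Qed.

Lemma contrast_dot_sqr a :
  pq (fun z => wdot w a (contrast R z) ^+ 2) <= 2 * \sum_j (w j * a j) ^+ 2 * (p j + q j).
Proof.
pose f x := 2 * (w x * a x) ^+ 2.
apply: (@le_trans _ _ (pq (fun z => f z.1 + f z.2))).
  apply: le_mean => z; rewrite wdot_contrast /f.
  have := sqr_ge0 (w z.1 * a z.1 + w z.2 * a z.2); nra.
rewrite meanD pairm_fst pairm_snd !obsE -big_split mulr_sumr.
by apply/eq_ler/eq_bigr => j _ /=; rewrite /f; ring.
Qed.

(** Two pairs of observations meet in at most four ways, one for each choice of
    a member in each pair. *)
Lemma contrast_pair_sqr :
  pq (fun z => pq (fun y => wdot w (contrast R z) (contrast R y) ^+ 2)) <=
  4 * \sum_j w j ^+ 2 * (p j + q j) ^+ 2.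
Proof.
pose f (x y : 'I_d) := (x == y)%:R * w y ^+ 2.
have fE (r s : 'I_d -> R) (hr : simplex R d r) (hs : simplex R d s) :
    obs hr (fun x => obs hs (fun y => f x y)) = \sum_j w j ^+ 2 * (r j * s j).
  rewrite obsE; apply: eq_bigr => j _.
  under eq_mean => y do rewrite /f eq_sym.
  by rewrite obs_delta; ring.
apply: (@le_trans _ _ (pq (fun z => pq (fun y =>
   4 * (f z.1 y.1 + f z.1 y.2 + f z.2 y.1 + f z.2 y.2))))).
  apply: le_mean => z; apply: le_mean => y; rewrite wdot_contrast /contrast /f.
  rewrite (_ : w y.1 * _ - _ = (z.1 == y.1)%:R * w y.1 - (z.2 == y.1)%:R * w y.1
     - (z.1 == y.2)%:R * w y.2 + (z.2 == y.2)%:R * w y.2); last by ring.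
  have sq (b : bool) (x : R) : b%:R * x ^+ 2 = (b%:R * x) ^+ 2.
    by case: b; rewrite ?mul1r// !mul0r expr0n.
  rewrite !sq; move: (_ * _) (_ * _) (_ * _) (_ * _) => A B C D.
  have := sqr_ge0 (A + B); have := sqr_ge0 (A + C); have := sqr_ge0 (A - D).
  have := sqr_ge0 (B - C); have := sqr_ge0 (B + D); have := sqr_ge0 (C + D).
  nra.
under eq_mean => z.
  rewrite meanZ !meanD (pairm_fst _ _ (f z.1)) (pairm_fst _ _ (f z.2)).
  rewrite (pairm_snd _ _ (f z.1)) (pairm_snd _ _ (f z.2)).
  over.
rewrite meanZ !meanD.
rewrite (pairm_fst _ _ (fun x => obs hp (f x))) (pairm_fst _ _ (fun x => obs hq (f x))).
rewrite (pairm_snd _ _ (fun x => obs hp (f x))) (pairm_snd _ _ (fun x => obs hq (f x))).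
rewrite !fE -!big_split /= !mulr_sumr.
by apply/eq_ler/eq_bigr => j _ /=; ring.
Qed.

Lemma two_sample_ustat_var n :
  pairm (iid (obs hp) n) (iid (obs hq) n)
    (fun t => (ustat w (@contrast R d) (zip t.1 t.2) -
       n%:R * (n%:R - 1) * \sum_j w j * (p j - q j) ^+ 2) ^+ 2) <=
  16 * (n%:R ^+ 3 * \sum_j w j ^+ 2 * (p j - q j) ^+ 2 * (p j + q j) +
        n%:R ^+ 2 * \sum_j w j ^+ 2 * (p j + q j) ^+ 2).
Proof.
rewrite (iid_zip hp hq n (fun s => (ustat w (@contrast R d) s -
       n%:R * (n%:R - 1) * \sum_j w j * (p j - q j) ^+ 2) ^+ 2)).
have mE : (fun j => pq (fun z => contrast R z j)) = (fun j => p j - q j).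
  by apply/funext => j; exact: contrast_mean.
have := ustat_var pq w n (@contrast R d); cbv zeta; rewrite mE.
have -> : wdot w (fun j => p j - q j) (fun j => p j - q j) =
   \sum_j w j * (p j - q j) ^+ 2 by apply: eq_bigr => j _; ring.
move/le_trans; apply; rewrite mulrDr; apply: lerD.
  rewrite (_ : 16 * _ = 8 * n%:R ^+ 3 * (2 * \sum_j (w j * (p j - q j)) ^+ 2 * (p j + q j))).
    by rewrite ler_wpM2l ?mulr_ge0// contrast_dot_sqr.
  rewrite (eq_bigr (fun j => (w j * (p j - q j)) ^+ 2 * (p j + q j))).
    by ring.
  by move=> j _; rewrite exprMn.
rewrite (_ : 16 * _ = 4 * n%:R ^+ 2 * (4 * \sum_j w j ^+ 2 * (p j + q j) ^+ 2)); last by ring.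
by rewrite ler_wpM2l ?mulr_ge0// contrast_pair_sqr.
Qed.

Definition linear_stat (x y : seq 'I_d) : R := \sum_(z <- zip x y) (w z.1 - w z.2).

Lemma two_sample_linear_stat_var n : (forall j, 0 <= w j <= 1) ->
  pairm (iid (obs hp) n) (iid (obs hq) n)
    (fun t => (linear_stat t.1 t.2 - n%:R * \sum_j w j * (p j - q j)) ^+ 2) <= n%:R.
Proof.
move=> w01.
rewrite (iid_zip hp hq n (fun s => (\sum_(z <- s) (w z.1 - w z.2) -
       n%:R * \sum_j w j * (p j - q j)) ^+ 2)).
have <- : pq (fun z => w z.1 - w z.2) = \sum_j w j * (p j - q j).
  rewrite meanB pairm_fst pairm_snd !obsE -sumrB.
  by apply: eq_bigr => j _; ring.
apply: le_trans (iid_sum_var _ _ _) _; rewrite ler_piMr//.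
rewrite -[leRHS](mean1 pq); apply: le_mean => z.
by have := w01 z.1; have := w01 z.2; nra.
Qed.

End TwoSampleVar.

(** * Joint law of two counts *)

Section Counts.
Variables (R : realType) (T : Type) (E : mean R T) (A B : pred T).
Hypothesis AB : forall z, ~~ (A z && B z).

Let al := E (fun z => (A z)%:R).
Let be := E (fun z => (B z)%:R).

(** The trinomial law, by Pascal's recursion on the sample size. *)
Lemma iid_counts n a b :
  iid E n (fun t => ((count A t == a) && (count B t == b))%:R) =
  ('C(n, a + b) * 'C(a + b, a))%:R * (al ^+ a * be ^+ b * (1 - al - be) ^+ (n - (a + b))).
Proof.
elim: n a b => [|n IH] a b.
  rewrite iid0 /=; case: a b => [|a] [|b] //=; first by rewrite !mulr1.
  - by rewrite mul0n mul0r.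
  - by rewrite mul0n mul0r.
  - by rewrite mul0n mul0r.
pose J a b := iid E n (fun t => ((count A t == a) && (count B t == b))%:R).
pose X1 := iid E n (fun t => ((1 + count A t == a)%N && (count B t == b))%:R).
pose X2 := iid E n (fun t => ((count A t == a) && (1 + count B t == b)%N)%:R).
rewrite iidS (eq_mean _ (g := fun z => (A z)%:R * X1 + (B z)%:R * X2 +
   J a b * (1 - (A z)%:R - (B z)%:R))); last first.
  move=> z.
  transitivity (if A z then X1 else if B z then X2 else J a b).
    by rewrite /J /X1 /X2 /=; have := AB z; case: (A z); case: (B z).
  by have := AB z; case: (A z); case: (B z) => //= _; ring.
rewrite 2!meanD !meanZr meanZ !meanB mean_cst -/al -/be.
have powS s : (1 - al - be) * ('C(n, s)%:R * (1 - al - be) ^+ (n - s)) =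
    'C(n, s)%:R * (1 - al - be) ^+ (n.+1 - s).
  case: (leqP s n) => sn; last by rewrite bin_small// !mul0r mulr0.
  by rewrite subSn// exprS; ring.
have JE : J a b * (1 - al - be) = ('C(n, a + b) * 'C(a + b, a))%:R *
    (al ^+ a * be ^+ b * (1 - al - be) ^+ (n.+1 - (a + b))).
  rewrite /J IH !natrM -mulrA [X in _ = _ * X]mulrC.
  have := powS (a + b)%N; move: (1 - al - be) => g.
  move: ('C(n, _)%:R) ('C(a + b, _)%:R) (_ ^+ (n.+1 - _)) (_ ^+ (n - _)) => c1 c2 x y e.
  rewrite (_ : _ * _ = c2 * (al ^+ a * be ^+ b) * (g * (c1 * y))); last by ring.
  by rewrite e; ring.
have X1E : al * X1 = (if a is a'.+1 then 'C(n, a' + b) * 'C(a' + b, a') else 0)%:R *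
    (al ^+ a * be ^+ b * (1 - al - be) ^+ (n.+1 - (a + b))).
  rewrite /X1; case: (a) => [|a'].
    by rewrite mul0r (eq_mean _ (g := fun=> 0)) ?mean_cst ?mulr0.
  rewrite (_ : iid E n _ = J a' b)//.
  by rewrite /J IH addSn subSS exprS; ring.
have X2E : be * X2 = (if b is b'.+1 then 'C(n, a + b') * 'C(a + b', a) else 0)%:R *
    (al ^+ a * be ^+ b * (1 - al - be) ^+ (n.+1 - (a + b))).
  rewrite /X2; case: (b) => [|b'].
    rewrite mul0r (eq_mean _ (g := fun=> 0)) ?mean_cst ?mulr0// => t.
    by rewrite andbF.
  rewrite (_ : iid E n _ = J a b')//.
  by rewrite /J IH addnS subSS exprS; ring.
rewrite X1E X2E JE -!mulrDl -!natrD; congr (_%:R * _).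
case: (a) (b) => [|a'] [|b'] //=; rewrite ?addn0 ?add0n ?addSn ?addnS ?bin0 ?binn ?muln1 ?add0n.
- by rewrite ?bin0.
- by rewrite binS addnC.
- by rewrite binS addnC.
rewrite (binS n) (binS (a' + b').+1); lia.
Qed.

End Counts.

(** * The collision statistic: one coordinate *)

Section BinR.
Variable R : realType.

Lemma binR2 n : 'C(n, 2)%:R = n%:R * (n%:R - 1) / 2 :> R.
Proof.
elim: n => [|n IH]; first by rewrite bin0n !mul0r.
by rewrite binS natrD IH bin1 -natr1; field.
Qed.

Lemma binR3 n : 'C(n, 3)%:R = n%:R * (n%:R - 1) * (n%:R - 2) / 6 :> R.
Proof.
elim: n => [|n IH]; first by rewrite bin0n !mul0r.
by rewrite binS natrD IH binR2 -natr1; field.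
Qed.

Lemma binR4 n :
  'C(n, 4)%:R = n%:R * (n%:R - 1) * (n%:R - 2) * (n%:R - 3) / 24 :> R.
Proof.
elim: n => [|n IH]; first by rewrite bin0n !mul0r.
by rewrite binS natrD IH binR3 -natr1; field.
Qed.

End BinR.

Lemma iid_count (R : realType) (T : Type) (E : mean R T) (A : pred T) n a :
  iid E n (fun t => (count A t == a)%:R) =
  'C(n, a)%:R * (E (fun z => (A z)%:R) ^+ a * (1 - E (fun z => (A z)%:R)) ^+ (n - a)).
Proof.
have AB z : ~~ (A z && pred0 z) by rewrite andbF.
have := iid_counts E AB n a 0; rewrite mean_cst addn0 binn muln1 subr0 expr0 mulr1.
by move=> <-; apply: eq_mean => t; rewrite count_pred0 eqxx andbT.
Qed.

Lemma simplex_le1 (R : realType) (d : nat) (p : 'I_d -> R) (hp : simplex R d p) j :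
  p j <= 1.
Proof.
rewrite -hp.2 (bigD1 j)//= lerDl; apply: sumr_ge0 => i _; exact: hp.1.
Qed.

Section Cells.
Variables (R : realType) (d k : nat) (p q : 'I_d -> R).
Hypotheses (hp : simplex R d p) (hq : simplex R d q).

Let E2 := pairm (iid (obs hp) k) (iid (obs hq) k).

Definition cell (a b : nat) (j : 'I_d) (t : seq 'I_d * seq 'I_d) : R :=
  ((count_mem j t.1 == a) && (count_mem j t.2 == b))%:R.

Let binp (x : R) a := 'C(k, a)%:R * (x ^+ a * (1 - x) ^+ (k - a)).
Let binp2 (x y : R) a b :=
  ('C(k, a + b) * 'C(a + b, a))%:R * (x ^+ a * y ^+ b * (1 - x - y) ^+ (k - (a + b))).

Lemma cell_mean a b j : E2 (cell a b j) = binp (p j) a * binp (q j) b.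
Proof.
rewrite (eq_mean _ (g := fun t => (count_mem j t.1 == a)%:R * (count_mem j t.2 == b)%:R)).
  rewrite (pairm_prod _ _ (fun x => (count_mem j x == a)%:R)
     (fun x => (count_mem j x == b)%:R)) !iid_count.
  by rewrite !obs_ind.
by move=> t; rewrite /cell -mulnb natrM.
Qed.

Lemma cell_mean2 a b c e i j : i != j ->
  E2 (fun t => cell a c i t * cell b e j t) =
  binp2 (p i) (p j) a b * binp2 (q i) (q j) c e.
Proof.
move=> ij; have ijN z : ~~ ((pred1 i z) && (pred1 j z)).
  by apply/negP => /andP[/eqP -> /eqP /esym/eqP]; rewrite eq_sym (negPf ij).
rewrite (eq_mean _ (g := fun t =>
    ((count_mem i t.1 == a) && (count_mem j t.1 == b))%:R *
    ((count_mem i t.2 == c) && (count_mem j t.2 == e))%:R)).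
  rewrite (pairm_prod _ _ (fun x => ((count_mem i x == a) && (count_mem j x == b))%:R)
     (fun x => ((count_mem i x == c) && (count_mem j x == e))%:R)) !iid_counts//.
  by rewrite !obs_ind.
by move=> t; rewrite /cell -!natrM !mulnb andbACA.
Qed.

(** With these weights the probabilities of the cells (2, 0), (0, 2) and (1, 1)
    are the three terms of the square of p (1 - q) - q (1 - p) = p - q, times a
    common factor.  The mean is therefore exact, without splitting or
    randomizing the samples. *)
Definition collision_score j t : R :=
  2 * k%:R / (k%:R - 1) * (cell 2 0 j t + cell 0 2 j t) - 2 * cell 1 1 j t.

Lemma collision_score_mean j : (2 <= k)%N ->
  E2 (collision_score j) = (k%:R * (p j - q j)) ^+ 2 * ((1 - p j) * (1 - q j)) ^+ (k - 2).
Proof.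
move=> k2; rewrite meanB !meanZ meanD !cell_mean /binp.
have k1 : k%:R - 1 != 0 :> R by rewrite subr_eq0 (eqr_nat R k 1); lia.
have P2 (x : R) : x ^+ k = x ^+ (k - 2) * x ^+ 2 by rewrite -exprD subnK.
have P1 (x : R) : x ^+ (k - 1) = x ^+ (k - 2) * x by rewrite -exprSr; congr (_ ^+ _); lia.
rewrite !binR2 !bin0 !bin1 !subn0 !P2 !P1 exprMn.
rewrite [((1 - p j) * _) ^+ _]exprMn; rewrite !expr0 !expr1 !mul1r.
move: ((1 - p j) ^+ (k - 2)) ((1 - q j) ^+ (k - 2)) => U V.
move: (p j) (q j) (k%:R) k1 => x y n n1.
by field.
Qed.

Lemma collision_score_sqr j : (4 <= k)%N ->
  E2 (fun t => collision_score j t ^+ 2) <=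
  4 * (k%:R * (p j + q j)) ^+ 2 * ((1 - p j) * (1 - q j)) ^+ (k - 4).
Proof.
move=> k4.
pose c : R := 2 * k%:R / (k%:R - 1).
rewrite (eq_mean _ (g := fun t => c ^+ 2 * (cell 2 0 j t + cell 0 2 j t) + 4 * cell 1 1 j t)); last first.
  move=> t; rewrite /collision_score -/c /cell.
  case: (count_mem j t.1) => [|[|[|a]]]; case: (count_mem j t.2) => [|[|[|b]]] //=; ring.
rewrite meanD !meanZ meanD !cell_mean /binp.
have k1 : k%:R - 1 != 0 :> R by rewrite subr_eq0 (eqr_nat R k 1); lia.
have k3 : 4 <= k%:R :> R by rewrite ler_nat.
have [p0 p1] := (hp.1 j, simplex_le1 hp j).
have [q0 q1] := (hq.1 j, simplex_le1 hq j).
have P4 n m (x : R) : (n + m = 4)%N -> x ^+ (k - n) = x ^+ (k - 4) * x ^+ m.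
  by move=> nm4; rewrite -exprD; congr (_ ^+ _); lia.
rewrite !binR2 !bin0 !bin1 !(P4 0%N 4%N)// !(P4 1%N 3%N)// !(P4 2%N 2%N)// [((1 - _) * _) ^+ (k - 4)]exprMn.
set u := p j in p0 p1 *; set v := q j in q0 q1 *.
rewrite !expr0 !expr1 !mul1r.
have U0 : 0 <= (1 - u) ^+ (k - 4) by rewrite exprn_ge0// subr_ge0.
have V0 : 0 <= (1 - v) ^+ (k - 4) by rewrite exprn_ge0// subr_ge0.
move: ((1 - u) ^+ (k - 4)) ((1 - v) ^+ (k - 4)) U0 V0 => U V U0 V0.
rewrite [leLHS](_ : _ = U * V * (2 * k%:R ^+ 3 / (k%:R - 1) *
  (u ^+ 2 * (1 - u) ^+ 2 * (1 - v) ^+ 4 + v ^+ 2 * (1 - v) ^+ 2 * (1 - u) ^+ 4) +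
  4 * k%:R ^+ 2 * (u * v * ((1 - u) ^+ 3 * (1 - v) ^+ 3)))); last first.
  by rewrite /c; field.
rewrite [leRHS](_ : _ = U * V * (4 * (k%:R * (u + v)) ^+ 2)); last by ring.
apply: ler_wpM2l; first exact: mulr_ge0.
have e1 n (x : R) : 0 <= x <= 1 -> 0 <= (1 - x) ^+ n <= 1.
  by move=> x01; rewrite exprn_ge0 ?exprn_ile1//; lra.
have := e1 2%N u; have := e1 4%N u; have := e1 3%N u.
have := e1 2%N v; have := e1 4%N v; have := e1 3%N v.
rewrite p0 p1 q0 q1 => /(_ isT) v3 /(_ isT) v4 /(_ isT) v2 /(_ isT) u3 /(_ isT) u4 /(_ isT) u2.
have kk : 2 * k%:R ^+ 3 / (k%:R - 1) <= 4 * k%:R ^+ 2 :> R.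
  by rewrite ler_pdivrMr; [nra|lra].
have kk0 : 0 <= 2 * k%:R ^+ 3 / (k%:R - 1) :> R.
  by rewrite divr_ge0 ?mulr_ge0 ?exprn_ge0//; lra.
have b1 : u ^+ 2 * (1 - u) ^+ 2 * (1 - v) ^+ 4 <= u ^+ 2.
  by rewrite -mulrA ler_piMr ?sqr_ge0//; nra.
have b2 : v ^+ 2 * (1 - v) ^+ 2 * (1 - u) ^+ 4 <= v ^+ 2.
  by rewrite -mulrA ler_piMr ?sqr_ge0//; nra.
have b3 : u * v * ((1 - u) ^+ 3 * (1 - v) ^+ 3) <= u * v.
  by rewrite ler_piMr ?mulr_ge0//; nra.
apply: (@le_trans _ _ (4 * k%:R ^+ 2 * (u ^+ 2 + v ^+ 2) + 4 * k%:R ^+ 2 * (u * v))).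
  apply: lerD.
    apply: ler_pM => //; last exact: lerD.
    by rewrite addr_ge0// !mulr_ge0 ?exprn_ge0 ?subr_ge0.
  by rewrite ler_wpM2l// mulr_ge0 ?exprn_ge0.
rewrite -mulrDr (_ : 4 * (_ * _) ^+ 2 = 4 * k%:R ^+ 2 * (u + v) ^+ 2); last by ring.
rewrite ler_wpM2l ?mulr_ge0 ?exprn_ge0//.
have : 0 <= u * v by exact: mulr_ge0.
nra.
Qed.

End Cells.

(** * The collision statistic: two coordinates *)

Section CovAlgebra.
Variable R : realType.

(** Two coordinates interact only through the replacement of (1 - p) (1 - p') by
    1 - p - p', an error of order p p'; its effect is smaller than the leading
    order by a factor of the size of the coordinates. *)
Lemma screened_product_le (p p' q q' : R) :
  0 <= p -> 0 <= p' -> 0 <= q -> 0 <= q' -> p + p' <= 1 -> q + q' <= 1 ->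
  ((p * (1 - q - q') - q * (1 - p - p')) *
   (p' * (1 - q - q') - q' * (1 - p - p'))) ^+ 2 <=
  (p - q) ^+ 2 * (p' - q') ^+ 2 *
    (((1 - p) * (1 - q)) ^+ 2 * ((1 - p') * (1 - q')) ^+ 2) +
  10 * (p + q) ^+ 2 * (p' + q') ^+ 2 * (p + q + (p' + q')).
Proof.
move=> p0 p'0 q0 q'0 pp qq.
set u := p + q; set v := p' + q'.
have u0 : 0 <= u by rewrite addr_ge0.
have v0 : 0 <= v by rewrite addr_ge0.
have uv2 : u + v <= 2 by rewrite /u /v; lra.
pose om := p * q' - q * p'; pose D := p - q; pose D' := p' - q'.
pose e := om * (D - D') - om ^+ 2.
have uv0 : 0 <= u * v by exact: mulr_ge0.
have Du : `|D| <= u by rewrite ler_norml /D /u; lra.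
have Dv : `|D'| <= v by rewrite ler_norml /D' /v; lra.
have omuv : `|om| <= u * v.
  have a : 0 <= p * p' by exact: mulr_ge0.
  have b : 0 <= p * q' by exact: mulr_ge0.
  have c : 0 <= q * p' by exact: mulr_ge0.
  have f : 0 <= q * q' by exact: mulr_ge0.
  by rewrite ler_norml /om /u /v; lra.
have uvs : u * v <= (u + v) / 2.
  have := sqr_ge0 (u - v); nra.
have ele : `|e| <= 3 / 2 * (u * v * (u + v)).
  apply: le_trans (ler_normB _ _) _; rewrite normrM normrX.
  have dd : `|D - D'| <= u + v by apply: le_trans (ler_normB _ _) _; exact: lerD.
  have h1 : `|om| * `|D - D'| <= u * v * (u + v) by exact: ler_pM.
  have h2 : `|om| ^+ 2 <= u * v * ((u + v) / 2).
    by rewrite expr2; apply: ler_pM => //; exact: le_trans uvs.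
  lra.
rewrite (_ : (_ * _) ^+ 2 = (D * D' + e) ^+ 2); last first.
  by rewrite /e /om /D /D'; congr (_ ^+ 2); ring.
rewrite -[p - q]/D -[p' - q']/D'.
have DD : `|D * D'| <= u * v by rewrite normrM; exact: ler_pM.
have cross : 2 * (D * D') * e <= 3 * (u * v) ^+ 2 * (u + v).
  have : (D * D') * e <= u * v * (3 / 2 * (u * v * (u + v))).
    by apply: le_trans (ler_norm _) _; rewrite normrM; apply: ler_pM.
  by lra.
have esq : e ^+ 2 <= 9 / 2 * (u * v) ^+ 2 * (u + v).
  have : e ^+ 2 <= (3 / 2 * (u * v * (u + v))) ^+ 2.
    by rewrite -real_normK ?num_real// lerXn2r ?nnegrE// !mulr_ge0// addr_ge0.
  have : (u * v) ^+ 2 * (u + v) * (u + v) <= (u * v) ^+ 2 * (u + v) * 2.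
    by rewrite ler_wpM2l// mulr_ge0 ?sqr_ge0 ?addr_ge0.
  by lra.
set rr := ((1 - p) * (1 - q)) ^+ 2 * _.
have rrge : 1 - rr <= 2 * (u + v).
  have a1 : 0 <= (1 - p) * (1 - q) <= 1 by nra.
  have a2 : 1 - u <= (1 - p) * (1 - q) by rewrite /u; nra.
  have b1 : 0 <= (1 - p') * (1 - q') <= 1 by nra.
  have b2 : 1 - v <= (1 - p') * (1 - q') by rewrite /v; nra.
  rewrite /rr; move: (_ * (1 - q)) (_ * (1 - q')) a1 a2 b1 b2 => A B A1 A2 B1 B2.
  have ab : 0 <= A * B <= 1 by nra.
  have : 1 - (u + v) <= A * B by nra.
  rewrite -exprMn; nra.
have DD2 : D ^+ 2 * D' ^+ 2 <= (u * v) ^+ 2.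
  by rewrite -exprMn -[leLHS]real_normK ?num_real// lerXn2r ?nnegrE.
have DDp : 0 <= D ^+ 2 * D' ^+ 2 by rewrite mulr_ge0 ?sqr_ge0.
have last : D ^+ 2 * D' ^+ 2 * (1 - rr) <= (u * v) ^+ 2 * (2 * (u + v)).
  apply: (@le_trans _ _ (D ^+ 2 * D' ^+ 2 * (2 * (u + v)))).
    exact: ler_wpM2l.
  by rewrite ler_wpM2r// mulr_ge0// addr_ge0.
have pos : 0 <= (u * v) ^+ 2 * (u + v) by rewrite mulr_ge0 ?sqr_ge0 ?addr_ge0.
lra.
Qed.

(** The left-hand side is what the trinomial law gives for the product of two
    scores.  It would be n^4 times a perfect square if falling factorials were
    powers; positive terms only decrease, and the negative ones lose at most the
    last term. *)
Lemma screened_moment_le (n p p' q q' r s : R) : 4 <= n ->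
  0 <= p -> 0 <= p' -> 0 <= q -> 0 <= q' -> 0 <= r <= 1 -> 0 <= s <= 1 ->
  (2 * n / (n - 1)) ^+ 2 *
    (n * (n - 1) * (n - 2) * (n - 3) / 4 *
        (p ^+ 2 * p' ^+ 2 * s ^+ 4 + q ^+ 2 * q' ^+ 2 * r ^+ 4) +
     (n * (n - 1) / 2) ^+ 2 *
        ((p ^+ 2 * q' ^+ 2 + q ^+ 2 * p' ^+ 2) * (r ^+ 2 * s ^+ 2))) -
  2 * (2 * n / (n - 1)) * (n * (n - 1) * (n - 2) / 2 * n) *
    (p ^+ 2 * p' * q' * (r * s ^+ 3) + q ^+ 2 * p' * q' * (r ^+ 3 * s) +
     p * p' ^+ 2 * q * (r * s ^+ 3) + p * q * q' ^+ 2 * (r ^+ 3 * s)) +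
  4 * (n * (n - 1)) ^+ 2 * (p * p' * q * q' * (r ^+ 2 * s ^+ 2)) <=
  n ^+ 4 * ((p * s - q * r) * (p' * s - q' * r)) ^+ 2 +
  2 * n ^+ 3 * ((p + q) ^+ 2 * (p' + q') ^+ 2).
Proof.
move=> n4 p0 p'0 q0 q'0 /andP[r0 r1] /andP[s0 s1].
set A := _ + q ^+ 2 * q' ^+ 2 * r ^+ 4; set B := _ * (r ^+ 2 * s ^+ 2).
set Y := _ + p * q * q' ^+ 2 * _; set Z := p * p' * q * q' * _.
have n1 : n - 1 != 0 by apply/eqP; lra.
have A0 : 0 <= A by rewrite addr_ge0// !mulr_ge0// exprn_ge0.
have Z0 : 0 <= Z by rewrite !mulr_ge0// exprn_ge0.
have sqE : ((p * s - q * r) * (p' * s - q' * r)) ^+ 2 = A + B - 2 * Y + 4 * Z.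
  by rewrite /A /B /Y /Z; ring.
have Yle : Y <= (p + q) ^+ 2 * (p' + q') ^+ 2 / 2.
  have m1 a b : (0 < a + b)%N -> 0 <= r ^+ a * s ^+ b <= 1.
    by move=> _; rewrite mulr_ge0 ?exprn_ge0//= mulr_ile1 ?exprn_ge0 ?exprn_ile1.
  have t (x y : R) : 0 <= x -> 0 <= y <= 1 -> x * y <= x.
    by move=> x0 /andP[y0 y1]; rewrite ler_piMr.
  have := m1 1%N 3%N isT; have := m1 3%N 1%N isT; rewrite !expr1 => m31 m13.
  have a1 : p ^+ 2 * p' * q' * (r * s ^+ 3) <= p ^+ 2 * p' * q'.
    by apply: t => //; rewrite !mulr_ge0 ?exprn_ge0.
  have a2 : q ^+ 2 * p' * q' * (r ^+ 3 * s) <= q ^+ 2 * p' * q'.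
    by apply: t => //; rewrite !mulr_ge0 ?exprn_ge0.
  have a3 : p * p' ^+ 2 * q * (r * s ^+ 3) <= p * p' ^+ 2 * q.
    by apply: t => //; rewrite !mulr_ge0 ?exprn_ge0.
  have a4 : p * q * q' ^+ 2 * (r ^+ 3 * s) <= p * q * q' ^+ 2.
    by apply: t => //; rewrite !mulr_ge0 ?exprn_ge0.
  have b1 : 0 <= (p ^+ 2 + q ^+ 2) * (p' - q') ^+ 2.
    by rewrite mulr_ge0 ?sqr_ge0// addr_ge0 ?sqr_ge0.
  have b2 : 0 <= (p' ^+ 2 + q' ^+ 2) * (p - q) ^+ 2.
    by rewrite mulr_ge0 ?sqr_ge0// addr_ge0 ?sqr_ge0.
  have b3 : 0 <= p * q * (p' * q') by rewrite !mulr_ge0.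
  have b4 : 0 <= p * q * (p' ^+ 2 + q' ^+ 2) by rewrite !mulr_ge0// addr_ge0 ?sqr_ge0.
  have b5 : 0 <= p' * q' * (p ^+ 2 + q ^+ 2) by rewrite !mulr_ge0// addr_ge0 ?sqr_ge0.
  rewrite /Y; nra.
rewrite sqE.
have cA : (2 * n / (n - 1)) ^+ 2 * (n * (n - 1) * (n - 2) * (n - 3) / 4) <= n ^+ 4.
  rewrite (_ : _ * _ = n ^+ 3 * ((n - 2) * (n - 3)) / (n - 1)); last by field.
  rewrite ler_pdivrMr; last by lra.
  rewrite (_ : n ^+ 4 * (n - 1) = n ^+ 3 * (n * (n - 1))); last by ring.
  rewrite ler_wpM2l ?exprn_ge0//; first by lra.
  nra.
have cB : (2 * n / (n - 1)) ^+ 2 * (n * (n - 1) / 2) ^+ 2 = n ^+ 4 by field.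
have cY : 2 * (2 * n / (n - 1)) * (n * (n - 1) * (n - 2) / 2 * n) = 2 * n ^+ 4 - 4 * n ^+ 3 by field.
have cZ : 4 * (n * (n - 1)) ^+ 2 <= 4 * n ^+ 4.
  rewrite (_ : 4 * n ^+ 4 = 4 * (n * n) ^+ 2); last by ring.
  by rewrite ler_wpM2l// lerXn2r ?nnegrE ?mulr_ge0//; nra.
have hA := ler_wpM2r A0 cA; have hZ := ler_wpM2r Z0 cZ.
have n3 : 0 <= n ^+ 3 by rewrite exprn_ge0//; lra.
have hY := ler_wpM2l n3 Yle.
rewrite cY mulrDr [X in X + _ - _ + _ <= _]mulrA [X in _ + X - _ + _ <= _]mulrA cB.
lra.
Qed.

End CovAlgebra.

Lemma simplex_pair_le1 (R : realType) (d : nat) (p : 'I_d -> R) (hp : simplex R d p) i j :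
  i != j -> p i + p j <= 1.
Proof.
move=> ij; rewrite -hp.2 (bigD1 i)//= lerD2l (bigD1 j) 1?eq_sym//= lerDl.
by apply: sumr_ge0 => l _; exact: hp.1.
Qed.

Section Covariance.
Variables (R : realType) (d k : nat) (p q : 'I_d -> R).
Hypotheses (hp : simplex R d p) (hq : simplex R d q) (k4 : (4 <= k)%N).

Let E2 := pairm (iid (obs hp) k) (iid (obs hq) k).
Let n : R := k%:R.
Let sg j : R := n * (p j + q j).
Let ee j : R := ((1 - p j) * (1 - q j)) ^+ (k - 4).

Lemma collision_score_mean2 i j : i != j ->
  let r := 1 - p i - p j in let s := 1 - q i - q j in
  E2 (fun t => collision_score R k i t * collision_score R k j t) =
  (r * s) ^+ (k - 4) * (
  (2 * n / (n - 1)) ^+ 2 *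
    (n * (n - 1) * (n - 2) * (n - 3) / 4 *
        (p i ^+ 2 * p j ^+ 2 * s ^+ 4 + q i ^+ 2 * q j ^+ 2 * r ^+ 4) +
     (n * (n - 1) / 2) ^+ 2 *
        ((p i ^+ 2 * q j ^+ 2 + q i ^+ 2 * p j ^+ 2) * (r ^+ 2 * s ^+ 2))) -
  2 * (2 * n / (n - 1)) * (n * (n - 1) * (n - 2) / 2 * n) *
    (p i ^+ 2 * p j * q j * (r * s ^+ 3) + q i ^+ 2 * p j * q j * (r ^+ 3 * s) +
     p i * p j ^+ 2 * q i * (r * s ^+ 3) + p i * q i * q j ^+ 2 * (r ^+ 3 * s)) +
  4 * (n * (n - 1)) ^+ 2 * (p i * p j * q i * q j * (r ^+ 2 * s ^+ 2))).
Proof.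
move=> ij; cbv zeta; set r := 1 - p i - p j; set s := 1 - q i - q j.
pose c : R := 2 * n / (n - 1).
pose z a b a' b' (t : seq 'I_d * seq 'I_d) := cell R a b i t * cell R a' b' j t.
rewrite (eq_mean _ (g := fun t =>
  c ^+ 2 * (z 2%N 0%N 2%N 0%N t + z 2%N 0%N 0%N 2%N t + z 0%N 2%N 2%N 0%N t + z 0%N 2%N 0%N 2%N t) -
  2 * c * (z 2%N 0%N 1%N 1%N t + z 0%N 2%N 1%N 1%N t + z 1%N 1%N 2%N 0%N t + z 1%N 1%N 0%N 2%N t) +
  4 * z 1%N 1%N 1%N 1%N t)); last by move=> t; rewrite /collision_score -/n -/c /z; ring.
rewrite meanD meanB !meanZ !meanD !cell_mean2// -/r -/s.
have P4 a b (x : R) : (a + b = 4)%N -> x ^+ (k - a) = x ^+ (k - 4) * x ^+ b.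
  by move=> ab; rewrite -exprD; congr (_ ^+ _); lia.
rewrite (_ : (k - (2 + 2) = k - 4)%N)//.
rewrite ?(P4 (2 + 0) 2)%N// ?(P4 (0 + 2) 2)%N// ?(P4 (0 + 0) 4)%N//.
rewrite ?(P4 (2 + 1) 1)%N// ?(P4 (1 + 2) 1)%N// ?(P4 (1 + 0) 3)%N// ?(P4 (0 + 1) 3)%N// ?(P4 (1 + 1) 2)%N//.
rewrite [(r * s) ^+ _]exprMn.
move: (r ^+ (k - 4)) (s ^+ (k - 4)) => U V.
have -> : ('C(k, 2 + 2) * 'C(2 + 2, 2))%:R = n * (n - 1) * (n - 2) * (n - 3) / 4.
  by rewrite natrM binR4 (_ : 'C(2 + 2, 2) = 6)%N// -/n; field.
have -> : ('C(k, 2 + 0) * 'C(2 + 0, 2))%:R = n * (n - 1) / 2.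
  by rewrite muln1 binR2.
have -> : ('C(k, 0 + 0) * 'C(0 + 0, 0))%:R = 1 :> R by rewrite muln1 bin0.
have -> : ('C(k, 2 + 1) * 'C(2 + 1, 2))%:R = n * (n - 1) * (n - 2) / 2.
  by rewrite natrM binR3 (_ : 'C(2 + 1, 2) = 3)%N// -/n; field.
have -> : ('C(k, 1 + 0) * 'C(1 + 0, 1))%:R = n by rewrite (_ : 'C(1 + 0, 1) = 1)%N// muln1 bin1.
have -> : ('C(k, 1 + 1) * 'C(1 + 1, 1))%:R = n * (n - 1).
  by rewrite natrM binR2 (_ : 'C(1 + 1, 1) = 2)%N// -/n; field.
rewrite !expr0 !expr1 -/c; move: c n (p i) (p j) (q i) (q j) r s => c' n' x x' y y' r' s'.
ring.
Qed.

(** Dependence between coordinates comes only from the fixed sample size, and it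
    costs a factor 1 / n, so that the covariances add up to no more than the
    variances. *)
Lemma collision_score_cov i j : i != j ->
  E2 (fun t => collision_score R k i t * collision_score R k j t) - E2 (collision_score R k i) * E2 (collision_score R k j) <=
  10 / n * (sg i ^+ 2 * sg j ^+ 2 * (1 + sg i + sg j) * (ee i * ee j)).
Proof.
move=> ij; rewrite collision_score_mean2// !collision_score_mean ?(leq_trans _ k4)//.
have [p0 p1] := (hp.1 i, hp.1 j); have [q0 q1] := (hq.1 i, hq.1 j).
have pp := simplex_pair_le1 hp ij; have qq := simplex_pair_le1 hq ij.
have n4 : 4 <= n by rewrite ler_nat.
have n0 : 0 < n by lra.
set r := 1 - p i - p j; set s := 1 - q i - q j.
have r01 : 0 <= r <= 1 by rewrite /r; apply/andP; split; lra.
have s01 : 0 <= s <= 1 by rewrite /s; apply/andP; split; lra.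
have := screened_moment_le n4 p0 p1 q0 q1 r01 s01.
set G := _ + 4 * _ * _ => Gle.
have := screened_product_le p0 p1 q0 q1 pp qq.
rewrite -[1 - q i - q j]/s -[1 - p i - p j]/r.
set X := (_ ^+ 2) in Gle * => Xle.
set ri := (1 - p i) * (1 - q i); set rj := (1 - p j) * (1 - q j).
rewrite -/ri -/rj in Xle.
have k42 : (k - 2 = k - 4 + 2)%N by clear -k4; lia.
have P2 (x : R) : x ^+ (k - 2) = x ^+ (k - 4) * x ^+ 2 by rewrite k42 exprD.
rewrite -/ri -/rj (P2 ri) (P2 rj) /ee -/ri -/rj.
have rirj : (r * s) ^+ (k - 4) <= ri ^+ (k - 4) * rj ^+ (k - 4).
  have [[r0 _] [s0 _]] := (andP r01, andP s01).
  have [a1 a2] := (simplex_le1 hp i, simplex_le1 hp j).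
  have [b1 b2] := (simplex_le1 hq i, simplex_le1 hq j).
  rewrite -exprMn lerXn2r ?nnegrE ?(mulr_ge0 r0)//.
    by rewrite /ri /rj !mulr_ge0// subr_ge0.
  rewrite /ri /rj (_ : _ * _ * _ = ((1 - p i) * (1 - p j)) * ((1 - q i) * (1 - q j))); last by ring.
  by apply: ler_pM; rewrite ?(andP r01).1 ?(andP s01).1// /r /s; nra.
have rs0 : 0 <= (r * s) ^+ (k - 4).
  by rewrite exprn_ge0// mulr_ge0 ?(andP r01).1 ?(andP s01).1.
set W := (r * s) ^+ (k - 4) in rirj rs0 *.
set U := ri ^+ (k - 4) in rirj *; set V := rj ^+ (k - 4) in rirj *.
have X0 : 0 <= X by exact: sqr_ge0.
have sq0 : 0 <= (p i + q i) ^+ 2 * (p j + q j) ^+ 2 by rewrite mulr_ge0 ?sqr_ge0.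
have n3 : 0 <= n ^+ 3 by rewrite exprn_ge0// ltW.
have nn4 : 0 <= n ^+ 4 by rewrite exprn_ge0// ltW.
set S2 := (p i + q i) ^+ 2 * (p j + q j) ^+ 2 in sq0 Gle *.
pose B := n ^+ 4 * X + 2 * n ^+ 3 * S2.
have B0 : 0 <= B by rewrite addr_ge0 ?(mulr_ge0 nn4)// mulr_ge0// mulr_ge0.
have h1 : W * G <= U * V * B.
  by apply: (@le_trans _ _ (W * B)); [exact: ler_wpM2l|exact: ler_wpM2r].
have UV0 : 0 <= U * V by exact: le_trans rs0 rirj.
set u := p i + q i; set v := p j + q j.
have u0 : 0 <= u by rewrite addr_ge0.
have v0 : 0 <= v by rewrite addr_ge0.
have h2 : B <= n ^+ 4 * ((p i - q i) ^+ 2 * (p j - q j) ^+ 2 * (ri ^+ 2 * rj ^+ 2) +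
   10 * u ^+ 2 * v ^+ 2 * (u + v)) + 2 * n ^+ 3 * (u ^+ 2 * v ^+ 2).
  by rewrite /B lerD2r ler_wpM2l.
have h3 := ler_wpM2l UV0 h2.
rewrite /sg -/u -/v.
rewrite (_ : 10 / n * _ = U * V * (10 * n ^+ 3 * (u ^+ 2 * v ^+ 2) + n ^+ 4 * (10 * u ^+ 2 * v ^+ 2 * (u + v)))); last first.
  by field; rewrite gt_eqF.
rewrite [X in _ - X <= _](_ : _ = U * V * (n ^+ 4 * ((p i - q i) ^+ 2 * (p j - q j) ^+ 2 * (ri ^+ 2 * rj ^+ 2)))); last first.
  by ring.
rewrite lerBlDl; apply: (le_trans h1); apply: (le_trans h3).
rewrite -mulrDr; apply: ler_wpM2l => //.
have : 0 <= n ^+ 3 * (u ^+ 2 * v ^+ 2) by rewrite mulr_ge0.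
lra.
Qed.

End Covariance.

(** * The collision statistic: variance *)

Section CauchySchwarz.
Variables (R : realType) (I : finType).
Implicit Types (P : pred I) (a b x y : I -> R).

Lemma cauchy_schwarz P a b :
  (\sum_(i | P i) a i * b i) ^+ 2 <= (\sum_(i | P i) a i ^+ 2) * (\sum_(i | P i) b i ^+ 2).
Proof.
have : 0 <= \sum_(i | P i) \sum_(j | P j) (a i * b j - a j * b i) ^+ 2.
  by apply: sumr_ge0 => i _; apply: sumr_ge0 => j _; exact: sqr_ge0.
set A := \sum_(i | P i) a i ^+ 2; set B := \sum_(i | P i) b i ^+ 2.
set C := \sum_(i | P i) a i * b i.
suff -> : \sum_(i | P i) \sum_(j | P j) (a i * b j - a j * b i) ^+ 2 =
  2 * (A * B - C ^+ 2) by lra.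
have sumsE f g : \sum_(i | P i) \sum_(j | P j) f i * g j =
    (\sum_(i | P i) f i) * \sum_(i | P i) g i :> R.
  by rewrite mulr_suml; apply: eq_bigr => i _; rewrite mulr_sumr.
transitivity (\sum_(i | P i) (\sum_(j | P j) a i ^+ 2 * b j ^+ 2 +
  \sum_(j | P j) b i ^+ 2 * a j ^+ 2 - 2 * \sum_(j | P j) (a i * b i) * (a j * b j))).
  apply: eq_bigr => i _; rewrite mulr_sumr -big_split -sumrB.
  by apply: eq_bigr => j _ /=; ring.
rewrite sumrB big_split /= -mulr_sumr !sumsE -/A -/B -/C; ring.
Qed.

(** Cauchy-Schwarz for the measure with masses [x i]; with x = 1 / w and y = w a
    it bounds from below the weighted sum of squares of [a]. *)
Lemma weighted_cauchy_schwarz P x y : (forall i, P i -> 0 <= x i) ->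
  (\sum_(i | P i) x i * y i) ^+ 2 <=
  (\sum_(i | P i) x i) * (\sum_(i | P i) x i * y i ^+ 2).
Proof.
move=> x0; pose s i := Num.sqrt (x i).
have sE i : P i -> s i ^+ 2 = x i by move=> Pi; rewrite sqr_sqrtr// x0.
rewrite (eq_bigr (fun i => s i * (s i * y i))); last first.
  by move=> i Pi; rewrite mulrA -expr2 sE.
apply: le_trans (cauchy_schwarz _ _ _) _; apply/eq_ler; congr (_ * _).
  by apply: eq_bigr => i; exact: sE.
by apply: eq_bigr => i Pi; rewrite exprMn sE.
Qed.

End CauchySchwarz.

Section ExpBounds.
Variable R : realType.

Lemma mul_expRN_le1 (x : R) : x * expR (- x) <= 1.
Proof.
rewrite expRN ler_pdivrMr ?expR_gt0// mul1r.
by have := expR_ge1Dx x; lra.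
Qed.

Lemma expR_le_inv (x : R) : x < 1 -> expR x <= (1 - x)^-1.
Proof.
move=> x1; have h := expR_ge1Dx (- x); rewrite expRN in h.
by rewrite -[expR x]invrK lef_pV2 ?posrE ?invr_gt0 ?expR_gt0// subr_gt0.
Qed.

Lemma ln_ge1 (x : R) : 3 <= x -> 1 <= ln x.
Proof.
move=> x3; have x0 : 0 < x by lra.
have e6 : expR (1 / 6) <= 6 / 5 :> R.
  by rewrite (_ : 6 / 5 = (1 - 1 / 6)^-1); [apply: expR_le_inv; lra|field].
rewrite -[1]expRK ler_ln ?posrE ?expR_gt0//; apply: le_trans x3.
have -> : expR 1 = expR (1 / 6) ^+ 6 :> R by rewrite -expRM_natl; congr expR; field.
apply: (@le_trans _ _ ((6 / 5) ^+ 6)); first by rewrite lerXn2r ?nnegrE ?expR_ge0.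
lra.
Qed.

Lemma expR_le_oneB (x : R) : 0 <= x <= 1 / 2 -> expR (- (2 * x)) <= 1 - x.
Proof.
move=> /andP[x0 x1]; rewrite expRN -[leLHS]mul1r ler_pdivrMr ?expR_gt0//.
have h := expR_ge1Dx (2 * x).
apply: (@le_trans _ _ ((1 - x) * (1 + 2 * x))); last by rewrite ler_wpM2l//; lra.
nra.
Qed.

Lemma cube_expRN_le (x : R) : 0 <= x -> x ^+ 3 * expR (- x) <= 27.
Proof.
move=> x0; rewrite expRN ler_pdivrMr ?expR_gt0//.
have h := expR_ge1Dx (x / 3).
have -> : expR x = expR (x / 3) ^+ 3 by rewrite -expRM_natl; congr expR; field.
have : (x / 3) ^+ 3 <= expR (x / 3) ^+ 3.
  by rewrite lerXn2r ?nnegrE ?expR_ge0//; lra.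
by rewrite expr_div_n; lra.
Qed.

Lemma screen_le_expR (k : nat) (p q : R) : (4 <= k)%N -> 0 <= p <= 1 -> 0 <= q <= 1 ->
  ((1 - p) * (1 - q)) ^+ (k - 4) <= expR 8 * expR (- (k%:R * (p + q))).
Proof.
move=> k4; have one x : 0 <= x <= 1 -> (1 - x) ^+ (k - 4) <= expR (4 - k%:R * x).
  move=> /andP[x0 x1]; apply: (@le_trans _ _ (expR (- x) ^+ (k - 4))).
    rewrite lerXn2r ?nnegrE ?expR_ge0 ?subr_ge0//.
    by have := expR_ge1Dx (- x).
  by rewrite -expRM_natl ler_expR natrB//; lra.
move=> hp hq; rewrite exprMn -expRD.
rewrite (_ : 8 - _ = (4 - k%:R * p) + (4 - k%:R * q)); last by ring.
by rewrite expRD ler_pM ?one ?exprn_ge0// subr_ge0; [case/andP: hp|case/andP: hq].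
Qed.

End ExpBounds.

Section CollisionVariance.
Variables (R : realType) (d k : nat) (p q : 'I_d -> R).
Hypotheses (hp : simplex R d p) (hq : simplex R d q) (k4 : (4 <= k)%N).

Let E2 := pairm (iid (obs hp) k) (iid (obs hq) k).
Let n : R := k%:R.
Let sg j : R := n * (p j + q j).
Let ee j : R := ((1 - p j) * (1 - q j)) ^+ (k - 4).

Definition collision_stat (t : seq 'I_d * seq 'I_d) : R := \sum_j collision_score R k j t.

Definition collision_stat_mean : R :=
  \sum_j (n * (p j - q j)) ^+ 2 * ((1 - p j) * (1 - q j)) ^+ (k - 2).

(** The n^2 covariances carry the factor 1 / n, which Cauchy-Schwarz against the
    total mass sum_j sg j = 2 n absorbs. *)
Lemma collision_stat_var : E2 (fun t => (collision_stat t - collision_stat_mean) ^+ 2) <=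
  600 * expR 8 * \sum_j sg j ^+ 2 * ee j.
Proof.
pose m j := E2 (collision_score R k j).
have n4 : 4 <= n by rewrite ler_nat.
have n0 : 0 < n by lra.
have mE : collision_stat_mean = \sum_j m j.
  by apply: eq_bigr => j _; rewrite /m collision_score_mean ?(leq_trans _ k4).
have sg0 j : 0 <= sg j by rewrite mulr_ge0 ?(ltW n0)// addr_ge0 ?hp.1 ?hq.1.
have p01 j : 0 <= p j <= 1 by rewrite hp.1 simplex_le1.
have q01 j : 0 <= q j <= 1 by rewrite hq.1 simplex_le1.
have ee0 j : 0 <= ee j.
  by rewrite exprn_ge0// mulr_ge0// subr_ge0 simplex_le1.
have eele j : ee j <= expR 8 * expR (- sg j) by exact: screen_le_expR.
have -> : E2 (fun t => (collision_stat t - collision_stat_mean) ^+ 2) =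
   \sum_i \sum_j (E2 (fun t => collision_score R k i t * collision_score R k j t) - m i * m j).
  rewrite (eq_mean _ (g := fun t => \sum_i \sum_j
     (collision_score R k i t - m i) * (collision_score R k j t - m j))); last first.
    by move=> t; rewrite mE -sumrB expr2 big_distrlr.
  rewrite mean_sum; apply: eq_bigr => i _; rewrite mean_sum; apply: eq_bigr => j _.
  rewrite (eq_mean _ (g := fun t => (collision_score R k i t * collision_score R k j t - m i * collision_score R k j t) -
     (m j * collision_score R k i t - m i * m j))); last by move=> t; ring.
  by rewrite !meanB !meanZ mean_cst -/(m i) -/(m j); ring.
pose F i j := 10 / n * (sg i ^+ 2 * sg j ^+ 2 * (1 + sg i + sg j) * (ee i * ee j)).
have F0 i j : 0 <= F i j.
  apply: mulr_ge0; first by rewrite divr_ge0// ltW.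
  apply: mulr_ge0; last exact: mulr_ge0.
  by apply: mulr_ge0; [rewrite mulr_ge0 ?sqr_ge0|rewrite !addr_ge0].
apply: (@le_trans _ _ (\sum_i (4 * (sg i ^+ 2 * ee i) + \sum_j F i j))).
  apply: ler_sum => i _; rewrite (bigD1 i)//=; apply: lerD.
    apply: (@le_trans _ _ (E2 (fun t => collision_score R k i t ^+ 2))).
      by rewrite lerBlDr -[m i * m i]expr2 lerDl sqr_ge0.
    by apply: le_trans (collision_score_sqr hp hq i k4) _; rewrite /sg /ee -mulrA.
  rewrite [leRHS](bigD1 i)//= -[leLHS]add0r; apply: lerD => //.
  apply: ler_sum => j ji; apply: collision_score_cov => //; by rewrite eq_sym.
rewrite big_split /= -mulr_sumr.
pose A := \sum_j sg j ^+ 2 * ee j; pose B := \sum_j sg j ^+ 3 * ee j.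
have FE : \sum_i \sum_j F i j = 10 / n * (A ^+ 2 + 2 * A * B).
  have dbl f g : (\sum_i f i) * (\sum_j g j) = \sum_i \sum_j f i * g j :> R.
    by rewrite mulr_suml; apply: eq_bigr => i _; rewrite mulr_sumr.
  rewrite (_ : A ^+ 2 + 2 * A * B = A * A + (A * B + B * A)); last by ring.
  rewrite !dbl -!big_split /= mulr_sumr; apply: eq_bigr => i _.
  rewrite -!big_split /= mulr_sumr; apply: eq_bigr => j _.
  by rewrite /F; ring.
have A0 : 0 <= A by apply: sumr_ge0 => j _; rewrite mulr_ge0 ?sqr_ge0.
have sumsg : \sum_j sg j = 2 * n.
  by rewrite -mulr_sumr big_split /= hp.2 hq.2; ring.
have cs m' c : 0 <= c -> (forall j, sg j ^+ m'.*2.+1 * ee j <= c) ->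
    (\sum_j sg j ^+ (m'.+2) * ee j) ^+ 2 <= 2 * n * (c * A).
  move=> c0 hc; rewrite -sumsg.
  rewrite (eq_bigr (fun j => sg j * (sg j ^+ m'.+1 * ee j))); last first.
    by move=> j _; rewrite mulrA -exprS.
  apply: le_trans (weighted_cauchy_schwarz _ _) _; first by [].
  rewrite ler_wpM2l ?sumr_ge0// mulr_sumr; apply: ler_sum => j _.
  rewrite (_ : sg j * _ = (sg j ^+ m'.*2.+1 * ee j) * (sg j ^+ 2 * ee j)).
    by rewrite ler_wpM2r// mulr_ge0 ?sqr_ge0.
  rewrite exprMn -exprM (_ : (m'.+1 * 2 = m'.*2 + 2)%N) ?exprD ?exprS; last by lia.
  by ring.
have e8 : 0 <= expR 8 :> R by exact: expR_ge0.
have A2 : A ^+ 2 <= 2 * n * (expR 8 * A).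
  apply: (cs 0%N) => // j; rewrite expr1.
  apply: (@le_trans _ _ (sg j * (expR 8 * expR (- sg j)))); first by rewrite ler_wpM2l.
  by rewrite mulrCA ler_piMr ?mul_expRN_le1.
have B2 : B ^+ 2 <= 2 * n * (27 * expR 8 * A).
  apply: (cs 1%N) => [|j]; first by rewrite mulr_ge0.
  apply: (@le_trans _ _ (sg j ^+ 3 * (expR 8 * expR (- sg j)))).
    by rewrite ler_wpM2l ?exprn_ge0.
  by rewrite mulrCA mulrC ler_wpM2r ?cube_expRN_le.
have AB : A ^+ 2 + 2 * A * B <= 2 * A ^+ 2 + B ^+ 2.
  by have := sqr_ge0 (A - B); nra.
have : 10 / n * (A ^+ 2 + 2 * A * B) <= 10 / n * (58 * n * (expR 8 * A)).
  rewrite ler_wpM2l ?divr_ge0 ?(ltW n0)//; lra.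
rewrite FE (_ : 10 / n * (58 * _ * _) = 580 * (expR 8 * A)); last first.
  by field; rewrite gt_eqF.
have : A <= expR 8 * A by rewrite ler_peMl// -expR0 ler_expR.
rewrite -/A; lra.
Qed.

End CollisionVariance.

(** * Coupling a neighbor with its profile, and order statistics *)

Section DyadicIndex.
Variable R : realType.
Implicit Types x y : R.

Definition dyadic_index x : int :=
  xget 0 [set i : int | 2 ^ (- i) <= x < 2 ^ (- i + 1)].

Lemma exp2zS (i : int) : 2 ^ (i + 1) = 2 * 2 ^ i :> R.
Proof. by rewrite expfzDr ?pnatr_eq0// mulrC expr1z. Qed.

Lemma dyadic_indexP x : 0 < x -> x <= 1 ->
  2 ^ (- dyadic_index x) <= x < 2 ^ (- dyadic_index x + 1).
Proof.
move=> x0 x1; rewrite /dyadic_index.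
suff [i hi] : exists i : int, 2 ^ (- i) <= x < 2 ^ (- i + 1).
  exact: (@xgetPex _ 0 [set i : int | 2 ^ (- i) <= x < 2 ^ (- i + 1)] (ex_intro _ i hi)).
have ex : exists m : nat, 2 ^- m <= x.
  exists (Num.Def.archi_bound x^-1).
  rewrite -[leRHS]invrK lef_pV2 ?posrE ?exprn_gt0 ?invr_gt0//.
  exact/ltW/upper_nthrootP.
case: (ex_minnP ex) => m hm mmin; exists m%:Z.
rewrite exp2zS -exprnN hm /=; case: m hm mmin => [|m] hm mmin.
  by rewrite expr0 invr1; lra.
have : ~~ (2 ^- m <= x) by apply/negP => /mmin; rewrite ltnn.
by rewrite -ltNge exprS invfM mulrA divff ?mul1r.
Qed.

Lemma dyadic_index_uniq x (i : int) : 0 < x -> x <= 1 ->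
  2 ^ (- i) <= x < 2 ^ (- i + 1) -> dyadic_index x = i.
Proof.
move=> x0 x1 /andP[a b]; have /andP[a' b'] := dyadic_indexP x0 x1.
have := le_lt_trans a b'; have := le_lt_trans a' b.
rewrite !ltr_eXz2l ?ltr1n//; lia.
Qed.

Lemma dyadic_classE (d : nat) (u : 'I_d -> R) (hu : simplex R d u) i j :
  (j \in dyadic_class u i) = (0 < u j) && (dyadic_index (u j) == i).
Proof.
have u1 : u j <= 1.
  by rewrite -hu.2 (bigD1 j)//= lerDl; apply: sumr_ge0 => l _; exact: hu.1.
rewrite inE; apply/idP/andP => [h|[u0 /eqP <-]]; last exact: dyadic_indexP.
have u0 : 0 < u j by case/andP: h => h _; apply: lt_le_trans h; exact: exprz_gt0.
by split => //; apply/eqP/dyadic_index_uniq.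
Qed.

(** The asymmetric window is the point: y <= 4 x, and not y <= 8 x, makes
    exp (- 2 x) at most exp (- y / 2). *)
Lemma dyadic_window x y : 0 < x <= 1 -> 0 < y <= 1 ->
  -1 <= dyadic_index y - dyadic_index x <= 3 -> x <= 16 * y /\ y <= 4 * x.
Proof.
move=> /andP[x0 x1] /andP[y0 y1].
have /andP[a b] := dyadic_indexP x0 x1; have /andP[a' b'] := dyadic_indexP y0 y1.
move: (dyadic_index x) (dyadic_index y) a b a' b' => i j a b a' b' ij.
have h1 : 2 ^ (- j) <= 2 ^ (- i + 1) :> R by rewrite ler_eXz2l ?ltr1n//; lia.
have h2 : 2 ^ (- i) <= 2 ^ (- j + 1 + 1 + 1) :> R by rewrite ler_eXz2l ?ltr1n//; lia.
rewrite !exp2zS in b b' h1 h2; lra.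
Qed.

End DyadicIndex.

Section Coupling.
Variables (R : realType) (d : nat) (pi q : 'I_d -> R).
Hypotheses (hpi : simplex R d pi) (hq : neighborhood pi q).

Let window : seq int := [:: -1; 0; 1; 2; 3].
Let idx (u : 'I_d -> R) j := dyadic_index (u j).
Let near_idx j l := [&& 0 < q j, 0 < pi l & -1 <= idx pi l - idx q j <= 3].
Let load (i : int) : R := \sum_(l | 0 < pi l) (-1 <= idx pi l - i <= 3)%R%:R.
Let a j l : R := (near_idx j l)%:R / load (idx q j).

Let hq1 : simplex R d q := hq.1.

(** Among the constraints that involve class i of q, the one centered at i + 1
    has the window i - 1, ..., i + 3 on the side of [pi]. *)
Lemma card_class_le_load i : #|dyadic_class q i|%:R <= 3 / 2 * load i.
Proof.
have [_] := hq.2 (i + 1).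
rewrite addrK !big_cons !big_nil !addr0.
rewrite -!addrA (_ : 1 - 2 = -1)//.
set e1 := #|dyadic_class q (i + _)|%:R; set e2 := #|dyadic_class q (i + _)|%:R.
have e10 : 0 <= e1 by []. have e20 : 0 <= e2 by [].
move=> h; apply: (@le_trans _ _ (#|dyadic_class q i|%:R + (e1 + e2))).
  by rewrite lerDl addr_ge0.
apply: le_trans h _; rewrite ler_wpM2l//.
have cE j : #|dyadic_class pi j|%:R = \sum_(l | 0 < pi l) (idx pi l == j)%:R :> R.
  rewrite -sum1_card natr_sum [LHS]big_mkcond [RHS]big_mkcond /=.
  apply: eq_bigr => l _; rewrite dyadic_classE//.
  by case: (0 < pi l) => //=; case: (_ == j).
rewrite !cE -!big_split /=; apply: ler_sum => l _; rewrite -!natrD ler_nat.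
lia.
Qed.

Lemma near_idx_bound j l : near_idx j l -> q j <= 16 * pi l /\ pi l <= 4 * q j.
Proof.
move=> /and3P[qj pl]; apply: dyadic_window.
  by rewrite qj -hq1.2 (bigD1 j)//= lerDl; apply: sumr_ge0 => i _; exact: hq1.1.
by rewrite pl -hpi.2 (bigD1 l)//= lerDl; apply: sumr_ge0 => i _; exact: hpi.1.
Qed.

(** Each entry of q spreads a unit mass uniformly over the entries of [pi] in its
    window.  An entry of [pi] is in the windows of five classes and receives at
    most 3 / 2 from each, hence 15 / 2. *)
Lemma neighborhood_coupling : exists c : 'I_d -> 'I_d -> R,
  [/\ forall j l, 0 <= c j l,
      forall j, 0 < q j -> \sum_l c j l = 1,
      forall l, \sum_j c j l <= 15 / 2 &
      forall j l, c j l != 0 ->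
        [/\ 0 < q j, 0 < pi l, q j <= 16 * pi l & pi l <= 4 * q j]].
Proof.
have load0 i : 0 <= load i by apply: sumr_ge0.
exists a; split.
- by move=> j l; rewrite divr_ge0.
- move=> j qj; rewrite -mulr_suml.
  rewrite (_ : \sum_l (near_idx j l)%:R = load (idx q j)).
    rewrite divff//; apply: contraL (card_class_le_load (idx q j)) => /eqP ->.
    rewrite mulr0 -ltNge ltr0n card_gt0; apply/set0Pn; exists j.
    by rewrite dyadic_classE// qj /idx eqxx.
  rewrite [RHS]big_mkcond; apply: eq_bigr => l _.
  by rewrite /near_idx qj /=; case: (0 < pi l).
- move=> l.
  apply: (@le_trans _ _ (\sum_j \sum_(e <- window)
     (j \in dyadic_class q (idx pi l - e))%:R / load (idx pi l - e))).
    apply: ler_sum => j _; rewrite /a; case: (boolP (near_idx j l)) => [h|_]; last first.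
      by rewrite mul0r; apply: sumr_ge0 => e _; rewrite divr_ge0.
    have [qj pl hw] := and3P h.
    have ew : idx pi l - idx q j \in window.
      by rewrite /window !inE; move: hw; lia.
    rewrite (big_rem _ ew) /= (_ : idx pi l - (idx pi l - idx q j) = idx q j); last by ring.
    rewrite dyadic_classE// qj /= /idx eqxx lerDl.
    by apply: sumr_ge0 => e _; rewrite divr_ge0.
  rewrite exchange_big /=.
  apply: (@le_trans _ _ (\sum_(e <- window) (3 / 2))).
    apply: ler_sum => e _; rewrite -mulr_suml.
    have := card_class_le_load (idx pi l - e); set L := load _.
    rewrite -sum1_card natr_sum big_mkcond /=.
    rewrite (eq_bigr (fun j => (j \in dyadic_class q (idx pi l - e))%:R)); last first.
      by move=> j _; case: (_ \in _).
    have := load0 (idx pi l - e); rewrite -/L le_eqVlt => /orP[/eqP <- _|L0].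
      by rewrite invr0 mulr0.
    by rewrite ler_pdivrMr.
  by rewrite /window !big_cons big_nil; lra.
move=> j l; rewrite /a; case: (boolP (near_idx j l)) => [h _|_]; last by rewrite mul0r eqxx.
by have [? ?] := near_idx_bound h; case/and3P: h => ? ? _.
Qed.

Lemma neighborhood_sum_le (f g : 'I_d -> R) : (forall l, 0 <= g l) ->
  (forall j l, 0 < q j -> 0 < pi l -> q j <= 16 * pi l -> pi l <= 4 * q j -> f j <= g l) ->
  \sum_(j | 0 < q j) f j <= 15 / 2 * \sum_l g l.
Proof.
move=> g0 fg; have [c [c0 c1 c2 cn]] := neighborhood_coupling.
apply: (@le_trans _ _ (\sum_(j | 0 < q j) \sum_l c j l * g l)).
  apply: ler_sum => j qj; rewrite -[f j]mul1r -(c1 j qj) mulr_suml.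
  apply: ler_sum => l _; have [->|/cn[? ? ? ?]] := eqVneq (c j l) 0; first by rewrite !mul0r.
  by rewrite ler_wpM2l// fg.
rewrite exchange_big /= mulr_sumr; apply: ler_sum => l _.
rewrite -mulr_suml ler_wpM2r//; apply: le_trans (c2 l).
by rewrite [leRHS](bigID (fun j => 0 < q j)) /= lerDl; apply: sumr_ge0.
Qed.

(** The set consists of the coordinates that send at least half of their mass
    into [S]: there are few of them as [S] receives little, and the other ones
    are charged to the complement of [S]. *)
Lemma neighborhood_split (S : {set 'I_d}) : exists A : {set 'I_d},
  (#|A| <= 15 * #|S|)%N /\ \sum_(j in ~: A) q j <= 240 * \sum_(l in ~: S) pi l.
Proof.
have [c [c0 c1 c2 cn]] := neighborhood_coupling.
pose al j := \sum_(l in S) c j l; pose be j := \sum_(l in ~: S) c j l.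
have albe j : 0 < q j -> al j + be j = 1.
  move=> qj; rewrite -(c1 j qj) [RHS](bigID (mem S)) /=; congr (_ + _).
  by apply: eq_bigl => l; rewrite inE.
exists [set j | 1 / 2 <= al j]%SET; split.
  rewrite -(ler_nat R) natrM; set A := [set j | _]%SET.
  have : \sum_(j in A) (1 / 2) <= \sum_(l in S) (15 / 2) :> R.
    apply: (@le_trans _ _ (\sum_j al j)).
      rewrite [leRHS](bigID (mem A)) /= -[leLHS]addr0; apply: lerD.
        by apply: ler_sum => j; rewrite inE.
      by apply: sumr_ge0 => j _; apply: sumr_ge0.
    by rewrite exchange_big /=; apply: ler_sum.
  by rewrite !sumr_const -!(mulr_natr (_ / _)); lra.
apply: (@le_trans _ _ (\sum_j 2 * \sum_(l in ~: S) c j l * (16 * pi l))).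
  rewrite [leRHS](bigID (mem (~: [set j | 1 / 2 <= al j]%SET))) /= -[leLHS]addr0; apply: lerD.
    apply: ler_sum => j; rewrite !inE -ltNge => alj.
    have := hq1.1 j; rewrite le_eqVlt => /orP[/eqP <-|qj].
      by rewrite mulr_ge0// sumr_ge0// => l _; rewrite !mulr_ge0// hpi.1.
    have be2 : 1 / 2 <= be j by have := albe j qj; lra.
    apply: (@le_trans _ _ (2 * (be j * q j))).
      have : 1 / 2 * q j <= be j * q j by rewrite ler_wpM2r// ltW.
      lra.
    rewrite ler_wpM2l// mulr_suml; apply: ler_sum => l _.
    have [->|/cn[? ? ? ?]] := eqVneq (c j l) 0; first by rewrite !mul0r.
    by rewrite ler_wpM2l.
  by apply: sumr_ge0 => j _; rewrite mulr_ge0// sumr_ge0// => l _; rewrite !mulr_ge0// hpi.1.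
rewrite -mulr_sumr exchange_big /= !mulr_sumr; apply: ler_sum => l _.
rewrite -mulr_suml.
have : (\sum_j c j l) * (16 * pi l) <= 15 / 2 * (16 * pi l).
  by rewrite ler_wpM2r ?mulr_ge0 ?hpi.1.
lra.
Qed.

End Coupling.

Section Ranks.
Variables (R : realType) (d : nat) (u : 'I_d -> R).

Let e := sort (relpre u >=%R) (enum 'I_d).
Let s := [seq u l | l <- e].

Let perm_e : perm_eq e (enum 'I_d). Proof. by rewrite perm_sort. Qed.

Let size_e : size e = d. Proof. by rewrite size_sort size_enum_ord. Qed.

Lemma order_statE j : order_stat u j = nth 0 s j.-1.
Proof. by rewrite /order_stat sort_map. Qed.

Lemma sum_ranks (F : R -> R) : \sum_l F (u l) = \sum_(0 <= i < d) F (nth 0 s i).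
Proof.
transitivity (\sum_(l <- e) F (u l)).
  by rewrite (perm_big _ perm_e) /= big_enum.
rewrite -(big_map u predT F) (big_nth 0) size_map size_e.
by [].
Qed.

Lemma order_stat_sorted i j : (i <= j)%N -> (j < d)%N -> nth 0 s j <= nth 0 s i.
Proof.
move=> ij jd.
have srt : sorted >=%R s.
  by rewrite /s -sort_map; apply: sort_sorted => x y; exact: ge_total.
apply: (sorted_leq_nth _ _ _ srt) => //; rewrite ?inE ?size_map ?size_e//.
- by move=> x y z /= a b; exact: le_trans b a.
- by move=> x /=.
- exact: leq_ltn_trans jd.
Qed.

Lemma top_ranks I : (0 < I)%N -> exists S : {set 'I_d},
  (#|S| <= I)%N /\ \sum_(l in ~: S) u l = \sum_(I <= i < d.+1) order_stat u i.
Proof.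
move=> I0; pose S := [set l in take I.-1 e]%SET.
have uniq_e : uniq e by rewrite (perm_uniq perm_e) enum_uniq.
exists S; split.
  rewrite cardsE (leq_trans (card_size _))// size_take; case: ifP => //; lia.
transitivity (\sum_(l <- drop I.-1 e) u l).
  transitivity (\sum_(l <- e | l \in ~: S) u l).
    by rewrite (perm_big _ perm_e) /= big_enum_cond.
  rewrite -[in LHS](cat_take_drop I.-1 e) big_cat /= big_seq_cond big1 => [|l]; last first.
    by rewrite !inE => /andP[->].
  rewrite add0r big_seq_cond [RHS]big_seq; apply: eq_bigl => l.
  rewrite !inE; case: (boolP (l \in drop _ _)) => //= ld.
  have := uniq_e; rewrite -{1}(cat_take_drop I.-1 e) cat_uniq => /and3P[_ /hasPn h _].
  exact: h.
rewrite -(big_map u predT id) (big_nth 0) size_map size_drop size_e.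
case: I I0 {S} => // I _ /=.
symmetry; rewrite big_add1 /= -{1}[I]add0n big_addn; apply: eq_bigr => i _.
by rewrite order_statE /= map_drop nth_drop addnC.
Qed.

Lemma small_rankP k : (0 < d)%N ->
  (0 < small_rank u k <= d)%N /\
  (forall l, (small_rank u k <= l < d)%N -> nth 0 s l <= 1 / k%:R).
Proof.
move=> d0; rewrite /small_rank.
set P := fun j => order_stat u j <= 1 / k%:R.
have [le1 le2] : (\big[minn/d]_(1 <= j < d.+1 | P j) j <= d)%N /\
   (0 < \big[minn/d]_(1 <= j < d.+1 | P j) j)%N.
  rewrite big_seq_cond; elim/big_rec : _ => [|j x /andP[]]; first by rewrite d0 leqnn.
  by rewrite mem_index_iota => /andP[j0 jd] _ [xd x0]; rewrite geq_min xd orbT leq_min j0 x0.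
split; first by rewrite le1 le2.
move=> l /andP[Jl ld].
set J := \big[minn/d]_(_ <= j < _ | P j) j in le1 le2 Jl *.
have : P J \/ J = d.
  rewrite /J; elim/big_rec : _ => [|j x Pj [Px|->]]; first by right.
    by left; rewrite /minn; case: ifP.
  rewrite /minn; case: ifP; [by left|by right].
case=> [PJ|Jd]; last by rewrite Jd leqNgt ld in Jl.
apply: le_trans PJ; rewrite order_statE; apply: order_stat_sorted => //.
by apply: leq_trans Jl; exact: leq_pred.
Qed.

Lemma head_ranks k (F : R -> R) : (0 < d)%N -> (forall x, 0 <= F x) ->
  \sum_(l | 1 / k%:R < u l) F (u l) <=
  \sum_(1 <= i < (small_rank u k).+1) F (order_stat u i).
Proof.
move=> d0 F0; have [/andP[J0 Jd] small] := small_rankP k d0.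
rewrite big_mkcond (sum_ranks (fun x => if 1 / k%:R < x then F x else 0)).
rewrite (@big_cat_nat _ _ _ (small_rank u k))//= [X in _ + X]big_nat_cond [X in _ + X]big1 => [|l]; last first.
  by rewrite andbT => /small h; rewrite ltNge h.
rewrite addr0 big_add1 /=; apply: ler_sum => i _; rewrite order_statE /=.
by case: ifP.
Qed.

End Ranks.

(** * Cube roots, inverse moments of counts, and weights *)

Section CubeRoot.
Variable R : realType.
Implicit Types x y : R.

Definition cbrt x : R := x `^ (1 / 3).

Lemma cbrt_ge0 x : 0 <= cbrt x. Proof. exact: powR_ge0. Qed.

Lemma cbrtK x : 0 <= x -> cbrt x ^+ 3 = x.
Proof.
move=> x0; rewrite -powR_mulrn ?cbrt_ge0// -powRrM (_ : 1 / 3 * 3%:R = 1); last by field.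
by rewrite powRr1.
Qed.

Lemma le_cbrt x y : 0 <= x -> 0 <= y -> x <= y ^+ 3 -> cbrt x <= y.
Proof.
move=> x0 y0 xy; rewrite -(@ler_pXn2r _ 3)// ?nnegrE ?cbrt_ge0//.
by rewrite cbrtK.
Qed.

Lemma ge_cbrt x y : 0 <= x -> 0 <= y -> y ^+ 3 <= x -> y <= cbrt x.
Proof.
move=> x0 y0 xy; rewrite -(@ler_pXn2r _ 3)// ?nnegrE ?cbrt_ge0//.
by rewrite cbrtK.
Qed.

Lemma cbrt0 : cbrt 0 = 0.
Proof. by apply/eqP; rewrite eq_le cbrt_ge0 le_cbrt// expr0n. Qed.

Lemma cbrt_gt0 x : 0 < x -> 0 < cbrt x.
Proof. exact: powR_gt0. Qed.

Lemma powR23E x : x `^ (2 / 3) = cbrt x ^+ 2.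
Proof.
by rewrite -powR_mulrn ?cbrt_ge0// -powRrM (_ : 1 / 3 * 2%:R = 2 / 3)//; field.
Qed.

(** Contribution of an entry of size x to the null variance of the U-statistic
    with weights (1 + count)^(-2/3). *)
Definition small_or_root x : R := Num.min (cbrt x ^+ 2) (x ^+ 2).

Lemma small_or_root_ge0 x : 0 <= small_or_root x.
Proof. by rewrite le_min !sqr_ge0. Qed.

Lemma small_or_root_le x y : 0 <= x -> 0 <= y -> x <= 16 * y ->
  small_or_root x <= 256 * small_or_root y.
Proof.
move=> x0 y0 xy.
have h : cbrt x <= 16 * cbrt y.
  by apply: le_cbrt; rewrite ?mulr_ge0 ?cbrt_ge0// exprMn cbrtK//; lra.
have h2 : cbrt x ^+ 2 <= 256 * cbrt y ^+ 2.
  rewrite (_ : 256 * _ = (16 * cbrt y) ^+ 2); last by ring.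
  by rewrite lerXn2r ?nnegrE ?mulr_ge0 ?cbrt_ge0.
have h3 : x ^+ 2 <= 256 * y ^+ 2.
  rewrite (_ : 256 * _ = (16 * y) ^+ 2); last by ring.
  by rewrite lerXn2r ?nnegrE ?mulr_ge0.
rewrite /small_or_root [in leRHS]/Num.min; case: ifP => _.
  by rewrite ge_min h2.
by rewrite ge_min h3 orbT.
Qed.

Lemma small_or_rootE x : 1 <= x -> small_or_root x = cbrt x ^+ 2.
Proof.
move=> x1; have x0 : 0 <= x by lra.
rewrite /small_or_root min_l// lerXn2r ?nnegrE ?cbrt_ge0// le_cbrt//.
by rewrite exprS ler_peMr// expr_ge1.
Qed.

End CubeRoot.

Section CountMoments.
Variables (R : realType) (d m : nat) (q : 'I_d -> R).
Hypothesis hq : simplex R d q.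

Let E := iid (obs hq) m.

Lemma count_mean j : E (fun y => (count_mem j y)%:R) = m%:R * q j.
Proof.
rewrite -(obs_ind hq j) -iid_sum; apply: eq_mean => y.
rewrite -sum1_count natr_sum big_mkcond; apply: eq_bigr => z _ /=.
by case: (z == j).
Qed.

(** Dividing a binomial coefficient by (a + 1) (a + 2) shifts both of its
    arguments by two, and the shifted binomial probabilities sum to at most 1. *)
Lemma count_inv_sqr j : 0 < q j ->
  m.+1%:R * m.+2%:R * q j ^+ 2 * E (fun y => ((1 + (count_mem j y)%:R) ^+ 2)^-1) <= 2.
Proof.
move=> qj; set x := q j in qj *.
have x1 : x <= 1 by exact: simplex_le1.
pose B a : R := 'C(m, a)%:R * (x ^+ a * (1 - x) ^+ (m - a)).
have -> : E (fun y => ((1 + (count_mem j y)%:R) ^+ 2)^-1) =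
    \sum_(a < m.+1) ((1 + a%:R) ^+ 2)^-1 * B a.
  rewrite (eq_iid _ (g := fun y => \sum_(a < m.+1)
      ((1 + a%:R) ^+ 2)^-1 * (count_mem j y == a)%:R)).
    rewrite mean_sum; apply: eq_bigr => a _.
    by rewrite meanZ iid_count obs_ind.
  move=> y sy; have cm : (count_mem j y < m.+1)%N by rewrite ltnS -sy count_size.
  rewrite (bigD1 (Ordinal cm))//= eqxx mulr1 big1 ?addr0// => a an.
  case: eqP => [ca|_]; last by rewrite mulr0.
  by case/eqP: an; apply: val_inj => /=; rewrite ca.
pose B2 b : R := 'C(m.+2, b)%:R * (x ^+ b * (1 - x) ^+ (m.+2 - b)).
have B20 b : 0 <= B2 b by rewrite mulr_ge0// mulr_ge0 ?exprn_ge0 ?subr_ge0// ltW.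
have sumB2 : \sum_(b < m.+3) B2 b = 1.
  rewrite -[RHS](expr1n R m.+2) -[X in _ = X ^+ _](subrK x 1) exprDn; apply: eq_bigr => b _.
  by rewrite /B2 -[in RHS]mulr_natl [x ^+ b * _]mulrC.
apply: (@le_trans _ _ (2 * \sum_(a < m.+1) B2 a.+2)).
  rewrite !mulr_sumr; apply: ler_sum => a _.
  have e1 : m.+2%:R * 'C(m.+1, a.+1)%:R = a.+2%:R * 'C(m.+2, a.+2)%:R :> R.
    by rewrite -!natrM -(mul_bin_diag m.+2).
  have e2 : m.+1%:R * 'C(m, a)%:R = a.+1%:R * 'C(m.+1, a.+1)%:R :> R.
    by rewrite -!natrM -(mul_bin_diag m.+1).
  rewrite /B2 !subSS (_ : x ^+ a.+2 = x ^+ 2 * x ^+ a); last by rewrite -exprD.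
  have P0 : 0 <= x ^+ 2 * (x ^+ a * (1 - x) ^+ (m - a)).
    by rewrite !mulr_ge0 ?exprn_ge0 ?subr_ge0// ltW.
  rewrite (_ : _ * _ * _ * _ = (m.+2%:R * (m.+1%:R * 'C(m, a)%:R)) * ((1 + a%:R) ^+ 2)^-1 *
    (x ^+ 2 * (x ^+ a * (1 - x) ^+ (m - a)))); last by rewrite /B; ring.
  rewrite (_ : 2 * _ = 2 * 'C(m.+2, a.+2)%:R * (x ^+ 2 * (x ^+ a * (1 - x) ^+ (m - a)))); last by ring.
  apply: ler_wpM2r => //; rewrite e2 mulrCA e1.
  have a0 : 0 <= a%:R :> R by [].
  rewrite ler_pdivrMr; last by rewrite exprn_gt0//; lra.
  have := ler0n R 'C(m.+2, a.+2); move: ('C(m.+2, a.+2)%:R) => c c0.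
  rewrite -[a.+2%:R]natr1 -[a.+1%:R]natr1; move: (a%:R) a0 => t t0.
  have : 0 <= c * t by exact: mulr_ge0.
  have : 0 <= c * t ^+ 2 by rewrite mulr_ge0 ?sqr_ge0.
  nra.
rewrite -[leRHS]mulr1 ler_wpM2l// -sumB2 [leRHS]big_ord_recl [X in _ <= _ + X]big_ord_recl /=.
by rewrite !addrA lerDr addr_ge0.
Qed.

Lemma count_eq0 j : E (fun y => (count_mem j y == 0)%:R) = (1 - q j) ^+ m.
Proof. by rewrite iid_count bin0 subn0 expr0 !mul1r obs_ind. Qed.

Lemma count_eq02 i j : i != j ->
  E (fun y => (count_mem i y == 0)%:R * (count_mem j y == 0)%:R) = (1 - q i - q j) ^+ m.
Proof.
move=> ij; have ijN z : ~~ ((pred1 i z) && (pred1 j z)).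
  by apply/negP => /andP[/eqP -> /eqP /esym/eqP]; rewrite eq_sym (negPf ij).
have := iid_counts (obs hq) ijN m 0 0; rewrite bin0 subn0 !expr0 !mul1r !obs_ind => <-.
by apply: eq_mean => y; rewrite -natrM mulnb.
Qed.

End CountMoments.

Section Weight.
Variable R : realType.

Definition wt (N : nat) : R := (cbrt (1 + N%:R) ^+ 2)^-1.

Let cb_ge1 N : 1 <= cbrt (1 + N%:R) :> R.
Proof.
have N0 : 0 <= N%:R :> R by [].
by apply: ge_cbrt; rewrite ?expr1n; lra.
Qed.

Let cbK N : cbrt (1 + N%:R) ^+ 3 = 1 + N%:R :> R.
Proof. by rewrite cbrtK// addr_ge0. Qed.

Lemma wt_gt0 N : 0 < wt N.
Proof. by rewrite invr_gt0 exprn_gt0// (lt_le_trans ltr01). Qed.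

Lemma wt_le1 N : wt N <= 1.
Proof. by rewrite invf_le1 ?exprn_ege1// exprn_gt0// (lt_le_trans ltr01). Qed.

Lemma wtV_le N : (wt N)^-1 <= 1 + N%:R.
Proof.
rewrite invrK -[leRHS]cbK [leRHS]exprS ler_peMl// exprn_ge0//.
exact: cbrt_ge0.
Qed.

(** With t the ratio of the cube roots of [l] and of 1 + N, this is
    t^4 <= 1 + t^6: the fractional inverse moment of the count is bounded by its
    inverse second moment. *)
Lemma wt_sqr_le N (l : R) : 0 <= l ->
  wt N ^+ 2 * l ^+ 2 <= cbrt l ^+ 2 * (1 + l ^+ 2 * ((1 + N%:R) ^+ 2)^-1).
Proof.
move=> l0; have := cb_ge1 N; have := cbK N; rewrite /wt.
have := cbrtK l0; have := cbrt_ge0 l.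
move: (cbrt l) (cbrt (1 + _)) => c x c0 cl xN x1.
have x0 : x != 0 by rewrite gt_eqF//; lra.
rewrite -cl -xN (_ : _ ^-1 ^+ 2 * _ = c ^+ 2 * (c / x) ^+ 4); last by field.
rewrite (_ : (c ^+ 3) ^+ 2 * _ = (c / x) ^+ 6); last by field.
rewrite ler_wpM2l ?sqr_ge0//.
have : 0 <= c / x by rewrite divr_ge0//; lra.
move: (c / x) => t t0.
have s0 := sqr_ge0 t.
have -> : t ^+ 4 = (t ^+ 2) ^+ 2 by rewrite -exprM.
have -> : t ^+ 6 = (t ^+ 2) ^+ 3 by rewrite -exprM.
move: (t ^+ 2) s0 => s s0.
have : 0 <= (s - 1) ^+ 2 * (s + 1) by rewrite mulr_ge0 ?sqr_ge0//; lra.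
lra.
Qed.

(** The same with t^2 <= 1 + t^3, for t the inverse ratio. *)
Lemma wtV_le_root N (l : R) : 0 < l ->
  (wt N)^-1 <= cbrt l ^+ 2 * (1 + (1 + N%:R) / l).
Proof.
move=> l0; have := cb_ge1 N; have := cbK N; rewrite /wt invrK.
have := cbrtK (ltW l0); have := cbrt_gt0 l0.
move: (cbrt l) (cbrt (1 + _)) => c x c0 cl xN x1.
have c0' : c != 0 by rewrite gt_eqF.
rewrite -cl -xN (_ : x ^+ 2 = c ^+ 2 * (x / c) ^+ 2); last by field.
rewrite (_ : x ^+ 3 / _ = (x / c) ^+ 3); last by field.
rewrite ler_wpM2l ?sqr_ge0//.
have : 0 <= x / c by rewrite divr_ge0//; lra.
move: (x / c) => t t0.
have : 0 <= (t - 1) ^+ 2 * (t + 1) by rewrite mulr_ge0 ?sqr_ge0//; lra.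
lra.
Qed.

End Weight.

(** * The weighted U-statistic with fixed weights *)

Section SumFacts.
Variables (R : realType) (I : finType).

Lemma sum_sqr_le (x : I -> R) : (forall i, 0 <= x i) ->
  \sum_i x i ^+ 2 <= (\sum_i x i) ^+ 2.
Proof.
move=> x0; rewrite expr2 mulr_suml; apply: ler_sum => i _.
rewrite expr2 ler_wpM2l// (bigD1 i)//= lerDl; apply: sumr_ge0 => j _; exact: x0.
Qed.

Lemma ler_sum_cond (P : pred I) (x : I -> R) : (forall i, 0 <= x i) ->
  \sum_(i | P i) x i <= \sum_i x i.
Proof. by move=> x0; rewrite [leRHS](bigID P) /= lerDl sumr_ge0. Qed.

End SumFacts.

Section WeightedTest.
Variables (R : realType) (d k m n : nat) (p q : 'I_d -> R).
Hypotheses (hp : simplex R d p) (hq : simplex R d q).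
Let K : R := k%:R.
Hypotheses (mk : K <= 2 * m.+1%:R) (mk' : 2 * m%:R <= K) (nk : n%:R <= K)
  (kn : K <= 2 * n%:R) (kn1 : K <= 4 * (n%:R - 1)) (K1 : 1 <= K).

Let lam j : R := K * q j.
Let mu j : R := K * p j.
Let del j : R := K * (p j - q j).

Let K0 : 0 < K. Proof. exact: lt_le_trans ltr01 K1. Qed.
Let lam0 j : 0 <= lam j. Proof. by rewrite mulr_ge0 ?hq.1// ltW. Qed.
Let mu0 j : 0 <= mu j. Proof. by rewrite mulr_ge0 ?hp.1// ltW. Qed.

Lemma weighted_noise_mean :
  iid (obs hq) m (fun y => \sum_j wt R (count_mem j y) ^+ 2 * lam j ^+ 2) <=
  9 * \sum_j small_or_root (lam j).
Proof.
rewrite mean_sum mulr_sumr; apply: ler_sum => j _.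
rewrite /small_or_root minr_pMr// le_min; apply/andP; split; last first.
  rewrite -[leRHS](mean_cst (iid (obs hq) m)); apply: le_mean => y.
  have h : wt R (count_mem j y) ^+ 2 <= 1.
    by rewrite exprn_ile1 ?wt_le1// ltW// wt_gt0.
  have := sqr_ge0 (lam j); nra.
have := hq.1 j; rewrite le_eqVlt => /orP[/eqP qj|qj].
  rewrite (eq_mean _ (g := fun=> 0)) => [|y]; last first.
    by rewrite /lam -qj mulr0 expr0n mulr0.
  by rewrite mean_cst; apply: mulr_ge0 => //; exact: sqr_ge0.
apply: (@le_trans _ _ (cbrt (lam j) ^+ 2 * (1 + lam j ^+ 2 *
    iid (obs hq) m (fun y => ((1 + (count_mem j y)%:R) ^+ 2)^-1)))).
  apply: (@le_trans _ _ (iid (obs hq) m (fun y => cbrt (lam j) ^+ 2 *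
      (1 + lam j ^+ 2 * ((1 + (count_mem j y)%:R) ^+ 2)^-1)))).
    by apply: le_mean => y; exact: wt_sqr_le.
  by rewrite meanZ meanD mean_cst meanZ.
rewrite mulrC ler_wpM2r ?sqr_ge0//.
have := count_inv_sqr m hq qj; set e := iid _ _ _ => he.
have e0 : 0 <= e.
  by apply: mean_ge0 => y; rewrite invr_ge0 sqr_ge0.
suff : lam j ^+ 2 * e <= 4 * (m.+1%:R * m.+2%:R * q j ^+ 2 * e) by lra.
rewrite mulrA ler_wpM2r// /lam exprMn [leRHS]mulrA ler_wpM2r ?sqr_ge0//.
have : (m.+1%:R : R) <= m.+2%:R by rewrite ler_nat.
move=> ab; have a0 : 0 <= m.+1%:R :> R by [].
apply: (@le_trans _ _ ((2 * m.+1%:R) ^+ 2)).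
  by rewrite lerXn2r ?nnegrE ?mulr_ge0// ltW.
by have := ler_wpM2l a0 ab; lra.
Qed.

Definition pair_ustat (w : 'I_d -> R) (t : seq 'I_d * seq 'I_d) : R :=
  ustat w (@contrast R d) (zip t.1 t.2).

Let E2 := pairm (iid (obs hp) n) (iid (obs hq) n).

Lemma pair_ustat_var w : (forall j, 0 <= w j) ->
  E2 (fun t => (pair_ustat w t - n%:R * (n%:R - 1) * \sum_j w j * (p j - q j) ^+ 2) ^+ 2) <=
  16 * (\sum_j w j ^+ 2 * del j ^+ 2 * (mu j + lam j) +
        \sum_j w j ^+ 2 * (mu j + lam j) ^+ 2).
Proof.
move=> w0; apply: le_trans (two_sample_ustat_var hp hq w n) _.
have pq0 j : 0 <= p j + q j by rewrite addr_ge0 ?hp.1 ?hq.1.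
rewrite ler_wpM2l//; apply: lerD.
  rewrite (_ : \sum_j w j ^+ 2 * del j ^+ 2 * (mu j + lam j) =
    K ^+ 3 * \sum_j w j ^+ 2 * (p j - q j) ^+ 2 * (p j + q j)); last first.
    by rewrite mulr_sumr; apply: eq_bigr => j _; rewrite /del /mu /lam; ring.
  rewrite ler_wpM2r//; last by rewrite lerXn2r ?nnegrE// ltW.
  by apply: sumr_ge0 => j _; rewrite mulr_ge0// mulr_ge0// sqr_ge0.
rewrite (_ : \sum_j w j ^+ 2 * (mu j + lam j) ^+ 2 =
    K ^+ 2 * \sum_j w j ^+ 2 * (p j + q j) ^+ 2); last first.
  by rewrite mulr_sumr; apply: eq_bigr => j _; rewrite /mu /lam; ring.
rewrite ler_wpM2r//; last by rewrite lerXn2r ?nnegrE// ltW.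
by apply: sumr_ge0 => j _; rewrite mulr_ge0// sqr_ge0.
Qed.

(** Since s <= 2 lambda + delta, every part of the variance is bounded by the
    mean M and the null variance V: it is of order V + M + M sqrt(V) + M^(3/2),
    hence at most M^2 / b when M dominates sqrt(V) and 1 by a factor b^2. *)
Lemma pair_ustat_power (w : 'I_d -> R) (b t M V : R) : (forall j, 0 <= w j <= 1) -> 1 <= b ->
  M = \sum_j w j * del j ^+ 2 -> V = \sum_j w j ^+ 2 * lam j ^+ 2 ->
  b ^+ 4 * V <= M ^+ 2 -> b ^+ 2 <= M -> 16 * t <= M ->
  E2 (fun s => (pair_ustat w s < t)%R%:R) <= 208 * 256 / b.
Proof.
move=> w01 b1 ME VE hV hM ht.
have w0 j : 0 <= w j by case/andP: (w01 j).
have w1 j : w j <= 1 by case/andP: (w01 j).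
have b0 : 0 < b by lra.
have b2 : 1 <= b ^+ 2 by rewrite expr_ge1// ltW.
have M0 : 0 < M by apply: lt_le_trans hM; rewrite exprn_gt0.
have V0 : 0 <= V by rewrite VE; apply: sumr_ge0 => j _; rewrite mulr_ge0 ?sqr_ge0.
have bn0 : b != 0 by rewrite gt_eqF.
set th := n%:R * (n%:R - 1) * \sum_j w j * (p j - q j) ^+ 2.
have thM : M / 8 <= th.
  rewrite /th (_ : M = K ^+ 2 * \sum_j w j * (p j - q j) ^+ 2); last first.
    by rewrite ME mulr_sumr; apply: eq_bigr => j _; rewrite /del; ring.
  rewrite mulrAC ler_wpM2r ?sumr_ge0// => [j _|]; first by rewrite mulr_ge0 ?sqr_ge0.
  by move: kn kn1 K0; nra.
apply: (@le_trans _ _ (E2 (fun s => (pair_ustat w s <= th - M / 16)%R%:R))).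
  apply: le_mean => s; rewrite ler_nat; case: ltP => //= h.
  by rewrite (_ : pair_ustat w s <= _)//; apply: (le_trans (ltW h)); lra.
apply: (@le_trans _ _ ((208 * (M ^+ 2 / b)) / (M / 16) ^+ 2)); last first.
  by apply/eq_ler; field; rewrite bn0 gt_eqF.
apply: chebyshev_le; first by rewrite divr_gt0.
apply: le_trans (pair_ustat_var w0) _.
have s_le j : mu j + lam j <= 2 * lam j + `|del j|.
  by have := ler_norm (del j); rewrite /del /mu /lam; lra.
have s0 j : 0 <= mu j + lam j by rewrite addr_ge0.
pose X := \sum_j w j ^+ 2 * del j ^+ 2 * lam j.
pose Y := \sum_j w j ^+ 2 * `|del j| ^+ 3.
have Xle : X <= M ^+ 2 / b ^+ 2.
  have cs := cauchy_schwarz predT (fun j => w j * del j ^+ 2) (fun j => w j * lam j).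
  have X0 : 0 <= X by apply: sumr_ge0 => j _; rewrite mulr_ge0// mulr_ge0 ?sqr_ge0.
  have X2 : X ^+ 2 <= M ^+ 2 * V.
    rewrite /X (eq_bigr (fun j => (w j * del j ^+ 2) * (w j * lam j))); last first.
      by move=> j _; ring.
    apply: le_trans cs _; apply: ler_pM.
    - by apply: sumr_ge0 => j _; exact: sqr_ge0.
    - by apply: sumr_ge0 => j _; exact: sqr_ge0.
    - by rewrite ME; apply: sum_sqr_le => j; rewrite mulr_ge0 ?sqr_ge0.
    by rewrite VE; apply/eq_ler/eq_bigr => j _; rewrite exprMn.
  rewrite -(@ler_pXn2r _ 2)// ?nnegrE ?divr_ge0 ?sqr_ge0//.
  apply: (le_trans X2); rewrite [leRHS](_ : _ = M ^+ 2 * (M ^+ 2 / b ^+ 4)); last by field.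
  by rewrite ler_wpM2l ?sqr_ge0// ler_pdivlMr ?exprn_gt0// mulrC.
have Yle : Y <= M ^+ 2 / b.
  rewrite (_ : M ^+ 2 / b = \sum_j w j * del j ^+ 2 * (M / b)); last first.
    by rewrite -mulr_suml -ME; ring.
  apply: ler_sum => j _.
  have -> : w j ^+ 2 * `|del j| ^+ 3 = w j * del j ^+ 2 * (w j * `|del j|).
    by rewrite -(real_normK (num_real (del j))); ring.
  apply: ler_wpM2l; first by rewrite mulr_ge0 ?sqr_ge0.
  rewrite -(@ler_pXn2r _ 2)// ?nnegrE ?mulr_ge0 ?divr_ge0 ?invr_ge0 ?(ltW M0) ?(ltW b0)//.
  have wd : (w j * `|del j|) ^+ 2 <= M.
    rewrite exprMn real_normK ?num_real//; apply: (@le_trans _ _ (w j * del j ^+ 2)).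
      by rewrite ler_wpM2r ?sqr_ge0// expr2 ler_piMr.
    rewrite ME (bigD1 j)//= lerDl; apply: sumr_ge0 => i _.
    by rewrite mulr_ge0 ?sqr_ge0.
  apply: (le_trans wd); rewrite expr_div_n ler_pdivlMr ?exprn_gt0//.
  by rewrite expr2 ler_wpM2l// ltW.
have part1 : \sum_j w j ^+ 2 * del j ^+ 2 * (mu j + lam j) <= 2 * X + Y.
  rewrite /X /Y mulr_sumr -big_split; apply: ler_sum => j _ /=.
  rewrite [leRHS](_ : _ = w j ^+ 2 * del j ^+ 2 * (2 * lam j + `|del j|)).
    by rewrite ler_wpM2l// mulr_ge0 ?sqr_ge0.
  by rewrite -(real_normK (num_real (del j))); ring.
have part2 : \sum_j w j ^+ 2 * (mu j + lam j) ^+ 2 <= 8 * V + 2 * M.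
  rewrite VE ME !mulr_sumr -big_split; apply: ler_sum => j _ /=.
  apply: (@le_trans _ _ (w j ^+ 2 * (8 * lam j ^+ 2 + 2 * del j ^+ 2))).
    rewrite ler_wpM2l ?sqr_ge0//.
    rewrite (_ : mu j = lam j + del j); last by rewrite /mu /lam /del; ring.
    by have := sqr_ge0 (2 * lam j - del j); lra.
  have : w j ^+ 2 * del j ^+ 2 <= w j * del j ^+ 2.
    by rewrite ler_wpM2r ?sqr_ge0// expr2 ler_piMr.
  lra.
have ib (x : R) i : 0 <= x -> x / b ^+ i.+1 <= x / b.
  move=> x0; rewrite ler_wpM2l// lef_pV2 ?posrE ?exprn_gt0//.
  by rewrite exprS ler_peMr ?exprn_ege1 ?(ltW b0).
have M20 : 0 <= M ^+ 2 by exact: sqr_ge0.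
have h1 := ib _ 1%N M20; have h3 := ib _ 3%N M20.
have Vle : V <= M ^+ 2 / b ^+ 4 by rewrite ler_pdivlMr ?exprn_gt0// mulrC.
have Mle : M <= M ^+ 2 / b ^+ 2.
  by rewrite ler_pdivlMr ?exprn_gt0// expr2 ler_wpM2l// ltW.
lra.
Qed.

End WeightedTest.

(** * The weighted U-statistic with weights from an independent sample *)

(** How far, in units of the square root of the null variance, the conditional
    mean must lie for the test with threshold constant [K1] to have power
    1 - eta. *)
Definition power_const (R : realType) (Cf eta K1 : R) : R :=
  let b := 208 * 256 / eta in
  16 * K1 + b ^+ 2 * Num.sqrt (9 * Cf / eta) + b ^+ 2.

Section RandomWeightTest.
Variables (R : realType) (d k m n : nat) (p q : 'I_d -> R).
Hypotheses (hp : simplex R d p) (hq : simplex R d q).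
Let K : R := k%:R.
Hypotheses (mk : K <= 2 * m.+1%:R) (mk' : 2 * m%:R <= K) (nk : n%:R <= K)
  (kn : K <= 2 * n%:R) (kn1 : K <= 4 * (n%:R - 1)) (K1 : 1 <= K).

Let lam j : R := K * q j.
Let mu j : R := K * p j.
Let del j : R := K * (p j - q j).

Let K0 : 0 < K. Proof. exact: lt_le_trans ltr01 K1. Qed.
Let lam0 j : 0 <= lam j. Proof. by rewrite mulr_ge0 ?hq.1// ltW. Qed.
Let mu0 j : 0 <= mu j. Proof. by rewrite mulr_ge0 ?hp.1// ltW. Qed.

Definition count_weight (y : seq 'I_d) (j : 'I_d) : R := wt R (count_mem j y).

Let E3 := pairm (iid (obs hq) m) (pairm (iid (obs hp) n) (iid (obs hq) n)).
Let E0 := pairm (iid (obs hq) m) (pairm (iid (obs hq) n) (iid (obs hq) n)).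

Definition weighted_stat (s : seq 'I_d * (seq 'I_d * seq 'I_d)) : R :=
  pair_ustat (count_weight s.1) s.2.

Let cw0 y j : 0 <= count_weight y j. Proof. exact/ltW/wt_gt0. Qed.
Let cw01 y j : 0 <= count_weight y j <= 1. Proof. by rewrite cw0 wt_le1. Qed.

Lemma weighted_stat_null t : 0 < t ->
  E0 (fun s => (t <= weighted_stat s)%R%:R) <= 576 * (\sum_j small_or_root (lam j)) / t ^+ 2.
Proof.
move=> t0; apply: le_trans (_ : E0 (fun s => (0 + t <= weighted_stat s)%R%:R) <= _).
  by apply: le_mean => s; rewrite add0r.
apply: chebyshev_ge => //; rewrite /E0 pairmE.
apply: (@le_trans _ _ (iid (obs hq) m (fun y =>
    64 * \sum_j wt R (count_mem j y) ^+ 2 * lam j ^+ 2))).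
  apply: le_mean => y; have := pair_ustat_var hq hq nk (cw0 y); cbv beta.
  rewrite [X in _ * _ * X]big1 => [|j _]; last by rewrite subrr expr0n mulr0.
  rewrite mulr0 [X in _ <= _ * (X + _)]big1 => [|j _]; last first.
    by rewrite subrr mulr0 expr0n mulr0 mul0r.
  move/le_trans; apply; rewrite add0r !mulr_sumr; apply: ler_sum => j _.
  by rewrite /count_weight -/K -/(lam j); apply: eq_ler; ring.
rewrite meanZ; have := weighted_noise_mean hq mk; cbv beta; rewrite -/K; lra.
Qed.

Variables (Cf eta K2 G kappa : R).
Hypotheses (Cf0 : 0 < Cf) (eta0 : 0 < eta) (eta1 : eta <= 1) (K20 : 0 <= K2) (G1 : 1 <= G).
Hypotheses (hG : \sum_j small_or_root (lam j) <= Cf * G).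
Hypotheses (kappa1 : 1 <= kappa) (Gk : G ^+ 3 <= 16 ^+ 3 * kappa ^+ 4).

Let KM := power_const Cf eta K2.
Let Mw y := \sum_j count_weight y j * del j ^+ 2.

Let G0 : 0 < G. Proof. exact: lt_le_trans ltr01 G1. Qed.
Let sG1 : 1 <= Num.sqrt G. Proof. by rewrite -sqrtr1 ler_wsqrtr. Qed.
Let KM0 : 0 <= KM.
Proof.
rewrite /KM /power_const; set b := _ / eta.
have h1 := sqr_ge0 b; have h2 := sqrtr_ge0 (9 * Cf / eta).
by apply: addr_ge0 => //; apply: addr_ge0; exact: mulr_ge0.
Qed.

(** Conditionally on the first half the weights are fixed; the two exceptional
    events are a null variance far above its mean, and [bad]. *)
Lemma weighted_stat_power (bad : seq 'I_d -> bool) :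
  iid (obs hq) m (fun y => (bad y)%:R) <= eta ->
  (forall y, ~~ bad y -> KM * Num.sqrt G <= Mw y) ->
  E3 (fun s => (weighted_stat s < K2 * Num.sqrt G)%R%:R) <= 3 * eta.
Proof.
have [e0 e1 k20 g1] := And4 eta0 eta1 K20 G1; have cf0 := Cf0.
move=> hbad hgood; rewrite /E3 pairmE.
pose V y := \sum_j count_weight y j ^+ 2 * lam j ^+ 2.
pose V1 := 9 * Cf * G / eta.
have V10 : 0 < V1 by rewrite divr_gt0// !mulr_gt0.
have V0 y : 0 <= V y by apply: sumr_ge0 => j _; rewrite mulr_ge0 ?sqr_ge0.
have hV : iid (obs hq) m (fun y => (V1 <= V y)%R%:R) <= eta.
  apply: le_trans (markov _ V10 V0) _.
  rewrite ler_pdivrMr// /V1 mulrC mulfVK ?gt_eqF//.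
  apply: le_trans (weighted_noise_mean hq mk) _.
  by rewrite -mulrA ler_wpM2l.
apply: (@le_trans _ _ (iid (obs hq) m (fun y => (bad y)%:R + (V1 <= V y)%R%:R + eta))).
  apply: le_mean => y.
  set P := pairm _ _ _.
  have P1 : P <= 1.
    rewrite -[leRHS](mean1 (pairm (iid (obs hp) n) (iid (obs hq) n))).
    by apply: le_mean => s; case: (_ < _).
  have := hgood y.
  case: (bad y) => [_|/(_ isT) hM].
    by apply: (le_trans P1); rewrite -addrA lerDl addr_ge0// ltW.
  case: (leP V1 (V y)) => hVy.
    by apply: (le_trans P1); rewrite add0r lerDl ltW.
  rewrite (_ : false%:R = 0 :> R)// !add0r.
  have [b [b1 bE KME]] : exists b, [/\ 1 <= b, eta = 208 * 256 / b &
      KM = 16 * K2 + b ^+ 2 * Num.sqrt (9 * Cf / eta) + b ^+ 2].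
    exists (208 * 256 / eta); split => //; last by field; rewrite gt_eqF.
    by rewrite ler_pdivlMr// mul1r; apply: le_trans eta1 _; lra.
  rewrite [leRHS]bE.
  have sc0 := sqrtr_ge0 (9 * Cf / eta).
  have b20 := sqr_ge0 b.
  have sG0 : 0 <= Num.sqrt G by exact: sqrtr_ge0.
  have bs0 : 0 <= b ^+ 2 * Num.sqrt (9 * Cf / eta) by exact: mulr_ge0.
  apply: (@pair_ustat_power _ _ k n p q hp hq nk kn kn1 K1 (count_weight y) b _ (Mw y) (V y)) => //.
  - have h : b ^+ 2 * Num.sqrt (9 * Cf / eta) * Num.sqrt G <= Mw y.
      by apply: le_trans hM; rewrite ler_wpM2r//; lra.
    have h2 : (b ^+ 2 * Num.sqrt (9 * Cf / eta) * Num.sqrt G) ^+ 2 <= Mw y ^+ 2.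
      have h0 : 0 <= b ^+ 2 * Num.sqrt (9 * Cf / eta) * Num.sqrt G by exact: mulr_ge0.
      by rewrite lerXn2r ?nnegrE//; exact: le_trans h.
    apply: le_trans h2.
    rewrite (_ : _ ^+ 2 = b ^+ 4 * (Num.sqrt (9 * Cf / eta) ^+ 2 * Num.sqrt G ^+ 2)); last by ring.
    rewrite !sqr_sqrtr ?(ltW G0)//; last by rewrite divr_ge0 ?mulr_ge0 ?ltW.
    rewrite ler_wpM2l ?exprn_ge0//; first by lra.
    by apply/ltW/(lt_le_trans hVy)/eq_ler; rewrite /V1; field; rewrite gt_eqF.
  - apply: le_trans hM; rewrite -[leLHS]mulr1 ler_pM//; lra.
  - by apply: le_trans hM; rewrite mulrA ler_wpM2r//; lra.
by rewrite !meanD mean_cst; lra.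
Qed.

(** The sum of the inverse weights over these coordinates is of the order of
    the profile, and kappa is at least its power 3/4; Cauchy-Schwarz does the
    rest. *)
Lemma weighted_stat_power_large c : 0 <= c -> 3 * Cf / eta * KM * 64 <= c ^+ 2 ->
  c * kappa <= \sum_(j | 1 <= lam j) `|del j| ->
  E3 (fun s => (weighted_stat s < K2 * Num.sqrt G)%R%:R) <= 3 * eta.
Proof.
have [e0 e1 k20 g1 ka1] := And5 eta0 eta1 K20 G1 kappa1; have k1 := K1; have m2 := mk'; have cf0 := Cf0; have km0 := KM0.
move=> c0 hc hdel.
pose D y := \sum_(j | 1 <= lam j) (count_weight y j)^-1.
pose B := 3 * Cf * G / eta.
have B0 : 0 < B by rewrite divr_gt0// !mulr_gt0.
have D0 y : 0 <= D y by apply: sumr_ge0 => j _; rewrite invr_ge0.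
apply: (weighted_stat_power (bad := fun y => B <= D y)).
  apply: le_trans (markov _ B0 D0) _.
  rewrite ler_pdivrMr// /B mulrC mulfVK ?gt_eqF// mean_sum.
  apply: (@le_trans _ _ (\sum_(j | 1 <= lam j) 3 * small_or_root (lam j))).
    apply: ler_sum => j lj; rewrite small_or_rootE//.
    have l0 : 0 < lam j by lra.
    apply: (@le_trans _ _ (iid (obs hq) m (fun y =>
      cbrt (lam j) ^+ 2 * (1 + (lam j)^-1 * (1 + (count_mem j y)%:R))))).
      by apply: le_mean => y; rewrite [_^-1 * _]mulrC; exact: wtV_le_root.
    rewrite meanZ meanD mean_cst meanZ meanD mean_cst count_mean mulrC.
    rewrite ler_wpM2r ?sqr_ge0//.
    have : (lam j)^-1 * (1 + m%:R * q j) <= 2.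
      rewrite mulrC ler_pdivrMr//.
      have : m%:R * q j <= lam j.
        by rewrite /lam ler_wpM2r ?hq.1//; have : 0 <= m%:R :> R by []; lra.
      lra.
    lra.
  rewrite -mulr_sumr -mulrA ler_wpM2l//; apply: le_trans hG.
  exact: (ler_sum_cond _ (fun j => small_or_root_ge0 (lam j))).
move=> y; rewrite -ltNge => Dy.
have M0 : 0 <= Mw y by apply: sumr_ge0 => j _; rewrite mulr_ge0 ?sqr_ge0.
have : (c * kappa) ^+ 2 <= B * Mw y.
  apply: (@le_trans _ _ ((\sum_(j | 1 <= lam j) `|del j|) ^+ 2)).
    rewrite lerXn2r ?nnegrE ?sumr_ge0//.
    by rewrite mulr_ge0//; lra.
  apply: (@le_trans _ _ (D y * Mw y)); last by rewrite ler_wpM2r// ltW.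
  rewrite (eq_bigr (fun j => (count_weight y j)^-1 * (count_weight y j * `|del j|))); last first.
    by move=> j _; rewrite mulKf// gt_eqF// wt_gt0.
  apply: le_trans (weighted_cauchy_schwarz _ _) _.
    by move=> j _; rewrite invr_ge0.
  apply: ler_wpM2l; first exact: D0.
  rewrite (eq_bigr (fun j => count_weight y j * del j ^+ 2)).
    by rewrite /Mw; apply: ler_sum_cond => j; rewrite mulr_ge0 ?sqr_ge0.
  move=> j _; rewrite exprMn real_normK ?num_real//.
  by field; rewrite gt_eqF// wt_gt0.
move=> h; rewrite -(ler_pM2l B0); apply: le_trans h.
have GG : G * Num.sqrt G <= 64 * kappa ^+ 2.
  have G0' := ltW G0; have k20' : 0 <= 64 * kappa ^+ 2 by rewrite mulr_ge0 ?sqr_ge0.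
  rewrite -(@ler_pXn2r _ 2)// ?nnegrE ?(mulr_ge0 G0') ?sqrtr_ge0//.
  rewrite [(G * _) ^+ 2]exprMn sqr_sqrtr// (_ : G ^+ 2 * G = G ^+ 3); last by ring.
  by apply: (le_trans Gk); apply: eq_ler; ring.
rewrite (_ : B * _ = (3 * Cf / eta * KM) * (G * Num.sqrt G)); last by rewrite /B; ring.
apply: (@le_trans _ _ ((3 * Cf / eta * KM) * (64 * kappa ^+ 2))).
  by rewrite ler_wpM2l// mulr_ge0// divr_ge0 ?mulr_ge0 ?ltW.
by rewrite mulrA exprMn ler_wpM2r ?sqr_ge0.
Qed.

(** Here the counts have mean at most 1, so that the weights cost a constant on
    average; since delta_j >= 1 the sum of squares is at least of order kappa,
    far above the threshold, which is of order kappa^(2/3). *)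
Lemma weighted_stat_power_spike c : 0 < c -> 8 * KM / eta <= c ->
  c * kappa <= \sum_(j | (lam j < 1) && (2 < mu j)) `|del j| ->
  E3 (fun s => (weighted_stat s < K2 * Num.sqrt G)%R%:R) <= 3 * eta.
Proof.
have [e0 e1 k20 g1 ka1] := And5 eta0 eta1 K20 G1 kappa1; have k1 := K1; have m2 := mk'; have cf0 := Cf0; have km0 := KM0.
move=> c0 hc hdel.
pose P j := (lam j < 1) && (2 < mu j).
pose W := \sum_(j | P j) del j ^+ 2.
have Wge : c * kappa <= W.
  apply: (le_trans hdel); apply: ler_sum => j /andP[lj mj].
  have d1 : 1 <= del j by rewrite /del; move: lj mj; rewrite /lam /mu; lra.
  by rewrite ger0_norm; [rewrite expr2 ler_peMl//; lra|lra].
have W0 : 0 < W by apply: lt_le_trans Wge; rewrite mulr_gt0//; lra.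
pose D y := \sum_(j | P j) (count_weight y j)^-1 * del j ^+ 2.
have B0 : 0 < 2 * W / eta by rewrite divr_gt0// mulr_gt0.
have D0 y : 0 <= D y.
  by apply: sumr_ge0 => j _; rewrite mulr_ge0 ?sqr_ge0// invr_ge0.
apply: (weighted_stat_power (bad := fun y => 2 * W / eta <= D y)).
  apply: le_trans (markov _ B0 D0) _.
  rewrite ler_pdivrMr// mulrC mulfVK ?gt_eqF// mean_sum mulr_sumr.
  apply: ler_sum => j /andP[lj _]; rewrite meanZr ler_wpM2r ?sqr_ge0//.
  apply: (@le_trans _ _ (iid (obs hq) m (fun y => 1 + (count_mem j y)%:R))).
    by apply: le_mean => y; exact: wtV_le.
  rewrite meanD mean_cst count_mean.
  have : m%:R * q j <= lam j.
    by rewrite /lam ler_wpM2r ?hq.1//; have : 0 <= m%:R :> R by []; lra.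
  lra.
move=> y; rewrite -ltNge => Dy.
have M0 : 0 <= Mw y by apply: sumr_ge0 => j _; rewrite mulr_ge0 ?sqr_ge0.
have h : W ^+ 2 <= 2 * W / eta * Mw y.
  apply: (@le_trans _ _ (D y * Mw y)); last by rewrite ler_wpM2r// ltW.
  rewrite /W (eq_bigr (fun j => ((count_weight y j)^-1 * del j ^+ 2) * count_weight y j)); last first.
    by move=> j _; rewrite mulrAC mulVf ?mul1r// gt_eqF// wt_gt0.
  apply: le_trans (weighted_cauchy_schwarz _ _) _.
    by move=> j _; rewrite mulr_ge0 ?sqr_ge0// invr_ge0.
  apply: ler_wpM2l; first exact: D0.
  rewrite (eq_bigr (fun j => count_weight y j * del j ^+ 2)).
    by rewrite /Mw; apply: ler_sum_cond => j; rewrite mulr_ge0 ?sqr_ge0.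
  by move=> j _; field; rewrite gt_eqF// wt_gt0.
have h2 : eta * W <= 2 * Mw y.
  rewrite -(ler_pM2r W0) -mulrA -expr2.
  apply: (@le_trans _ _ (eta * (2 * W / eta * Mw y))); first by rewrite ler_wpM2l// ltW.
  by apply: eq_ler; field; rewrite gt_eqF.
have sG : Num.sqrt G <= 4 * kappa.
  have G16 : G <= 16 * kappa ^+ 2.
    have k16 : 0 <= 16 * kappa ^+ 2 by rewrite mulr_ge0 ?sqr_ge0.
    rewrite -(@ler_pXn2r _ 3)// ?nnegrE ?(ltW G0)//.
    apply: (le_trans Gk); rewrite exprMn ler_wpM2l ?exprn_ge0//.
    by rewrite -exprM; apply: ler_weXn2l.
  have k40 : 0 <= 4 * kappa by lra.
  rewrite -(@ler_pXn2r _ 2)// ?nnegrE ?sqrtr_ge0//.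
  by rewrite sqr_sqrtr ?(ltW G0)//; apply: le_trans (le_trans G16 _); [|apply: eq_ler; ring].
apply: (@le_trans _ _ (KM * (4 * kappa))); first by rewrite ler_wpM2l.
have h3 : 8 * KM <= eta * c by move: hc; rewrite ler_pdivrMr// [c * _]mulrC.
have h4 : 8 * KM * kappa <= eta * c * kappa by rewrite ler_wpM2r//; lra.
have h5 : eta * (c * kappa) <= eta * W by rewrite ler_wpM2l// ltW.
lra.
Qed.

End RandomWeightTest.

(** * The unseen coordinates *)

Lemma bernoulli_ineq (R : realType) (x : R) m : 0 <= x <= 1 -> 1 - m%:R * x <= (1 - x) ^+ m.
Proof.
move=> /andP[x0 x1]; elim: m => [|m IH]; first by rewrite mul0r subr0 expr0.
rewrite exprS -natr1; apply: (@le_trans _ _ ((1 - x) * (1 - m%:R * x))).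
  have : 0 <= m%:R * x ^+ 2 by rewrite mulr_ge0 ?sqr_ge0.
  lra.
by rewrite ler_wpM2l// subr_ge0.
Qed.

Section UnseenTest.
Variables (R : realType) (d k m n : nat) (p q : 'I_d -> R).
Hypotheses (hp : simplex R d p) (hq : simplex R d q).
Let K : R := k%:R.
Hypotheses (mk' : 2 * m%:R <= K) (nk : n%:R <= K) (kn : K <= 2 * n%:R) (K1 : 1 <= K).

Let lam j : R := K * q j.
Let mu j : R := K * p j.

Definition unseen (y : seq 'I_d) (j : 'I_d) : R := (count_mem j y == 0)%:R.

Definition unseen_stat (s : seq 'I_d * (seq 'I_d * seq 'I_d)) : R :=
  linear_stat (unseen s.1) s.2.1 s.2.2.

Let E3 := pairm (iid (obs hq) m) (pairm (iid (obs hp) n) (iid (obs hq) n)).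
Let E0 := pairm (iid (obs hq) m) (pairm (iid (obs hq) n) (iid (obs hq) n)).

Let un01 y j : 0 <= unseen y j <= 1.
Proof. by rewrite /unseen; case: (_ == _); rewrite /= ?lexx ?ler01. Qed.

Lemma unseen_stat_null t : 0 < t -> E0 (fun s => (t <= unseen_stat s)%R%:R) <= K / t ^+ 2.
Proof.
move=> t0; apply: le_trans (_ : E0 (fun s => (0 + t <= unseen_stat s)%R%:R) <= _).
  by apply: le_mean => s; rewrite add0r.
apply: chebyshev_ge => //; rewrite /E0 pairmE -[leRHS](mean_cst (iid (obs hq) m)).
apply: le_mean => y; apply: le_trans nk.
have := two_sample_linear_stat_var hq hq n (un01 y).
by rewrite big1 ?mulr0// => j _; rewrite subrr mulr0.
Qed.

(** Not seeing i and not seeing j are negatively correlated events, because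
    1 - q_i - q_j <= (1 - q_i) (1 - q_j). *)
Lemma unseen_mass_var (B : pred 'I_d) :
  iid (obs hq) m (fun y => (\sum_(j | B j) unseen y j * mu j -
    \sum_(j | B j) (1 - q j) ^+ m * mu j) ^+ 2) <= \sum_(j | B j) mu j ^+ 2.
Proof.
have K0 : 0 <= K by apply: le_trans K1.
have mu0 j : 0 <= mu j by rewrite mulr_ge0 ?hp.1.
have q1 j : 0 <= 1 - q j by rewrite subr_ge0 simplex_le1.
rewrite (eq_mean _ (g := fun y => \sum_(i | B i) \sum_(j | B j)
   mu i * mu j * ((unseen y i - (1 - q i) ^+ m) * (unseen y j - (1 - q j) ^+ m)))); last first.
  move=> y; rewrite -sumrB expr2 big_distrlr; apply: eq_bigr => i _ /=.
  by apply: eq_bigr => j _; ring.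
have mE j : iid (obs hq) m (fun y => unseen y j) = (1 - q j) ^+ m by exact: count_eq0.
have covE i j : iid (obs hq) m (fun y =>
    (unseen y i - (1 - q i) ^+ m) * (unseen y j - (1 - q j) ^+ m)) =
    iid (obs hq) m (fun y => unseen y i * unseen y j) - (1 - q i) ^+ m * (1 - q j) ^+ m.
  rewrite (eq_mean _ (g := fun y => (unseen y i * unseen y j - (1 - q i) ^+ m * unseen y j) -
     ((1 - q j) ^+ m * unseen y i - (1 - q i) ^+ m * (1 - q j) ^+ m))); last by move=> y; ring.
  by rewrite !meanB !meanZ mean_cst !mE; ring.
rewrite mean_sum; apply: ler_sum => i Bi.
rewrite mean_sum (eq_bigr (fun j => mu i * mu j * (iid (obs hq) m
    (fun y => unseen y i * unseen y j) - (1 - q i) ^+ m * (1 - q j) ^+ m))); last first.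
  by move=> j _; rewrite meanZ covE.
rewrite (bigD1 i)// -[leRHS]addr0; apply: lerD.
  rewrite -[mu i * mu i]expr2 -[leRHS]mulr1 ler_wpM2l ?sqr_ge0//.
  have : 0 <= (1 - q i) ^+ m * (1 - q i) ^+ m by rewrite mulr_ge0 ?exprn_ge0.
  have : iid (obs hq) m (fun y => unseen y i * unseen y i) <= 1.
    rewrite -[leRHS](mean1 (iid (obs hq) m)); apply: le_mean => y.
    by have := un01 y i; nra.
  lra.
apply: sumr_le0 => j /andP[_ ji].
apply: mulr_ge0_le0; first exact: mulr_ge0.
rewrite subr_le0 /unseen count_eq02 1?eq_sym// -exprMn.
have ij : i != j by rewrite eq_sym.
have qq := simplex_pair_le1 hq ij.
rewrite lerXn2r ?nnegrE ?mulr_ge0//; first by lra.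
have : 0 <= q i * q j by rewrite mulr_ge0 ?hq.1.
lra.
Qed.

(** As each coordinate of [B] is unseen with probability at least 1/2, a fixed
    fraction of the mass of p on [B] survives the screening.  What [Lam] bounds
    is all that can cancel it: the mass of q on [B], and the deficit of p
    elsewhere. *)
Lemma unseen_stat_power (B : pred 'I_d) (t Lam : R) : 0 < t ->
  (forall j, B j -> lam j <= 1 /\ mu j <= 2) ->
  \sum_(j | B j) lam j + \sum_(j | ~~ B j && (p j < q j)) `|K * (p j - q j)| <= Lam ->
  4 * (Lam + 4 * t) <= \sum_(j | B j) mu j ->
  E3 (fun s => (unseen_stat s < t)%R%:R) <= 32 / (\sum_(j | B j) mu j) + K / t ^+ 2.
Proof.
move=> t0 hB hLam hM; have k1 := K1.
have K0 : 0 < K by lra.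
have mu0 j : 0 <= mu j by rewrite mulr_ge0 ?hp.1// ltW.
have lam0 j : 0 <= lam j by rewrite mulr_ge0 ?hq.1// ltW.
have Lam0 : 0 <= Lam.
  by apply: le_trans hLam; rewrite addr_ge0 ?sumr_ge0.
set M := \sum_(j | B j) mu j in hM *.
have M0 : 0 < M by lra.
pose Z y := \sum_(j | B j) unseen y j * mu j.
pose EZ := \sum_(j | B j) (1 - q j) ^+ m * mu j.
have EZge : M / 2 <= EZ.
  rewrite /M mulr_suml; apply: ler_sum => j Bj.
  rewrite mulrC ler_wpM2r//.
  have q01 : 0 <= q j <= 1 by rewrite hq.1 simplex_le1.
  have := bernoulli_ineq m q01; have [l1 _] := hB j Bj.
  have : m%:R * q j <= lam j / 2.
    rewrite /lam mulrAC ler_wpM2r ?hq.1//; have := mk'; lra.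
  lra.
have varZ : iid (obs hq) m (fun y => (Z y - EZ) ^+ 2) <= 2 * M.
  apply: le_trans (unseen_mass_var _) _; rewrite mulr_sumr; apply: ler_sum => j Bj.
  by rewrite expr2 ler_wpM2r//; case: (hB j Bj).
have M4 : 0 < M / 4 by rewrite divr_gt0.
have PZ := chebyshev_le M4 varZ.
rewrite /E3 pairmE.
apply: (@le_trans _ _ (iid (obs hq) m (fun y => (Z y <= EZ - M / 4)%R%:R + K / t ^+ 2))).
  apply: le_mean => y; set P := pairm _ _ _.
  have P1 : P <= 1.
    rewrite -[leRHS](mean1 (pairm (iid (obs hp) n) (iid (obs hq) n))).
    by apply: le_mean => s; case: (_ < _).
  case: (leP (Z y) (EZ - M / 4)) => hZ.
    by apply: (le_trans P1); rewrite lerDl divr_ge0 ?sqr_ge0// ltW.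
  rewrite add0r.
  pose th := n%:R * \sum_j unseen y j * (p j - q j).
  have thE : K * th = n%:R * \sum_j unseen y j * (K * (p j - q j)).
    rewrite (_ : \sum_j unseen y j * (K * (p j - q j)) = K * \sum_j unseen y j * (p j - q j)).
      by rewrite /th; ring.
    by rewrite mulr_sumr; apply: eq_bigr => j _; ring.
  have ge : Z y - Lam <= \sum_j unseen y j * (K * (p j - q j)).
    apply: (@le_trans _ _ (Z y - (\sum_(j | B j) lam j +
        \sum_(j | ~~ B j && (p j < q j)) `|K * (p j - q j)|))).
      by rewrite lerB.
    rewrite [leRHS](bigID B) /= opprD addrA; apply: lerD.
      rewrite /Z -sumrB; apply: ler_sum => j Bj.
      have := un01 y j; have := lam0 j; rewrite /mu /lam; move: (unseen y j) => u.
      nra.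
    rewrite big_mkcondr /= -sumrN; apply: ler_sum => j _.
    have /andP[u0 u1] := un01 y j; case: ltP => pq.
      rewrite ltr0_norm ?opprK; last by rewrite pmulr_rlt0// subr_lt0.
      have : K * (p j - q j) <= 0 by rewrite pmulr_rle0// subr_le0 ltW.
      move: (K * _) (unseen y j) u0 u1 => x u; nra.
    by rewrite oppr0 mulr_ge0// mulr_ge0 ?subr_ge0// ltW.
  have th2 : 2 * t <= th.
    rewrite -(ler_pM2l K0) thE.
    apply: (@le_trans _ _ (n%:R * (4 * t))).
      by have : K * t <= 2 * n%:R * t; [rewrite ler_wpM2r ?kn// ltW|lra].
    by rewrite ler_wpM2l//; apply: le_trans ge; lra.
  apply: (@le_trans _ _ (pairm (iid (obs hp) n) (iid (obs hq) n)
     (fun s => (linear_stat (unseen y) s.1 s.2 <= th - t)%R%:R))).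
    apply: le_mean => s; rewrite ler_nat /unseen_stat /=; case: ltP => //= h.
    by rewrite (_ : _ <= th - t)//; apply: (le_trans (ltW h)); lra.
  apply: chebyshev_le => //; apply: le_trans nk.
  exact: (two_sample_linear_stat_var hp hq n (un01 y)).
rewrite meanD mean_cst lerD2r; apply: (le_trans PZ); apply: eq_ler.
by field; rewrite gt_eqF.
Qed.

End UnseenTest.

(** * The collision statistic: deviations *)

Section CollisionTest.
Variables (R : realType) (d k : nat) (p q : 'I_d -> R).
Hypotheses (hp : simplex R d p) (hq : simplex R d q) (k4 : (4 <= k)%N).
Let K : R := k%:R.

Let lam j : R := K * q j.
Let mu j : R := K * p j.
Let del j : R := K * (p j - q j).

Let K4 : 4 <= K. Proof. by rewrite ler_nat. Qed.
Let lam0 j : 0 <= lam j. Proof. by rewrite mulr_ge0 ?hq.1. Qed.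
Let mu0 j : 0 <= mu j. Proof. by rewrite mulr_ge0 ?hp.1. Qed.
Let p01 j : 0 <= p j <= 1. Proof. by rewrite hp.1 simplex_le1. Qed.
Let q01 j : 0 <= q j <= 1. Proof. by rewrite hq.1 simplex_le1. Qed.

Let E2 := pairm (iid (obs hp) k) (iid (obs hq) k).
Let E0 := pairm (iid (obs hq) k) (iid (obs hq) k).

Lemma collision_stat_null t : 0 < t ->
  E0 (fun s => (t <= collision_stat R k s)%R%:R) <=
  600 * expR 8 * (4 * expR 8 * \sum_j lam j ^+ 2 * expR (- (2 * lam j))) / t ^+ 2.
Proof.
move=> t0; apply: le_trans (_ : E0 (fun s => (0 + t <= collision_stat R k s)%R%:R) <= _).
  by apply: le_mean => s; rewrite add0r.
apply: chebyshev_ge => //.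
have := collision_stat_var hq hq k4; rewrite /collision_stat_mean big1 => [|j _]; last first.
  by rewrite subrr mulr0 expr0n mul0r.
have c0 : 0 <= 600 * expR 8 :> R by apply: mulr_ge0; [exact: ler0n|exact: expR_ge0].
move/le_trans; apply; apply: (ler_wpM2l c0); rewrite mulr_sumr.
apply: ler_sum => j _; have := screen_le_expR k4 (q01 j) (q01 j).
rewrite (_ : k%:R * (q j + q j) = 2 * lam j); last by rewrite /lam /K; ring.
move=> h; apply: (@le_trans _ _ ((2 * lam j) ^+ 2 * (expR 8 * expR (- (2 * lam j))))).
  by rewrite ler_wpM2l ?sqr_ge0.
by apply: eq_ler; ring.
Qed.

Let V0 := \sum_j lam j ^+ 2 * expR (- (2 * lam j)).
Let M2 := collision_stat_mean k p q.

Lemma ln_le_sixteenth : 32 ^+ 2 <= K -> ln K <= K / 16.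
Proof.
move=> hK; have k4' := K4; have K0 : 0 < K by lra.
have s0 : 0 < Num.sqrt K by rewrite sqrtr_gt0.
have sK : Num.sqrt K ^+ 2 = K by rewrite sqr_sqrtr// ltW.
have s32 : 32 <= Num.sqrt K.
  by rewrite -(@ler_pXn2r _ 2)// ?nnegrE ?sqrtr_ge0// sK.
have h : ln K = 2 * ln (Num.sqrt K) by rewrite -{1}sK lnXn// mulr_natl.
have h2 : ln (Num.sqrt K) <= Num.sqrt K - 1.
  by rewrite -ler_expR lnK ?posrE//; have := expR_ge1Dx (Num.sqrt K - 1); lra.
have : 32 * Num.sqrt K <= K by rewrite -[leRHS]sK expr2 ler_wpM2r// ltW.
rewrite h; lra.
Qed.

(** Three regimes for s = mu + lambda.  If s > 8 ln K the contribution is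
    negligible.  If delta <= 1 then exp (- s) is comparable to exp (- 2 lambda).
    Otherwise s^2 <= (8 ln K)^2 delta^2, and the contribution is at most of order
    ln(K)^2 times that of the coordinate to the mean. *)
Lemma collision_stat_noise_le : 32 ^+ 2 <= K ->
  \sum_j (K * (p j + q j)) ^+ 2 * ((1 - p j) * (1 - q j)) ^+ (k - 4) <=
  8 * expR 9 * V0 + 32 * 33 * ln K ^+ 2 * M2 + 4 * expR 8.
Proof.
move=> hK; have k4' := K4; have K0 : 0 < K by lra.
have lK := ln_le_sixteenth hK.
have lnK1 : 1 <= ln K by apply: ln_ge1; lra.
set L := 8 * ln K.
have L2 : L <= K / 2 by rewrite /L; lra.
have sg_sum : \sum_j K * (p j + q j) = 2 * K.
  by rewrite -mulr_sumr big_split /= hp.2 hq.2; ring.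
rewrite (_ : 4 * expR 8 = \sum_j 2 * expR 8 * (K * (p j + q j)) / K); last first.
  rewrite -mulr_suml -mulr_sumr sg_sum; field; by rewrite gt_eqF.
rewrite /V0 /M2 /collision_stat_mean !mulr_sumr -!big_split; apply: ler_sum => j _ /=.
rewrite -/K -/(del j).
have -> : K * (p j + q j) = mu j + lam j by rewrite /mu /lam; ring.
set s := mu j + lam j; set rho := (1 - p j) * (1 - q j).
have s0 : 0 <= s by rewrite addr_ge0.
have rho0 : 0 <= rho by rewrite mulr_ge0// subr_ge0 simplex_le1.
have A0 : 0 <= 8 * expR 9 * (lam j ^+ 2 * expR (- (2 * lam j))).
  apply: mulr_ge0; first by rewrite mulr_ge0 ?expR_ge0.
  by apply: mulr_ge0; [exact: sqr_ge0|exact: expR_ge0].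
have B0 : 0 <= 32 * 33 * ln K ^+ 2 * (del j ^+ 2 * rho ^+ (k - 2)).
  apply: mulr_ge0; first by apply: mulr_ge0; rewrite ?sqr_ge0.
  by apply: mulr_ge0; [exact: sqr_ge0|exact: exprn_ge0].
have C0 : 0 <= 2 * expR 8 * s / K.
  have := expR_ge0 (8 : R) => e8; apply: divr_ge0; last exact: ltW.
  by apply: mulr_ge0 => //; exact: mulr_ge0.
have ee := screen_le_expR k4 (p01 j) (q01 j).
rewrite -/rho (_ : k%:R * (p j + q j) = s) in ee; last by rewrite /s /mu /lam /K; ring.
case: (leP s L) => sL; last first.
  suff : s ^+ 2 * rho ^+ (k - 4) <= 2 * expR 8 * s / K by lra.
  apply: (@le_trans _ _ (s ^+ 2 * (expR 8 * expR (- s)))).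
    by rewrite ler_wpM2l ?sqr_ge0.
  have h1 : s / 2 * expR (- (s / 2)) <= 1 by exact: mul_expRN_le1.
  have h2 : expR (- (s / 2)) <= K^-1.
    rewrite -[K^-1]lnK ?posrE ?invr_gt0// lnV ?posrE// ler_expR lerN2.
    by move: sL; rewrite /L; lra.
  have -> : expR (- s) = expR (- (s / 2)) * expR (- (s / 2)).
    by rewrite -expRD; congr expR; field.
  rewrite (_ : s ^+ 2 * _ = 2 * expR 8 * s * ((s / 2 * expR (- (s / 2))) * expR (- (s / 2)))); last by field.
  rewrite ler_wpM2l ?mulr_ge0 ?expR_ge0// -[leRHS]mul1r ler_pM ?expR_ge0//.
  by rewrite mulr_ge0 ?expR_ge0// divr_ge0.
have half x : 0 <= x -> K * x <= L -> 1 / 2 <= 1 - x.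
  move=> x0 Kx; have : x <= 1 / 2.
    by rewrite -(ler_pM2l K0); apply: (le_trans Kx); lra.
  lra.
have rho4 : rho ^+ (k - 4) <= 16 * rho ^+ (k - 2).
  have -> : (k - 2 = k - 4 + 2)%N by clear -k4; lia.
  rewrite exprD mulrCA ler_peMr ?exprn_ge0//.
  have hp2 : 1 / 2 <= 1 - p j.
    apply: half; [exact: hp.1|].
    by apply: le_trans sL; rewrite /s lerDl.
  have hq2 : 1 / 2 <= 1 - q j.
    apply: half; [exact: hq.1|].
    by apply: le_trans sL; rewrite /s lerDr.
  have : 1 / 2 * (1 / 2) <= rho by apply: ler_pM.
  move=> h; have : (1 / 2 * (1 / 2)) ^+ 2 <= rho ^+ 2.
    by rewrite lerXn2r ?nnegrE.
  lra.
have ln2 : 1 <= ln K ^+ 2 by rewrite expr_ge1//; lra.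
have D0 : 0 <= del j ^+ 2 * rho ^+ (k - 2).
  by apply: mulr_ge0; [exact: sqr_ge0|exact: exprn_ge0].
have Dln : del j ^+ 2 * rho ^+ (k - 2) <= ln K ^+ 2 * (del j ^+ 2 * rho ^+ (k - 2)).
  by rewrite ler_peMl.
have sE : s = 2 * lam j + del j by rewrite /s /mu /lam /del; ring.
case: (leP (`|del j|) 1) => d1.
  suff : s ^+ 2 * rho ^+ (k - 4) <= 8 * expR 9 * (lam j ^+ 2 * expR (- (2 * lam j))) +
      32 * (del j ^+ 2 * rho ^+ (k - 2)) by lra.
  apply: (@le_trans _ _ (8 * lam j ^+ 2 * rho ^+ (k - 4) + 2 * del j ^+ 2 * rho ^+ (k - 4))).
    rewrite -mulrDl ler_wpM2r ?exprn_ge0// sE.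
    by have := sqr_ge0 (2 * lam j - del j); lra.
  apply: lerD.
    apply: (@le_trans _ _ (8 * lam j ^+ 2 * (expR 8 * (expR 1 * expR (- (2 * lam j)))))).
      apply: ler_wpM2l; first by rewrite mulr_ge0 ?sqr_ge0.
      apply: (le_trans ee); rewrite ler_wpM2l ?expR_ge0// -expRD ler_expR sE.
      by move: d1; rewrite ler_norml => /andP[]; lra.
    rewrite (_ : expR 9 = expR 8 * expR 1); last by rewrite -expRD; congr expR; ring.
    by apply: eq_ler; ring.
  rewrite (_ : 32 * _ = 2 * del j ^+ 2 * (16 * rho ^+ (k - 2))); last by ring.
  by apply: ler_wpM2l => //; apply: mulr_ge0 => //; exact: sqr_ge0.
suff : s ^+ 2 * rho ^+ (k - 4) <= 32 * 32 * (ln K ^+ 2 * (del j ^+ 2 * rho ^+ (k - 2))) by lra.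
have dd : 1 <= del j ^+ 2.
  by rewrite -real_normK ?num_real// expr_ge1// ltW.
have ss : s ^+ 2 <= L ^+ 2 * del j ^+ 2.
  apply: (@le_trans _ _ (L ^+ 2)); first by rewrite lerXn2r ?nnegrE// (le_trans s0).
  by rewrite ler_peMr// sqr_ge0.
apply: (@le_trans _ _ (L ^+ 2 * del j ^+ 2 * (16 * rho ^+ (k - 2)))).
  by apply: ler_pM => //; rewrite ?sqr_ge0 ?exprn_ge0.
by apply: eq_ler; rewrite /L; ring.
Qed.

End CollisionTest.

(** * What the rate controls *)

Lemma cubeD_le (R : realType) (a b : R) : 0 <= a -> 0 <= b ->
  (a + b) ^+ 3 <= 4 * (a ^+ 3 + b ^+ 3).
Proof.
move=> a0 b0.
have : 0 <= (a + b) * (a - b) ^+ 2 by rewrite mulr_ge0 ?sqr_ge0// addr_ge0.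
lra.
Qed.

Section Rate.
Variables (R : realType) (d k : nat) (pi : 'I_d -> R).
Hypotheses (d0 : (0 < d)%N) (hpi : simplex R d pi) (k3 : (3 <= k)%N).
Let K : R := k%:R.
Let r := closeness_rate pi k.
Let kappa := K * r.

Definition screened_energy : R := \sum_j (K * pi j) ^+ 2 * expR (- (K * pi j / 2)).
Definition profile_energy : R := \sum_j small_or_root (K * pi j).

Let K0 : 0 < K. Proof. by rewrite ltr0n (leq_trans _ k3). Qed.

Let ln1 : 1 <= ln K. Proof. by apply: ln_ge1; rewrite ler_nat. Qed.

Lemma rate_ge_parametric : K <= kappa ^+ 2 /\ 0 < r.
Proof.
have l1 := ln1.
have rs : Num.sqrt (ln K / K) <= r.
  by rewrite /r /closeness_rate !le_max lexx !orbT.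
have lk : 0 < ln K / K by rewrite divr_gt0//; lra.
have s0 : 0 < Num.sqrt (ln K / K) by rewrite sqrtr_gt0.
split; last exact: lt_le_trans rs.
have : ln K / K <= r ^+ 2.
  rewrite -[leLHS](sqr_sqrtr (ltW lk)) lerXn2r ?nnegrE ?(ltW s0)//.
  exact/ltW/(lt_le_trans s0).
rewrite ler_pdivrMr// => h.
apply: (@le_trans _ _ (K * ln K)); first by rewrite ler_peMr// ltW.
by rewrite /kappa exprMn [K ^+ 2]expr2 -mulrA ler_wpM2l ?(ltW K0)// mulrC.
Qed.

Lemma kappa_ge1 : 1 <= kappa.
Proof.
have [h r0] := rate_ge_parametric.
have K1 : 1 <= K by rewrite ler1n (leq_trans _ k3).
have ka0 : 0 <= kappa by rewrite mulr_ge0// ltW.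
rewrite -(@ler_pXn2r _ 2)// ?nnegrE// expr1n; exact: le_trans h.
Qed.

Lemma rate_large :
  (\sum_(l | 1 < K * pi l) cbrt (K * pi l) ^+ 2) ^+ 3 <= kappa ^+ 4.
Proof.
set Y := \sum_(1 <= i < (small_rank pi k).+1) order_stat pi i `^ (2 / 3).
have Y0 : 0 <= Y by apply: sumr_ge0 => i _; exact: powR_ge0.
have rY : 1 / Num.sqrt K * Y `^ (3 / 4) <= r.
  by rewrite /r /closeness_rate !le_max lexx !orbT.
have XY : \sum_(l | 1 < K * pi l) cbrt (pi l) ^+ 2 <= Y.
  have := head_ranks pi k (F := fun x => x `^ (2 / 3)) d0 (fun x => powR_ge0 _ _).
  rewrite -/Y; apply: le_trans; rewrite le_eqVlt; apply/orP; left; apply/eqP.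
  by apply: eq_big => [l|l _]; [rewrite ltr_pdivrMr// mulrC|rewrite powR23E].
set X := \sum_(l | _) _ in XY.
have X0 : 0 <= X by apply: sumr_ge0 => l _; exact: sqr_ge0.
have -> : \sum_(l | 1 < K * pi l) cbrt (K * pi l) ^+ 2 = cbrt K ^+ 2 * X.
  rewrite mulr_sumr; apply: eq_bigr => l _.
  by rewrite /cbrt powRM ?hpi.1 ?(ltW K0)// exprMn.
have sK0 : 0 < Num.sqrt K by rewrite sqrtr_gt0.
have rY4 : Y ^+ 3 / K ^+ 2 <= r ^+ 4.
  have -> : Y ^+ 3 / K ^+ 2 = (1 / Num.sqrt K * Y `^ (3 / 4)) ^+ 4.
    have -> : (1 / Num.sqrt K * Y `^ (3 / 4)) ^+ 4 =
        (Y `^ (3 / 4)) ^+ 4 / (Num.sqrt K ^+ 2) ^+ 2 by field; rewrite gt_eqF.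
    rewrite sqr_sqrtr ?(ltW K0)// -(@powR_mulrn _ (Y `^ _)) ?powR_ge0// -powRrM.
    rewrite (_ : 3 / 4 * 4%:R = 3%:R); last by field.
    by rewrite powR_mulrn.
  rewrite lerXn2r ?nnegrE//; last by case: rate_ge_parametric => _ /ltW.
  by rewrite mulr_ge0 ?powR_ge0// divr_ge0// ltW.
rewrite exprMn -exprM (_ : (2 * 3 = 3 * 2)%N)// exprM cbrtK ?(ltW K0)//.
apply: (@le_trans _ _ (K ^+ 2 * Y ^+ 3)).
  by rewrite ler_wpM2l ?sqr_ge0// lerXn2r ?nnegrE.
rewrite /kappa exprMn.
have K20 : 0 < K ^+ 2 by rewrite exprn_gt0.
rewrite [leRHS](_ : _ = K ^+ 2 * (K ^+ 2 * r ^+ 4)); last by ring.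
apply: ler_wpM2l; first exact: ltW.
by move: rY4; rewrite ler_pdivrMr// [r ^+ 4 * _]mulrC.
Qed.

(** The four facts about a near-minimizer I that the tests use; [S] is the set
    of the I - 1 largest coordinates. *)
Lemma rate_budget : exists (I : nat) (S : {set 'I_d}),
  [/\ (#|S| <= I)%N,
      I%:R * ln K ^+ 2 <= 4 * kappa ^+ 2,
      I%:R ^+ 2 * screened_energy <= 16 * kappa ^+ 4 &
      K * \sum_(l in ~: S) pi l <= 2 * kappa].
Proof.
have [_ r0] := rate_ge_parametric; have k0 := K0.
pose T := [set tail_bound pi k I | I in [set I | (small_rank pi k <= I)%N]].
have infr : inf T <= r by rewrite /r /closeness_rate le_max lexx.
have hT : has_inf T.
  split; first by exists (tail_bound pi k (small_rank pi k)); exists (small_rank pi k) => /=.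
  exists 0 => _ [I _ <-]; rewrite /tail_bound !le_max mulr_ge0 ?sqrtr_ge0//.
  by apply: divr_ge0; [have := ln1; rewrite /K; lra|exact: ler0n].
have [_ [I JI <-] Ilt] := inf_adherent r0 hT.
have Ile : tail_bound pi k I <= 2 * r by move: Ilt; rewrite -/T; lra.
have [/andP[J0 _] _] := small_rankP pi k d0.
have I0 : (0 < I)%N by exact: leq_trans JI.
have [S [SI Stail]] := top_ranks pi I0.
exists I, S; split => //.
- have : Num.sqrt I%:R * (ln K / K) <= 2 * r.
    by apply: le_trans Ile; rewrite /tail_bound !le_max lexx.
  have l1 := ln1.
  move=> h; have h1 : Num.sqrt I%:R * ln K <= 2 * kappa.
    have := ler_wpM2l (ltW K0) h; rewrite /kappa.
    rewrite (_ : K * (_ * (ln K / K)) = Num.sqrt I%:R * ln K); last by field; rewrite gt_eqF.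
    by lra.
  have h0 : 0 <= Num.sqrt I%:R * ln K by rewrite mulr_ge0 ?sqrtr_ge0//; lra.
  have : (Num.sqrt I%:R * ln K) ^+ 2 <= (2 * kappa) ^+ 2.
    by rewrite lerXn2r ?nnegrE// (le_trans h0).
  by rewrite !exprMn sqr_sqrtr//; lra.
- set X := \sum_i pi i ^+ 2 * expR (- (k%:R * pi i / 2)).
  have X0 : 0 <= X by apply: sumr_ge0 => i _; rewrite mulr_ge0 ?sqr_ge0 ?expR_ge0.
  have h : Num.sqrt I%:R / Num.sqrt K * X `^ (1 / 4) <= 2 * r.
    by apply: le_trans Ile; rewrite /tail_bound !le_max lexx !orbT.
  have -> : screened_energy = K ^+ 2 * X.
    rewrite mulr_sumr; apply: eq_bigr => j _; rewrite /K; ring.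
  have sK0 : 0 < Num.sqrt K by rewrite sqrtr_gt0.
  have : I%:R ^+ 2 / K ^+ 2 * X <= 16 * r ^+ 4.
    have -> : I%:R ^+ 2 / K ^+ 2 * X = (Num.sqrt I%:R / Num.sqrt K * X `^ (1 / 4)) ^+ 4.
      have -> : (Num.sqrt I%:R / Num.sqrt K * X `^ (1 / 4)) ^+ 4 =
        (Num.sqrt I%:R ^+ 2) ^+ 2 / (Num.sqrt K ^+ 2) ^+ 2 * (X `^ (1 / 4)) ^+ 4.
        by field; rewrite gt_eqF.
      rewrite !sqr_sqrtr ?(ltW K0)// -(@powR_mulrn _ (X `^ _)) ?powR_ge0// -powRrM.
      rewrite (_ : 1 / 4 * 4%:R = 1); last by field.
      by rewrite powRr1.
    rewrite (_ : 16 * r ^+ 4 = (2 * r) ^+ 4); last by ring.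
    rewrite lerXn2r ?nnegrE//; last by rewrite mulr_ge0// ltW.
    by rewrite mulr_ge0 ?powR_ge0// divr_ge0 ?sqrtr_ge0.
  have K40 : 0 < K ^+ 4 by rewrite exprn_gt0.
  move/(ler_wpM2l (ltW K40)); rewrite /kappa.
  rewrite (_ : K ^+ 4 * (_ / _ * X) = I%:R ^+ 2 * (K ^+ 2 * X)); last by field; rewrite gt_eqF.
  by move/le_trans; apply; apply: eq_ler; ring.
have : \sum_(l in ~: S) pi l <= 2 * r.
  by rewrite Stail; apply: le_trans Ile; rewrite /tail_bound !le_max lexx !orbT.
by move/(ler_wpM2l (ltW K0)); rewrite /kappa; lra.
Qed.

(** Entries of [pi] above 1 / k are controlled by the 2/3-norm in the rate.  For
    the small ones let T be the sum of the squares of the K pi_j <= 1: it is at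
    most I plus K times the tail, and at most twice [screened_energy].  Either
    the tail dominates, and T is of order kappa; or T is of order I, and T^3 is
    at most of order I^2 [screened_energy]. *)
Lemma profile_energy_le : (profile_energy + 1) ^+ 3 <= 16 ^+ 3 * kappa ^+ 4.
Proof.
have [I [S [SI _ hQ hS]]] := rate_budget.
have ka1 := kappa_ge1; have k0 := K0.
have x0 j : 0 <= K * pi j by rewrite mulr_ge0 ?hpi.1// ltW.
pose P j := 1 < K * pi j.
pose S1 := \sum_(j | P j) cbrt (K * pi j) ^+ 2.
pose T := \sum_(j | ~~ P j) (K * pi j) ^+ 2.
have S10 : 0 <= S1 by apply: sumr_ge0 => j _; exact: sqr_ge0.
have T0 : 0 <= T by apply: sumr_ge0 => j _; exact: sqr_ge0.
have FT : profile_energy <= S1 + T.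
  rewrite /profile_energy (bigID P) /=; apply: lerD; apply: ler_sum => j _.
    by rewrite ge_min lexx.
  by rewrite ge_min lexx orbT.
have F0 : 0 <= profile_energy by apply: sumr_ge0 => j _; exact: small_or_root_ge0.
have hS1 : S1 ^+ 3 <= kappa ^+ 4 := rate_large.
have T1 : T <= I%:R + 2 * kappa.
  apply: (@le_trans _ _ (\sum_(j in S) 1 + K * \sum_(l in ~: S) pi l)); last first.
    by apply: lerD => //; rewrite sumr_const ler_nat.
  rewrite /T (bigID (mem S)) /= mulr_sumr; apply: lerD.
    rewrite [leRHS]big_mkcond [leLHS]big_mkcond; apply: ler_sum => j _ /=.
    case: (j \in S); rewrite ?andbF ?andbT//=; case: ifP => //.
    by rewrite /P -leNgt => h; rewrite exprn_ile1.
  rewrite [leRHS]big_mkcond [leLHS]big_mkcond; apply: ler_sum => j _ /=.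
  rewrite !inE; case: (j \in S); rewrite ?andbF ?andbT//=; case: ifP => //.
  by rewrite /P -leNgt => h; rewrite expr2 ler_piMl.
have T2 : T <= 2 * screened_energy.
  rewrite /T /screened_energy mulr_sumr big_mkcond; apply: ler_sum => j _ /=.
  have sq0 := sqr_ge0 (K * pi j); have e0 := expR_ge0 (- (K * pi j / 2)).
  case: ifP => [|_]; last by apply: mulr_ge0 => //; exact: mulr_ge0.
  rewrite /P -leNgt => h; rewrite mulrCA ler_peMr//.
  rewrite expRN -ler_pdivrMr ?invr_gt0 ?expR_gt0// invrK mul1r.
  rewrite (_ : 2 = (1 - 1 / 2)^-1); last by field.
  by apply: le_trans (expR_le_inv _); [rewrite ler_expR|]; lra.
have ka3 : kappa ^+ 3 <= kappa ^+ 4 by apply: ler_weXn2l => //; lra.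
have ka4 : 1 <= kappa ^+ 4 by apply: exprn_ege1.
have hT : T ^+ 3 <= 128 * kappa ^+ 4.
  have [h|h] := leP I%:R (2 * kappa).
    have : T ^+ 3 <= (4 * kappa) ^+ 3 by rewrite lerXn2r ?nnegrE//; lra.
    rewrite exprMn; lra.
  have Q0 : 0 <= screened_energy by lra.
  have h2 : T ^+ 2 <= (2 * I%:R) ^+ 2 by rewrite lerXn2r ?nnegrE ?mulr_ge0//; lra.
  have : T ^+ 2 * T <= (2 * I%:R) ^+ 2 * (2 * screened_energy).
    by apply: ler_pM => //; exact: sqr_ge0.
  rewrite exprMn; lra.
apply: (@le_trans _ _ ((S1 + T + 1) ^+ 3)).
  by rewrite lerXn2r ?nnegrE ?addr_ge0//; lra.
have := cubeD_le (addr_ge0 S10 T0) ler01.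
have := cubeD_le S10 T0; rewrite expr1n; lra.
Qed.

End Rate.

(** * The combined test, its risk and the separation distance *)

Section Transfer.
Variables (R : realType) (d : nat) (K : R) (pi q : 'I_d -> R).
Hypotheses (K0 : 0 <= K) (hpi : simplex R d pi) (hq : neighborhood pi q).

Lemma neighborhood_energy_le (f g : R -> R) (c : R) : 0 <= c -> f 0 = 0 ->
  (forall y, 0 <= g y) ->
  (forall x y, 0 <= x -> 0 <= y -> x <= 16 * y -> y <= 4 * x -> f x <= c * g y) ->
  \sum_j f (K * q j) <= 15 / 2 * c * \sum_l g (K * pi l).
Proof.
move=> c0 f0 g0 fg.
have q0 j : 0 <= q j by exact: hq.1.1.
have := neighborhood_sum_le hpi hq (f := fun j => f (K * q j)) (g := fun l => c * g (K * pi l)).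
move=> /(_ _ _)/le_trans; rewrite -mulr_sumr mulrA => h.
rewrite [leLHS](bigID (fun j => 0 < q j)) /= [X in _ + X]big1 ?addr0.
  apply: h => // [l|j l qj pl h1 h2]; first exact: mulr_ge0.
  by apply: fg; rewrite ?mulr_ge0 ?hpi.1// mulrCA ler_wpM2l.
by move=> j; rewrite -leNgt => h'; have -> : q j = 0 by [apply/eqP; rewrite eq_le h' q0]; rewrite mulr0.
Qed.

End Transfer.

(** The constant [H] is a signal-to-noise ratio: once the mean exceeds H times
    both ln(k)^2 and the null standard deviation, the variance is at most of
    order 1 / H times the square of the mean. *)
Lemma collision_stat_power (R : realType) (eta K2 Cf : R) : 0 < eta -> 0 <= K2 -> 0 <= Cf ->
  exists H : R, 0 < H /\ forall (d k : nat) (p q : 'I_d -> R)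
    (hp : simplex R d p) (hq : simplex R d q) (Q : R),
    (4 <= k)%N -> 32 ^+ 2 <= k%:R :> R -> 0 <= Q ->
    \sum_j (k%:R * q j) ^+ 2 * expR (- (2 * (k%:R * q j))) <= Cf * Q ->
    H * Num.sqrt (Q + 1) <= collision_stat_mean k p q ->
    H * ln (k%:R : R) ^+ 2 <= collision_stat_mean k p q ->
    pairm (iid (obs hp) k) (iid (obs hq) k)
      (fun s => (collision_stat R k s < K2 * Num.sqrt (Q + 1))%R%:R) <= eta.
Proof.
move=> eta0 K20 Cf0.
have [a [a0 aE]] : exists a : R, 0 <= a /\ a = 600 * expR 8.
  by exists (600 * expR 8); split; [apply: mulr_ge0; [exact: ler0n|exact: expR_ge0]|reflexivity].
have [e9 [e90 e9E]] : exists a : R, 0 <= a /\ a = 8 * expR 9.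
  by exists (8 * expR 9); split; [apply: mulr_ge0; [exact: ler0n|exact: expR_ge0]|reflexivity].
have [e4 [e40 e4E]] : exists a : R, 0 <= a /\ a = 4 * expR 8.
  by exists (4 * expR 8); split; [apply: mulr_ge0; [exact: ler0n|exact: expR_ge0]|reflexivity].
have [b [b0 bE]] : exists b : R, 0 <= b /\ b = 32 * 33.
  by exists (32 * 33); split; [apply: mulr_ge0; exact: ler0n|reflexivity].
pose A2 := a * (e9 * Cf + b + e4).
have A20 : 0 <= A2 by rewrite mulr_ge0// !addr_ge0// mulr_ge0.
have A2e : 0 <= A2 / eta by rewrite divr_ge0// ltW.
pose H := 4 * (A2 / eta) + 1 + 2 * K2.
have H1 : 1 <= H by rewrite /H; lra.
have HA : 4 * A2 <= eta * H.
  rewrite (_ : 4 * A2 = eta * (4 * (A2 / eta))); last by field; rewrite gt_eqF.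
  by rewrite ler_wpM2l ?(ltW eta0)// /H; lra.
have HK : 2 * K2 <= H by rewrite /H; lra.
have H0 : 0 < H by lra.
clearbody H; exists H; split=> // d k p q hp hq Q k4 hk Q0.
set V0 := \sum_j _; set M2 := collision_stat_mean k p q => hV hQ hln.
set sQ := Num.sqrt (Q + 1) in hQ *.
have sQ2 : sQ ^+ 2 = Q + 1 by rewrite sqr_sqrtr//; lra.
have sQ1 : 1 <= sQ by rewrite -sqrtr1 ler_wsqrtr//; lra.
have M20 : 0 < M2 by apply: lt_le_trans hQ; rewrite mulr_gt0//; lra.
have var := collision_stat_var hp hq k4; rewrite -aE -/M2 in var.
have noise := collision_stat_noise_le hp hq k4 hk.
rewrite -e9E -e4E -bE -/M2 in noise.
have noise2 : \sum_j (k%:R * (p j + q j)) ^+ 2 * ((1 - p j) * (1 - q j)) ^+ (k - 4) <=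
   (e9 * Cf + b + e4) * (M2 ^+ 2 / H).
  apply: (le_trans noise); rewrite !mulrDl.
  have hQ2 : Q + 1 <= M2 ^+ 2 / H.
    rewrite -sQ2 ler_pdivlMr//; apply: (@le_trans _ _ ((H * sQ) ^+ 2)).
      rewrite exprMn mulrC ler_wpM2r ?sqr_ge0// expr2 ler_peMr//; exact: ltW.
    by rewrite lerXn2r ?nnegrE ?(ltW M20)// mulr_ge0// ?(ltW H0)//; lra.
  have hl2 : ln k%:R ^+ 2 * M2 <= M2 ^+ 2 / H.
    rewrite ler_pdivlMr// mulrAC [M2 ^+ 2]expr2 ler_wpM2r ?(ltW M20)//.
    by rewrite mulrC.
  apply: lerD; first apply: lerD.
  - rewrite -mulrA ler_wpM2l//; apply: (le_trans hV); rewrite ler_wpM2l//.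
    by apply: le_trans hQ2; rewrite lerDl.
  - by rewrite -mulrA ler_wpM2l.
  - by rewrite ler_peMr//; apply: le_trans hQ2; lra.
apply: (@le_trans _ _ (pairm (iid (obs hp) k) (iid (obs hq) k)
   (fun s => (collision_stat R k s <= M2 - M2 / 2)%R%:R))).
  apply: le_mean => s; rewrite ler_nat; case: ltP => //= h.
  suff -> : collision_stat R k s <= M2 - M2 / 2 by [].
  have : 2 * K2 * sQ <= M2 by apply: le_trans hQ; rewrite ler_wpM2r//; lra.
  lra.
have M22 : 0 < M2 / 2 by rewrite divr_gt0.
apply: le_trans (chebyshev_le M22 (le_trans var (ler_wpM2l a0 noise2))) _.
rewrite (_ : _ / _ = 4 * A2 / H); first by rewrite ler_pdivrMr.
by rewrite /A2; field; rewrite !gt_eqF.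
Qed.

Section Test.
Variables (R : realType) (d k m n : nat).
Hypothesis kmn : k = (m + n)%N.
Variables (t1 t2 t3 : R).

Definition split_sample (x y : seq 'I_d) := (take m y, (drop m x, drop m y)).

Definition closeness_test (x y : seq 'I_d) : bool :=
  [|| t1 <= weighted_stat R (split_sample x y), t2 <= collision_stat R k (x, y)
    | t3 <= unseen_stat R (split_sample x y)]%R.

Variables (p q : 'I_d -> R) (hp : simplex R d p) (hq : simplex R d q).

Let Ek := pairm (iid (obs hp) k) (iid (obs hq) k).
Let E3 := pairm (iid (obs hq) m) (pairm (iid (obs hp) n) (iid (obs hq) n)).

Lemma split_sampleE (f : seq 'I_d * (seq 'I_d * seq 'I_d) -> R) :
  Ek (fun t => f (split_sample t.1 t.2)) = E3 f.
Proof.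
rewrite /Ek kmn pairmE iid_cat.
transitivity (iid (obs hp) m (fun x1 => iid (obs hp) n (fun x2 =>
  iid (obs hq) m (fun y1 => iid (obs hq) n (fun y2 => f (y1, (x2, y2))))))).
  apply: eq_iid => x1 sx1; apply: eq_mean => x2.
  rewrite iid_cat; apply: eq_iid => y1 sy1; apply: eq_mean => y2.
  by rewrite /split_sample /= take_size_cat// !drop_size_cat.
by rewrite mean_cst iid_exchange.
Qed.

Lemma closeness_test_reject :
  Ek (fun t => (closeness_test t.1 t.2)%:R) <=
  E3 (fun s => (t1 <= weighted_stat R s)%R%:R) + Ek (fun t => (t2 <= collision_stat R k t)%R%:R) +
  E3 (fun s => (t3 <= unseen_stat R s)%R%:R).
Proof.
rewrite -(split_sampleE (fun s => (t1 <= weighted_stat R s)%R%:R)).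
rewrite -(split_sampleE (fun s => (t3 <= unseen_stat R s)%R%:R)) -!meanD.
apply: le_mean => -[x y]; rewrite /closeness_test -!natrD ler_nat /=.
by case: (_ <= _); case: (_ <= _); case: (_ <= _).
Qed.

Lemma closeness_test_accept :
  let acc := Ek (fun t => (~~ closeness_test t.1 t.2)%:R) in
  [/\ acc <= E3 (fun s => (weighted_stat R s < t1)%R%:R),
      acc <= Ek (fun t => (collision_stat R k t < t2)%R%:R) &
      acc <= E3 (fun s => (unseen_stat R s < t3)%R%:R)].
Proof.
rewrite -(split_sampleE (fun s => (weighted_stat R s < t1)%R%:R)).
rewrite -(split_sampleE (fun s => (unseen_stat R s < t3)%R%:R)).
split; apply: le_mean => -[x y]; rewrite /closeness_test /= ler_nat !negb_or -!ltNge.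
- by case: (_ < _); case: (_ < _); case: (_ < _).
- by case: (_ < _) (collision_stat R k (x, y) < t2) (_ < _) => [] [] [].
- by case: (weighted_stat R _ < _); case: (collision_stat _ _ _ < _); case: (_ < _).
Qed.

End Test.

Section Risk.
Variables (R : realType) (d k : nat) (H0 H1 : set (('I_d -> R) * ('I_d -> R))).

Lemma risk_le (phi : test d k) (a b : R) : 0 <= a -> 0 <= b ->
  (forall pq, H0 pq -> prob_samples pq.1 pq.2 phi <= a) ->
  (forall pq, H1 pq -> prob_samples pq.1 pq.2 (fun x y => ~~ phi x y) <= b) ->
  risk H0 H1 phi <= a + b.
Proof.
have sup_le (A : set R) c : 0 <= c -> (forall x, A x -> x <= c) -> sup A <= c.
  move=> c0 Ac; have [->|A0] := eqVneq A set0; first by rewrite sup0.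
  by apply: ge_sup => //; apply/set0P.
move=> a0 b0 ha hb; apply: lerD; apply: sup_le => // _ [pq h <-].
  exact: ha.
exact: hb.
Qed.

End Risk.

Lemma separation_distance_le (R : realType) (d : nat) (gamma : R) H0 H1
    (pi : 'I_d -> R) (k : nat) (rho : R) (phi : test d k) :
  0 < rho -> risk (H0 pi) (H1 pi rho) phi <= gamma ->
  (separation_distance gamma H0 H1 pi k <= rho%:E)%E.
Proof.
move=> rho0 hrisk.
apply: (@le_trans _ _ (ereal_inf [set r%:E | r in
   [set r : R | 0 < r /\ risk (H0 pi) (H1 pi r) phi <= gamma]])).
  by apply: ereal_inf_lbound; exists phi.
by apply: ereal_inf_lbound; exists rho.
Qed.

Lemma l1_dist_le2 (R : realType) (d : nat) (p q : 'I_d -> R) :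
  simplex R d p -> simplex R d q -> l1_dist p q <= 2.
Proof.
move=> hp hq; rewrite (_ : 2 = \sum_j (p j + q j)).
  by apply: ler_sum => j _; apply: le_trans (ler_normB _ _) _; rewrite !ger0_norm ?hp.1 ?hq.1.
by rewrite big_split /= hp.2 hq.2; lra.
Qed.

(** Beyond distance 2 the alternative is empty, and accepting always has no
    error. *)
Lemma trivial_separation (R : realType) (d : nat) (gamma : R) (pi : 'I_d -> R) k rho :
  0 <= gamma -> 2 < rho ->
  (separation_distance gamma (@H0_clo R d) (@H1_clo R d) pi k <= rho%:E)%E.
Proof.
move=> g0 rho2; apply: (separation_distance_le (phi := fun _ _ => false)); first by lra.
rewrite -[leRHS]addr0; apply: risk_le => // -[p q].
  by move=> _; rewrite /prob_samples big1// => x _; rewrite big_pred0.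
by move=> [hp [hq _]] /= hrho; have := l1_dist_le2 hp hq; lra.
Qed.

(** * Power of the combined test *)

(** On coordinates of expected count at most 2, screening costs a constant
    factor. *)
Lemma screen_ge (R : realType) (k : nat) (p q : R) : (4 <= k)%N -> 0 <= p -> 0 <= q ->
  k%:R * p <= 2 -> k%:R * q <= 1 -> expR (- 6) <= ((1 - p) * (1 - q)) ^+ (k - 2).
Proof.
move=> k4 p0 q0 kp kq.
have K4 : 4 <= k%:R :> R by rewrite ler_nat.
have one (x c : R) : 0 <= x -> k%:R * x <= c -> c <= 2 ->
    expR (- (2 * c)) <= (1 - x) ^+ (k - 2).
  move=> x0 kx c2.
  have x2 : x <= 1 / 2 by nra.
  have hx : 0 <= x <= 1 / 2 by rewrite x0.
  apply: (@le_trans _ _ (expR (- (2 * x)) ^+ (k - 2))).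
    rewrite -expRM_natl ler_expR natrB ?(leq_trans _ k4)//.
    have : 0 <= x * 2 by lra.
    lra.
  rewrite lerXn2r ?nnegrE ?expR_ge0//; last exact: expR_le_oneB.
  by lra.
rewrite exprMn (_ : - 6 = - (2 * 2) + - (2 * 1)); last by ring.
by rewrite expRD ler_pM ?expR_ge0// one//; lra.
Qed.

Section Alternative.
Variables (R : realType) (d k : nat) (pi p q : 'I_d -> R).
Hypotheses (d0 : (0 < d)%N) (hpi : simplex R d pi) (k4 : (4 <= k)%N).
Hypotheses (hp : simplex R d p) (hqn : neighborhood pi q).
Let K : R := k%:R.
Let kappa := K * closeness_rate pi k.
Let lam j : R := K * q j.
Let mu j : R := K * p j.
Let del j : R := K * (p j - q j).
Let hq : simplex R d q := hqn.1.
Let Q := screened_energy k pi.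

(** Cauchy-Schwarz over at most 15 I coordinates gives a mean of order
    kappa^2 / I, which the first two terms of the minimum in the rate compare
    with ln(k)^2 and with the null standard deviation. *)
Lemma collision_region_mean (c H I : R) (D : {set 'I_d}) :
  0 <= c -> 120 * H <= expR (- 6) * c ^+ 2 -> 0 < kappa -> 0 < H ->
  #|D|%:R <= 15 * I -> I * ln K ^+ 2 <= 4 * kappa ^+ 2 -> I ^+ 2 * Q <= 16 * kappa ^+ 4 ->
  1 <= ln K -> 0 <= Q ->
  (forall j, j \in D -> lam j <= 1 /\ mu j <= 2) ->
  c * kappa <= \sum_(j in D) `|del j| ->
  H * Num.sqrt (Q + 1) <= collision_stat_mean k p q /\ H * ln K ^+ 2 <= collision_stat_mean k p q.
Proof.
move=> c0 hc ka0 H0 DI hI hQ ln1 Q0 hD hdel.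
set M2 := collision_stat_mean k p q; set e6 := expR (- 6) in hc.
have e60 : 0 < e6 by exact: expR_gt0.
have c2 : 0 < c ^+ 2.
  have : 0 < e6 * c ^+ 2 by apply: lt_le_trans hc; rewrite mulr_gt0.
  by rewrite pmulr_rgt0.
have M2ge : e6 * \sum_(j in D) del j ^+ 2 <= M2.
  rewrite mulr_sumr /M2 /collision_stat_mean big_mkcond; apply: ler_sum => j _ /=.
  have q1 : 0 <= 1 - q j by rewrite subr_ge0 simplex_le1.
  have p1 : 0 <= 1 - p j by rewrite subr_ge0 simplex_le1.
  have sq0 := sqr_ge0 (del j).
  case: ifP => [/hD[l1 m2]|_].
    rewrite mulrC; apply: ler_wpM2l => //.
    by apply: screen_ge; rewrite ?hp.1 ?hq.1.
  by rewrite mulr_ge0// exprn_ge0// mulr_ge0.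
have sum0 : 0 <= \sum_(j in D) del j ^+ 2 by apply: sumr_ge0 => j _; exact: sqr_ge0.
have cs : (c * kappa) ^+ 2 <= (\sum_(j in D) del j ^+ 2) * (15 * I).
  apply: (@le_trans _ _ ((\sum_(j in D) `|del j| * 1) ^+ 2)).
    have -> : \sum_(j in D) `|del j| * 1 = \sum_(j in D) `|del j|.
      by apply: eq_bigr => j _; rewrite mulr1.
    have ck0 : 0 <= c * kappa by rewrite mulr_ge0// ltW.
    by rewrite lerXn2r ?nnegrE//; exact: le_trans hdel.
  apply: le_trans (cauchy_schwarz _ _ _) _.
  apply: (@le_trans _ _ ((\sum_(j in D) del j ^+ 2) * #|D|%:R)); last by rewrite ler_wpM2l.
  apply: eq_ler; congr (_ * _).
    by apply: eq_bigr => j _; rewrite real_normK ?num_real.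
  by under eq_bigr => j _ do rewrite expr1n; rewrite sumr_const.
have main : e6 * (c * kappa) ^+ 2 <= M2 * (15 * I).
  have I0 : 0 <= 15 * I by apply: le_trans DI; exact: ler0n.
  apply: (@le_trans _ _ (e6 * (\sum_(j in D) del j ^+ 2) * (15 * I))).
    by rewrite -mulrA ler_wpM2l// ltW.
  by rewrite ler_wpM2r.
have lhs0 : 0 < e6 * (c * kappa) ^+ 2.
  by rewrite mulr_gt0// exprMn mulr_gt0// exprn_gt0.
have I0 : 0 < I.
  have : 0 <= 15 * I by apply: le_trans DI; exact: ler0n.
  rewrite le_eqVlt => /orP[/eqP I0|]; last by rewrite pmulr_rgt0.
  by move: main; rewrite -I0 mulr0 leNgt lhs0.
have hck : 120 * H * kappa ^+ 2 <= M2 * (15 * I).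
  apply: le_trans main; rewrite (_ : e6 * _ = e6 * c ^+ 2 * kappa ^+ 2); last by ring.
  by rewrite ler_wpM2r ?sqr_ge0.
have fin x : I * x <= 8 * kappa ^+ 2 -> H * x <= M2.
  move=> hx; have h15 : 0 < 15 * I by rewrite mulr_gt0.
  rewrite -(ler_pM2r h15); apply: le_trans hck.
  have := ler_wpM2l (ltW H0) hx; lra.
have k2 : 0 <= kappa ^+ 2 by exact: sqr_ge0.
split; last by apply: fin; lra.
apply: fin.
have sQ : Num.sqrt (Q + 1) <= Num.sqrt Q + 1.
  have s0 := sqrtr_ge0 Q.
  rewrite -(@ler_pXn2r _ 2)// ?nnegrE ?sqrtr_ge0// ?addr_ge0//.
  have -> : Num.sqrt (Q + 1) ^+ 2 = Q + 1 by rewrite sqr_sqrtr//; lra.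
  have := sqr_sqrtr Q0; lra.
have IQ : I * Num.sqrt Q <= 4 * kappa ^+ 2.
  have h1 : 0 <= I * Num.sqrt Q by rewrite mulr_ge0 ?sqrtr_ge0// ltW.
  have h2 : 0 <= 4 * kappa ^+ 2 by rewrite mulr_ge0.
  rewrite -(@ler_pXn2r _ 2)// ?nnegrE//.
  rewrite exprMn sqr_sqrtr//; apply: (le_trans hQ); apply: eq_ler; ring.
have I1 : I <= I * ln K ^+ 2 by rewrite ler_peMr ?(ltW I0)// exprn_ege1.
have := ler_wpM2l (ltW I0) sQ; lra.
Qed.

(** If the first three regions carry little, then the fourth one carries the
    rest.  The second bound holds because p exceeds q on the second region, so
    that only the first and third regions can offset the excess. *)
Lemma alternative_regions (A : {set 'I_d}) (c c1 c2 : R) :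
  c * kappa <= \sum_j `|del j| ->
  \sum_(j | 1 <= lam j) `|del j| < c1 * kappa ->
  \sum_(j | (lam j < 1) && (2 < mu j)) `|del j| < c1 * kappa ->
  \sum_(j | [&& lam j < 1, mu j <= 2 & j \in A]) `|del j| < c2 * kappa ->
  (c - 2 * c1 - c2) * kappa <=
    \sum_(j | [&& lam j < 1, mu j <= 2 & j \notin A]) `|del j| /\
  \sum_(j | ~~ [&& lam j < 1, mu j <= 2 & j \notin A] && (p j < q j)) `|del j| <=
    (c1 + c2) * kappa.
Proof.
move=> hc hbig hspike hcol.
have split1 : \sum_j `|del j| = \sum_(j | 1 <= lam j) `|del j| +
   \sum_(j | (lam j < 1) && (2 < mu j)) `|del j| +
   \sum_(j | [&& lam j < 1, mu j <= 2 & j \in A]) `|del j| +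
   \sum_(j | [&& lam j < 1, mu j <= 2 & j \notin A]) `|del j|.
  rewrite (bigID (fun j => 1 <= lam j)) /= -!addrA; congr (_ + _).
  rewrite (bigID (fun j => 2 < mu j)) /=; congr (_ + _).
    by apply: eq_bigl => j; rewrite -ltNge.
  rewrite (bigID (mem A)) /=; congr (_ + _).
    by apply: eq_bigl => j; rewrite -ltNge -leNgt -andbA.
  by apply: eq_bigl => j; rewrite -ltNge -leNgt -andbA.
split; first by move: hc; rewrite split1; lra.
apply: (@le_trans _ _ (\sum_(j | 1 <= lam j) `|del j| +
    \sum_(j | [&& lam j < 1, mu j <= 2 & j \in A]) `|del j|)); last by lra.
have mkcond (P : pred 'I_d) :
    \sum_(j | P j) `|del j| = \sum_j if P j then `|del j| else 0 by exact: big_mkcond.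
rewrite (mkcond (fun j => _ && (p j < q j))) (mkcond (fun j => 1 <= lam j)).
rewrite (mkcond (fun j => [&& lam j < 1, mu j <= 2 & j \in A])) -big_split.
apply: ler_sum => j _ /=.
have n0 : 0 <= `|del j| by [].
have K0 : 0 <= K by exact: ler0n.
case: (ltP (p j) (q j)) => pq; last by rewrite andbF addr_ge0//; case: ifP.
have mul : mu j <= lam j by rewrite ler_wpM2l// ltW.
rewrite andbT; case: (leP 1 (lam j)) => lj /=; first by rewrite addr0.
have -> : mu j <= 2 by lra.
by case: (j \in A) => /=; rewrite add0r.
Qed.

End Alternative.

Lemma exists_large (R : realType) (eta a b : R) : 0 < eta ->
  exists x : R, [/\ 1 <= x, a <= eta * x ^+ 2 & b <= x].
Proof.
move=> eta0; exists (`|a| / eta + `|b| + 1).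
have h : 0 <= `|a| / eta by rewrite divr_ge0// ltW.
have hb : 0 <= `|b| by [].
have hb2 := ler_norm b; have ha2 := ler_norm a.
split; [by lra| |by lra].
apply: (le_trans ha2); rewrite -ler_pdivrMl// mulrC.
set x := _ + 1; apply: (@le_trans _ _ x); first by rewrite /x; lra.
by rewrite expr2 ler_peMl// /x; lra.
Qed.

Lemma markov_ratio (R : realType) (eta A B G x : R) : 0 < eta -> 0 < x -> 0 < G -> 0 <= B ->
  A <= B * G -> B <= eta * x ^+ 2 -> A / (x * Num.sqrt G) ^+ 2 <= eta.
Proof.
move=> eta0 x0 G0 B0 AB Bx.
have x20 : 0 < x ^+ 2 by rewrite exprn_gt0.
rewrite exprMn sqr_sqrtr ?(ltW G0)// ler_pdivrMr ?mulr_gt0//.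
by apply: (le_trans AB); rewrite mulrA ler_wpM2r// ltW.
Qed.

Lemma halve_sample (R : realType) (k : nat) : (8 <= k)%N ->
  exists m n : nat, k = (m + n)%N /\
    [/\ k%:R <= 2 * m.+1%:R :> R, 2 * m%:R <= k%:R :> R, n%:R <= k%:R :> R,
        k%:R <= 2 * n%:R :> R & k%:R <= 4 * (n%:R - 1) :> R].
Proof.
move=> k8; exists (k %/ 2)%N, (k - k %/ 2)%N; rewrite mulrBr mulr1 lerBrDr.
by rewrite -!natrM -natrD !ler_nat; split; [|split]; lia.
Qed.

Lemma neighborhood_profile_le (R : realType) (d k : nat) (pi q : 'I_d -> R) :
  simplex R d pi -> neighborhood pi q ->
  \sum_j small_or_root (k%:R * q j) <= 15 / 2 * 256 * profile_energy k pi.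
Proof.
move=> hpi hq; apply: (neighborhood_energy_le (ler0n R k) hpi hq (ler0n R 256)).
- by rewrite /small_or_root cbrt0 expr0n minxx.
- exact: small_or_root_ge0.
- by move=> x y x0 y0 xy _; exact: small_or_root_le.
Qed.

Lemma neighborhood_screened_le (R : realType) (d k : nat) (pi q : 'I_d -> R) :
  simplex R d pi -> neighborhood pi q ->
  \sum_j (k%:R * q j) ^+ 2 * expR (- (2 * (k%:R * q j))) <=
  15 / 2 * 256 * screened_energy k pi.
Proof.
move=> hpi hq.
apply: (neighborhood_energy_le (f := fun x => x ^+ 2 * expR (- (2 * x)))
   (g := fun y => y ^+ 2 * expR (- (y / 2))) (ler0n R k) hpi hq (ler0n R 256)).
- by rewrite expr0n mul0r.
- by move=> y; rewrite mulr_ge0 ?sqr_ge0 ?expR_ge0.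
- move=> x y x0 y0 xy yx; rewrite mulrA; apply: ler_pM; rewrite ?sqr_ge0 ?expR_ge0//.
    rewrite (_ : 256 * _ = (16 * y) ^+ 2); last by ring.
    by rewrite lerXn2r ?nnegrE ?mulr_ge0.
  by rewrite ler_expR; lra.
Qed.

Lemma closeness_test_null (R : realType) (d k m n : nat) (q : 'I_d -> R)
    (hq : simplex R d q) (eta Cf A1 K1 K2 K3 F Q : R) :
  k = (m + n)%N -> (4 <= k)%N -> k%:R <= 2 * m.+1%:R :> R -> n%:R <= k%:R :> R ->
  0 < eta -> 0 <= Cf -> 0 < K1 -> 0 < K2 -> 0 < K3 ->
  600 * expR 8 * (4 * expR 8) = A1 -> 0 <= A1 ->
  576 * Cf <= eta * K1 ^+ 2 -> A1 * Cf <= eta * K2 ^+ 2 -> 1 <= eta * K3 ^+ 2 ->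
  0 <= F -> 0 <= Q ->
  \sum_j small_or_root (k%:R * q j) <= Cf * F ->
  \sum_j (k%:R * q j) ^+ 2 * expR (- (2 * (k%:R * q j))) <= Cf * Q ->
  pairm (iid (obs hq) k) (iid (obs hq) k) (fun t => (closeness_test k m
    (K1 * Num.sqrt (F + 1)) (K2 * Num.sqrt (Q + 1)) (K3 * Num.sqrt k%:R) t.1 t.2)%:R) <=
  3 * eta.
Proof.
move=> kmn k4 mk nk eta0 Cf0 K10 K20 K30 A1E A10 hK1 hK2 hK3 F0 Q0 hF hQ.
have F1 : 0 < F + 1 by rewrite ltr_wpDl.
have Q1 : 0 < Q + 1 by rewrite ltr_wpDl.
have K0 : 0 < k%:R :> R by rewrite ltr0n (leq_trans _ k4).
have pos (x y : R) : 0 < x -> 0 < y -> 0 < x * Num.sqrt y.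
  by move=> x0 y0; rewrite mulr_gt0 ?sqrtr_gt0.
apply: (le_trans (closeness_test_reject kmn _ _ _ hq hq)).
rewrite (_ : 3 * eta = eta + eta + eta); last by ring.
apply: lerD; first apply: lerD.
- apply: le_trans (weighted_stat_null hq mk nk (pos _ _ K10 F1)) _.
  apply: (markov_ratio eta0 K10 F1 _ _ hK1); first by rewrite mulr_ge0 ?ler0n.
  rewrite -mulrA ler_wpM2l ?ler0n//; apply: (le_trans hF).
  by rewrite ler_wpM2l// lerDl.
- apply: le_trans (collision_stat_null hq k4 (pos _ _ K20 Q1)) _; rewrite mulrA A1E.
  apply: (markov_ratio eta0 K20 Q1 _ _ hK2); first by rewrite mulr_ge0.
  rewrite -mulrA ler_wpM2l//; apply: (le_trans hQ).
  by rewrite ler_wpM2l// lerDl.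
- apply: le_trans (unseen_stat_null m hq nk (pos _ _ K30 K0)) _.
  by apply: (markov_ratio eta0 K30 K0 _ _ hK3); rewrite ?mul1r.
Qed.

Lemma closeness_test_power (R : realType) (d k m n : nat) (pi p q : 'I_d -> R)
    (hp : simplex R d p) (hqn : neighborhood pi q) (hq : simplex R d q)
    (eta Cf K1 K2 K3 H c1 c2 c : R) :
  let F := profile_energy k pi in let Q := screened_energy k pi in
  (0 < d)%N -> simplex R d pi -> k = (m + n)%N -> (4 <= k)%N -> 32 ^+ 2 <= k%:R :> R ->
  k%:R <= 2 * m.+1%:R :> R -> 2 * m%:R <= k%:R :> R -> n%:R <= k%:R :> R ->
  k%:R <= 2 * n%:R :> R -> k%:R <= 4 * (n%:R - 1) :> R ->
  0 < eta -> eta <= 1 -> 0 < Cf -> 0 < K1 -> 0 < K3 -> 0 < H ->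
  3 * Cf / eta * power_const Cf eta K1 * 64 <= c1 ^+ 2 ->
  8 * power_const Cf eta K1 / eta <= c1 -> 0 < c1 ->
  1 <= eta * K3 ^+ 2 -> 120 * H <= expR (- 6) * c2 ^+ 2 -> 0 <= c2 ->
  4 * (480 + c1 + c2 + 4 * K3) <= c - 2 * c1 - c2 - 480 ->
  32 / eta <= c - 2 * c1 - c2 - 480 ->
  \sum_j small_or_root (k%:R * q j) <= Cf * F ->
  (H * Num.sqrt (Q + 1) <= collision_stat_mean k p q -> H * ln (k%:R : R) ^+ 2 <= collision_stat_mean k p q ->
    pairm (iid (obs hp) k) (iid (obs hq) k)
      (fun s => (collision_stat R k s < K2 * Num.sqrt (Q + 1))%R%:R) <= eta) ->
  c * closeness_rate pi k <= l1_dist p q ->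
  pairm (iid (obs hp) k) (iid (obs hq) k) (fun t => (~~ closeness_test k m
    (K1 * Num.sqrt (F + 1)) (K2 * Num.sqrt (Q + 1)) (K3 * Num.sqrt k%:R) t.1 t.2)%:R) <=
  3 * eta.
Proof.
cbv zeta; set F := profile_energy k pi; set Q := screened_energy k pi.
move=> d0 hpi kmn k4 Klarge mk mk' nk kn kn1 eta0 eta1 Cf0 K10 K30 H0 hc1 hc1' c10 hK3 hc2 c20.
move=> cbig ceta hF hcol hdist.
have [acc1 acc2 acc3] := closeness_test_accept kmn (K1 * Num.sqrt (F + 1))
  (K2 * Num.sqrt (Q + 1)) (K3 * Num.sqrt k%:R) hp hq.
set acc := pairm _ _ _ in acc1 acc2 acc3 *.
have k3 : (3 <= k)%N by exact: leq_trans k4.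
have ln1 : 1 <= ln (k%:R : R) by apply: ln_ge1; rewrite ler_nat.
pose K : R := k%:R; pose kappa := K * closeness_rate pi k.
have [Kka r0] := rate_ge_parametric pi k3; rewrite -/K -/kappa in Kka.
have K0 : 0 < K by rewrite ltr0n (leq_trans _ k3).
have K1' : 1 <= K by rewrite ler1n (leq_trans _ k3).
have ka1 := kappa_ge1 pi k3; rewrite -/K -/kappa in ka1.
have ka0 : 0 < kappa by exact: lt_le_trans ka1.
have hprof := profile_energy_le d0 hpi k3; rewrite -/K -/kappa -/F in hprof.
have F0 : 0 <= F by apply: sumr_ge0 => j _; exact: small_or_root_ge0.
have F11 : 1 <= F + 1 by rewrite lerDr.
have hF1 : \sum_j small_or_root (K * q j) <= Cf * (F + 1).
  by apply: (le_trans hF); rewrite ler_wpM2l ?(ltW Cf0)// lerDl.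
pose lam j := K * q j; pose mu j := K * p j; pose del j := K * (p j - q j).
have lam0 j : 0 <= lam j by rewrite mulr_ge0 ?hq.1// ltW.
have mu0 j : 0 <= mu j by rewrite mulr_ge0 ?hp.1// ltW.
have total : c * kappa <= \sum_j `|del j|.
  rewrite (_ : \sum_j `|del j| = K * l1_dist p q).
    by rewrite /kappa mulrCA ler_wpM2l// ltW.
  by rewrite mulr_sumr; apply: eq_bigr => j _; rewrite /del normrM ger0_norm// ltW.
have [hbig|hbig] := leP (c1 * kappa) (\sum_(j | 1 <= lam j) `|del j|).
  exact: (le_trans acc1 (weighted_stat_power_large hp hq mk mk' nk kn kn1 K1' Cf0 eta0 eta1
    (ltW K10) F11 hF1 ka1 hprof (ltW c10) hc1 hbig)).
have [hspike|hspike] := leP (c1 * kappa) (\sum_(j | (lam j < 1) && (2 < mu j)) `|del j|).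
  exact: (le_trans acc1 (weighted_stat_power_spike hp hq mk mk' nk kn kn1 K1' Cf0 eta0 eta1
    (ltW K10) F11 hF1 ka1 hprof c10 hc1' hspike)).
have [I [S [SI hIln hIQ htail]]] := rate_budget pi d0 k3.
rewrite -/K -/kappa in hIln hIQ htail.
have [A [cardA massA]] := neighborhood_split hpi hqn S.
have [hmid|hmid] := leP (c2 * kappa)
    (\sum_(j | [&& lam j < 1, mu j <= 2 & j \in A]) `|del j|).
  pose D := [set j | [&& lam j < 1, mu j <= 2 & j \in A]]%SET.
  have DI : #|D|%:R <= 15 * I%:R :> R.
    rewrite -natrM ler_nat; apply: (@leq_trans #|A|).
      by apply: subset_leq_card; apply/fintype.subsetP => j; rewrite inE => /and3P[].
    by apply: (leq_trans cardA); rewrite leq_mul2l SI orbT.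
  have hD j : j \in D -> lam j <= 1 /\ mu j <= 2.
    by rewrite inE => /and3P[/ltW].
  have hmidD : c2 * kappa <= \sum_(j in D) `|del j|.
    by apply: (le_trans hmid); apply: eq_ler; apply: eq_bigl => j; rewrite inE.
  have Q0 : 0 <= Q by apply: sumr_ge0 => j _; rewrite mulr_ge0 ?sqr_ge0 ?expR_ge0.
  have [g1 g2] := collision_region_mean k4 hp hqn c20 hc2 ka0 H0 DI hIln hIQ
    ln1 Q0 hD hmidD.
  apply: (le_trans acc2); apply: le_trans (hcol g1 g2) _.
  by rewrite ler_peMl ?(ltW eta0)// ler1n.
pose B := fun j => [&& lam j < 1, mu j <= 2 & j \notin A].
have [massB negB] : (c - 2 * c1 - c2) * kappa <= \sum_(j | B j) `|del j| /\
    \sum_(j | ~~ B j && (p j < q j)) `|del j| <= (c1 + c2) * kappa.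
  exact: alternative_regions total hbig hspike hmid.
have lamB : \sum_(j | B j) lam j <= 480 * kappa.
  apply: (@le_trans _ _ (K * \sum_(j in ~: A) q j)).
    rewrite mulr_sumr [leLHS]big_mkcond [leRHS]big_mkcond; apply: ler_sum => j _ /=.
    rewrite /B !inE; case: (j \in A); rewrite ?andbF//= andbT.
    by case: ifP => // _; exact: lam0.
  clear -massA htail K0; have := ler_wpM2l (ltW K0) massA; lra.
have hB j : B j -> lam j <= 1 /\ mu j <= 2 by case/and3P => /ltW.
have MB : (c - 2 * c1 - c2 - 480) * kappa <= \sum_(j | B j) mu j.
  have : \sum_(j | B j) `|del j| <= \sum_(j | B j) mu j + \sum_(j | B j) lam j.
    rewrite -big_split; apply: ler_sum => j _ /=.
    have -> : del j = mu j - lam j by rewrite /del /mu /lam; ring.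
    by apply: le_trans (ler_normB _ _) _; rewrite !ger0_norm.
  by clear -massB lamB; lra.
have hLam : \sum_(j | B j) lam j + \sum_(j | ~~ B j && (p j < q j)) `|del j| <=
    (480 + c1 + c2) * kappa.
  by rewrite -[480 + c1 + c2]addrA mulrDl; apply: lerD.
have sKk : Num.sqrt K <= kappa.
  by rewrite -(@ler_pXn2r _ 2)// ?nnegrE ?sqrtr_ge0 ?(ltW ka0)// sqr_sqrtr ?(ltW K0).
have MBt : 4 * ((480 + c1 + c2) * kappa + 4 * (K3 * Num.sqrt K)) <= \sum_(j | B j) mu j.
  apply: le_trans MB.
  apply: (@le_trans _ _ (4 * (480 + c1 + c2 + 4 * K3) * kappa)).
    have : K3 * Num.sqrt K <= K3 * kappa by rewrite ler_wpM2l// ltW.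
    by clear; lra.
  by rewrite ler_wpM2r// ltW.
have t30 : 0 < K3 * Num.sqrt K by rewrite mulr_gt0 ?sqrtr_gt0.
apply: (le_trans acc3).
apply: le_trans (unseen_stat_power hp hq mk' nk kn K1' t30 hB hLam MBt) _.
have MB32 : 32 / eta <= \sum_(j | B j) mu j.
  apply: le_trans MB; apply: (le_trans ceta).
  by apply: ler_peMr ka1; apply: le_trans ceta; rewrite divr_ge0 ?ler0n// ltW.
have MB0 : 0 < \sum_(j | B j) mu j by apply: lt_le_trans MB32; exact: divr_gt0.
have m1 : 32 / (\sum_(j | B j) mu j) <= eta.
  by rewrite ler_pdivrMr// -ler_pdivrMl// mulrC.
have m2 : K / (K3 * Num.sqrt K) ^+ 2 <= eta.
  by apply: (markov_ratio eta0 K30 K0 ler01 _ hK3); rewrite mul1r.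
apply: (le_trans (lerD m1 m2)); clear -eta0; lra.
Qed.

Theorem corollary9 (R : realType) (gamma : R) (hgamma : 0 < gamma < 1) :
  exists c : R, 0 < c /\
    forall (d : nat) (pi : 'I_d -> R) (k : nat),
      (1 <= d)%N -> simplex R d pi -> (3 <= k)%N ->
      (separation_distance gamma (@H0_clo R d) (@H1_clo R d) pi k
         <= (c * closeness_rate pi k)%:E)%E.
Proof.
have [gamma0 gamma1] := andP hgamma.
have [eta [eta0 eta1 etaE]] : exists eta : R, [/\ 0 < eta, eta <= 1 & gamma = 3 * eta + 3 * eta].
  by exists (gamma / 6); split; [rewrite divr_gt0|lra|field].
have [Cf [Cf0 CfE]] : exists Cf : R, 0 < Cf /\ 15 / 2 * 256 = Cf.
  exists (15 / 2 * 256); split; last by reflexivity.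
  by apply: mulr_gt0; [apply: divr_gt0|]; rewrite ltr0n.
have [K1 [K1ge hK1 _]] := exists_large (576 * Cf) 0 eta0.
have [A1 [A10 A1E]] : exists A1 : R, 0 <= A1 /\ 600 * expR 8 * (4 * expR 8) = A1.
  exists (600 * expR 8 * (4 * expR 8)); split; last by reflexivity.
  by apply: mulr_ge0; apply: mulr_ge0; rewrite ?expR_ge0 ?ler0n.
have [K2 [K2ge hK2 _]] := exists_large (A1 * Cf) 0 eta0.
have [K3 [K3ge hK3 _]] := exists_large 1 0 eta0.
(* c1 and c2 are the multiples of kappa that make a region visible: c1 for the
   first two, c2 for the third.  The fourth one then gets c - 2 c1 - c2 of them. *)
have [c1 [c1ge hc1 hc1']] := exists_large
  (3 * Cf / eta * power_const Cf eta K1 * 64) (8 * power_const Cf eta K1 / eta) (@ltr01 R).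
rewrite mul1r in hc1.
have pos (x : R) : 1 <= x -> 0 < x by exact: lt_le_trans.
have [H [H0 hH]] := collision_stat_power eta0 (ltW (pos _ K2ge)) (ltW Cf0).
have [c2 [c2ge hc2 _]] := exists_large (120 * H) 0 (expR_gt0 (- 6 : R)).
have [c [c96 cbig ceta]] : exists c : R, [/\ 96 <= c,
    4 * (480 + c1 + c2 + 4 * K3) <= c - 2 * c1 - c2 - 480 &
    32 / eta <= c - 2 * c1 - c2 - 480].
  have e32 : 0 < 32 / eta by rewrite divr_gt0.
  exists (2 * c1 + c2 + 480 + 4 * (480 + c1 + c2 + 4 * K3) + 32 / eta + 96).
  by clear -c1ge c2ge K3ge e32; split; lra.
have c0 : 0 < c by apply: lt_le_trans c96; rewrite ltr0n.
exists c; split => // d pi k d0 hpi k3.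
have [Kka r0] := rate_ge_parametric pi k3.
have K0 : 0 < k%:R :> R by rewrite ltr0n (leq_trans _ k3).
(* From 32^2 on, 8 ln k <= k / 2; below, the rate is at least 1 / 32. *)
have [Ksmall|Klarge] := ltP (k%:R : R) (32 ^+ 2).
  apply: trivial_separation; first exact: ltW.
  clear -Kka r0 K0 Ksmall c96.
  set r := closeness_rate pi k in Kka r0 *.
  have h1 : 1 <= k%:R * r ^+ 2.
    by rewrite -(ler_pM2l K0) mulr1; apply: (le_trans Kka); apply: eq_ler; ring.
  have h2 : 1 <= (32 * r) ^+ 2.
    by apply: (le_trans h1); rewrite exprMn ler_wpM2r ?sqr_ge0//; exact: ltW.
  have h3 : 1 <= 32 * r.
    by rewrite -(@ler_pXn2r _ 2)// ?nnegrE ?expr1n//; rewrite mulr_ge0// ltW.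
  have : 96 * r <= c * r by rewrite ler_wpM2r// ltW.
  lra.
have k8 : (8 <= k)%N.
  by rewrite -(ler_nat R); apply: le_trans Klarge; clear; lra.
have k4 : (4 <= k)%N by exact: leq_trans k8.
have [m [n [kmn [mk mk' nk kn kn1]]]] := halve_sample R k8.
pose F := profile_energy k pi; pose Q := screened_energy k pi.
have F0 : 0 <= F by apply: sumr_ge0 => j _; exact: small_or_root_ge0.
have Q0 : 0 <= Q by apply: sumr_ge0 => j _; rewrite mulr_ge0 ?sqr_ge0 ?expR_ge0.
apply: (separation_distance_le (phi := fun x y => closeness_test k m
   (K1 * Num.sqrt (F + 1)) (K2 * Num.sqrt (Q + 1)) (K3 * Num.sqrt k%:R) x y)).
  exact: mulr_gt0.
have eta3 : 0 <= 3 * eta by rewrite mulr_ge0// ltW.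
rewrite etaE; apply: risk_le => //.
  move=> [p q] /= [_ hqn /= ->]; have hq := hqn.1.
  rewrite (prob_samplesE k hq hq).
  have hF := neighborhood_profile_le k hpi hqn; rewrite CfE in hF.
  have hQ := neighborhood_screened_le k hpi hqn; rewrite CfE in hQ.
  exact: (closeness_test_null hq kmn k4 mk nk eta0 (ltW Cf0) (pos _ K1ge) (pos _ K2ge)
    (pos _ K3ge) A1E A10 hK1 hK2 hK3 F0 Q0 hF hQ).
move=> [p q] /= [/= hp hqn hdist]; have hq := hqn.1.
have hF := neighborhood_profile_le k hpi hqn; rewrite CfE in hF.
have hQ := neighborhood_screened_le k hpi hqn; rewrite CfE in hQ.
rewrite (prob_samplesE k hp hq (fun x y => ~~ closeness_test k m
   (K1 * Num.sqrt (F + 1)) (K2 * Num.sqrt (Q + 1)) (K3 * Num.sqrt k%:R) x y)).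
exact: (closeness_test_power hqn d0 hpi kmn k4 Klarge mk mk' nk kn kn1 eta0 eta1 Cf0
  (pos _ K1ge) (pos _ K3ge) H0 hc1 hc1' (pos _ c1ge) hK3 hc2 (ltW (pos _ c2ge)) cbig ceta hF
  (hH d k p q hp hq Q k4 Klarge Q0 hQ) hdist).
Qed.
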